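(* Let $(G,b)$ be a $\mathbb{Z}_2$-coloured graph with $G$ connected. Then $\Gamma(G,b)$ is abelian if and only if $(G,b)$ has none of the following as a $\mathbb{Z}_2$-coloured graph minor: $(K_{3,3},b')$ with $b'$ of odd parity, $(K_5,b')$ with $b'$ of odd parity, $(K_{3,4},b')$ with $b'$ of even parity, and $(C_2\sqcup C_2,b')$ with $b'$ of any parity.
   Context: Graphs are finite, multiple edges allowed, no loops. $E(v)$ is the set of edges incident to $v$. A $\mathbb{Z}_2$-colouring is any function $b:V(G)\to\mathbb{Z}_2$, with parity $\sum_v b(v)\in\mathbb{Z}_2$. $\Gamma(G,b)$ is generated by $\{x_e:e\in E(G)\}\cup\{J\}$ with relations $J^2=x_e^2=1$, $[x_e,J]=1$, $[x_e,x_{e'}]=1$ whenever $e,e'\in E(v)$ for some $v$, and $\prod_{e\in E(v)}x_e=J^{b(v)}$ for every vertex $v$. $C_2$ is the two-vertex graph with two parallel edges; $C_2\sqcup C_2$ is the disjoint union of two copies. $K_{m,n}$ is the complete bipartite graph, $K_5$ the complete graph on $5$ vertices. $\mathbb{Z}_2$-coloured minor operations: (1) edge deletion $(G,b)\mapsto(G\setminus e,b)$; (2) contraction of an edge $e$ with endpoints $v_1,v_2$: merge them into a new vertex $u$, delete all edges between $v_1,v_2$, give $u$ colour $b(v_1)+b(v_2)$, others unchanged; (3) deletion of a vertex $v$ with $b(v)=0$ along with its incident edges; (4) edge toggling: add $1$ to the colours of both endpoints of an edge. $(H,c)$ is a $\mathbb{Z}_2$-coloured graph minor of $(G,b)$ if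 obtainable by a finite sequence of these operations. *)

(* Defs.v *)
From HB Require Import structures.
From Stdlib Require Export Relation_Operators.
From mathcomp Require Export all_boot all_order all_algebra.
From mathcomp Require Import boolp.

Set Implicit Arguments.
Unset Strict Implicit.
Unset Printing Implicit Defensive.

Local Open Scope quotient_scope.
Local Open Scope group_scope.

(* Groups given by generators and relations, as quotients of the words in the
   letters x (encoded (x, true)) and x^-1 (encoded (x, false)). *)

Definition word (X : choiceType) := seq (X * bool).

Definition wgen (X : choiceType) (x : X) : word X := [:: (x, true)].

Definition winv (X : choiceType) (w : word X) : word X :=
  rev [seq (a.1, ~~ a.2) | a <- w].

Definition wcomm (X : choiceType) (u v : word X) : word X :=
  winv u ++ winv v ++ u ++ v.

Section Presentation.

Variables (X : choiceType) (rels : word X -> word X -> Prop).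

Inductive wcongr : word X -> word X -> Prop :=
| wcongr_refl u : wcongr u u
| wcongr_sym u v : wcongr u v -> wcongr v u
| wcongr_trans u v w : wcongr u v -> wcongr v w -> wcongr u w
| wcongr_cat u u' v v' :
    wcongr u u' -> wcongr v v' -> wcongr (u ++ v) (u' ++ v')
| wcongr_cancel x s : wcongr [:: (x, s); (x, ~~ s)] [::]
| wcongr_rel u v : rels u v -> wcongr u v.

Definition wcongrb : rel (word X) := fun u v => `[< wcongr u v >].

Fact wcongrb_refl : reflexive wcongrb.
Proof. by move=> u; apply/asboolP/wcongr_refl. Qed.

Fact wcongrb_sym : symmetric wcongrb.
Proof. by move=> u v; apply/asboolP/asboolP => /wcongr_sym. Qed.

Fact wcongrb_trans : transitive wcongrb.
Proof.
by move=> v u w /asboolP uv /asboolP vw; apply/asboolP/(wcongr_trans uv).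
Qed.

Canonical wcongrb_equiv :=
  EquivRel wcongrb wcongrb_refl wcongrb_sym wcongrb_trans.

Definition presented := {eq_quot wcongrb_equiv}.

HB.instance Definition _ := Choice.on presented.

Definition wclass (w : word X) : presented := \pi_presented w.

Lemma wclassP (u v : word X) : wclass u = wclass v <-> wcongr u v.
Proof.
split=> [/eqP|uv]; first by rewrite eqmodE => /asboolP.
by apply/eqP; rewrite eqmodE; apply/asboolP.
Qed.

Lemma wclass_repr (x : presented) : wclass (repr x) = x.
Proof. exact: reprK. Qed.

Lemma repr_wclass (w : word X) : wcongr (repr (wclass w)) w.
Proof. by apply/wclassP; rewrite wclass_repr. Qed.

Lemma wcongr_catV (w : word X) : wcongr (w ++ winv w) [::].
Proof.
elim: w => [|[x s] w IHw]; first exact: wcongr_refl.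
rewrite /winv /= rev_cons -cats1 -cat_cons catA -cat1s -!catA.
apply: wcongr_trans (wcongr_cancel x s).
rewrite -[[:: (x, s); _]]/([:: (x, s)] ++ [::] ++ [:: (x, ~~ s)]).
apply: wcongr_cat; first exact: wcongr_refl.
by rewrite catA; apply: wcongr_cat; [exact: IHw | exact: wcongr_refl].
Qed.

Lemma winvK (w : word X) : winv (winv w) = w.
Proof.
rewrite /winv map_rev revK -map_comp -[RHS]map_id.
by apply: eq_map => -[x s] /=; rewrite negbK.
Qed.

Lemma wcongr_catVw (w : word X) : wcongr (winv w ++ w) [::].
Proof. by rewrite -{2}[w]winvK; apply: wcongr_catV. Qed.

Definition pres_one : presented := wclass [::].
Definition pres_mul (x y : presented) : presented := wclass (repr x ++ repr y).
Definition pres_inv (x : presented) : presented := wclass (winv (repr x)).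

Fact pres_mulA : associative pres_mul.
Proof.
move=> x y z; apply/wclassP; apply: (@wcongr_trans _ (repr x ++ repr y ++ repr z)).
  by apply: wcongr_cat; [exact: wcongr_refl | exact: repr_wclass].
rewrite catA; apply: wcongr_sym.
by apply: wcongr_cat; [exact: repr_wclass | exact: wcongr_refl].
Qed.

Fact pres_mul1 : left_id pres_one pres_mul.
Proof.
move=> x; rewrite -[RHS]wclass_repr; apply/wclassP; rewrite -[X in wcongr _ X]cat0s.
by apply: wcongr_cat; [exact: repr_wclass | exact: wcongr_refl].
Qed.

Fact pres_1mul : right_id pres_one pres_mul.
Proof.
move=> x; rewrite -[RHS]wclass_repr; apply/wclassP; rewrite -[X in wcongr _ X]cats0.
by apply: wcongr_cat; [exact: wcongr_refl | exact: repr_wclass].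
Qed.

Fact pres_mulV : left_inverse pres_one pres_inv pres_mul.
Proof.
move=> x; apply/wclassP; apply: wcongr_trans (wcongr_catVw (repr x)).
by apply: wcongr_cat; [exact: repr_wclass | exact: wcongr_refl].
Qed.

Fact pres_Vmul : right_inverse pres_one pres_inv pres_mul.
Proof.
move=> x; apply/wclassP; apply: wcongr_trans (wcongr_catV (repr x)).
by apply: wcongr_cat; [exact: wcongr_refl | exact: repr_wclass].
Qed.

HB.instance Definition _ := isGroup.Build presented
  pres_mulA pres_mul1 pres_1mul pres_mulV pres_Vmul.

Lemma wclassM (u v : word X) : wclass (u ++ v) = wclass u * wclass v.
Proof.
by apply/wclassP; apply: wcongr_sym; apply: wcongr_cat; exact: repr_wclass.
Qed.

End Presentation.

(* Finite multigraphs without loops: every edge has exactly two ends. *)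

Record mgraph := MGraph {
  vertex : finType;
  edge : finType;
  ends : edge -> {set vertex};
  card_ends : forall e, #|ends e| == 2
}.

Definition incident (G : mgraph) (v : vertex G) : {set edge G} :=
  [set e | v \in ends e].

Definition adjacent (G : mgraph) : rel (vertex G) :=
  fun v w => [exists e : edge G, ends e == [set v; w]].

Definition connected_graph (G : mgraph) : Prop :=
  forall v w : vertex G, connect (@adjacent G) v w.

Definition colouring (G : mgraph) := vertex G -> 'Z_2.

Definition parity (G : mgraph) (b : colouring G) : 'Z_2 :=
  (\sum_(v : vertex G) b v)%R.

Record cgraph := CGraph {
  graph_of :> mgraph;
  colour_of : colouring graph_of
}.

(* The group Gamma(G, b); None encodes the generator J and Some e encodes x_e. *)

Section Gamma.

Variables (G : mgraph) (b : colouring G).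

Definition gamma_gen : choiceType := option (edge G).

Definition genJ : word gamma_gen := wgen (None : gamma_gen).
Definition genx (e : edge G) : word gamma_gen := wgen (Some e : gamma_gen).

Inductive gamma_rel : word gamma_gen -> word gamma_gen -> Prop :=
| rel_JJ : gamma_rel (genJ ++ genJ) [::]
| rel_xx e : gamma_rel (genx e ++ genx e) [::]
| rel_xJ e : gamma_rel (wcomm (genx e) genJ) [::]
| rel_comm v e e' : e \in incident v -> e' \in incident v ->
    gamma_rel (wcomm (genx e) (genx e')) [::]
| rel_vertex v :
    gamma_rel (\big[cat/[::]]_(e in incident v) genx e)
              (flatten (nseq (b v : nat) genJ)).

Definition Gamma : groupType := presented gamma_rel.

End Gamma.

Section MinorOperations.

Variables (G : mgraph) (b : colouring G).

Definition del_edge_edge (e : edge G) : finType := {f : edge G | f != e}.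

Definition del_edge (e : edge G) : mgraph :=
  @MGraph (vertex G) (del_edge_edge e) (fun f => ends (val f))
    (fun f => card_ends (val f)).

Definition del_edge_col (e : edge G) : colouring (del_edge e) := b.

(* None is the new vertex; insub sends both ends of e to None and every other
   vertex w to Some w. *)
Definition contr_vertex (e : edge G) : finType :=
  option {w : vertex G | w \notin ends e}.

Definition contr_edge (e : edge G) : finType :=
  {f : edge G | ends f != ends e}.

Definition contr_proj (e : edge G) (w : vertex G) : contr_vertex e := insub w.

Definition contr_ends (e : edge G) (f : contr_edge e) : {set contr_vertex e} :=
  [set contr_proj e w | w in ends (val f)].

Fact card_contr_ends (e : edge G) (f : contr_edge e) : #|contr_ends f| == 2.
Proof.
rewrite card_in_imset ?card_ends // => v w vf wf; rewrite /contr_proj.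
case: insubP => [v' _ <-|]; first by case: insubP => [w' _ <- [->]|].
case: insubP => // /negPn we /negPn ve _; apply/eqP; apply: contraT => vw.
have eqf (g : edge G) : v \in ends g -> w \in ends g -> ends g = [set v; w].
  move=> vg wg; apply/esym/eqP; rewrite eqEcard cards2 vw (eqP (card_ends g)).
  by rewrite subUset !sub1set vg wg.
by move: (valP f); rewrite /= (eqf _ vf wf) (eqf _ ve we) eqxx.
Qed.

Definition contract (e : edge G) : mgraph := MGraph (@card_contr_ends e).

Definition contract_col (e : edge G) : colouring (contract e) :=
  fun u : contr_vertex e =>
    if u is Some w then b (val w) else (\sum_(v in ends e) b v)%R.

Definition del_vertex_vertex (v : vertex G) : finType :=
  {w : vertex G | w != v}.

Definition del_vertex_edge (v : vertex G) : finType :=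
  {f : edge G | f \notin incident v}.

Definition del_vertex_ends (v : vertex G) (f : del_vertex_edge v) :
  {set del_vertex_vertex v} := [set w | val w \in ends (val f)].

Fact card_del_vertex_ends (v : vertex G) (f : del_vertex_edge v) :
  #|del_vertex_ends f| == 2.
Proof.
rewrite -(eqP (card_ends (val f))) -(card_imset _ val_inj); apply/eqP/eq_card => w.
apply/imsetP/idP => [[w' + ->]|wf]; first by rewrite inE.
have wv : w != v by apply: contraTneq wf => ->; have := valP f; rewrite inE.
by exists (Sub w wv : del_vertex_vertex v); rewrite ?inE SubK.
Qed.

Definition del_vertex (v : vertex G) : mgraph :=
  MGraph (@card_del_vertex_ends v).

Definition del_vertex_col (v : vertex G) : colouring (del_vertex v) :=
  fun w : del_vertex_vertex v => b (val w).

Definition toggle (e : edge G) : colouring G :=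
  fun v => (if v \in ends e then b v + 1 else b v)%R.

End MinorOperations.

Arguments del_edge_col {G} b e.
Arguments contract_col {G} b e.
Arguments del_vertex_col {G} b v.
Arguments toggle {G} b e.

Inductive minor_step : cgraph -> cgraph -> Prop :=
| step_del_edge (G : mgraph) (b : colouring G) (e : edge G) :
    minor_step (CGraph b) (CGraph (del_edge_col b e))
| step_contract (G : mgraph) (b : colouring G) (e : edge G) :
    minor_step (CGraph b) (CGraph (contract_col b e))
| step_del_vertex (G : mgraph) (b : colouring G) (v : vertex G) :
    b v = 0%R -> minor_step (CGraph b) (CGraph (del_vertex_col b v))
| step_toggle (G : mgraph) (b : colouring G) (e : edge G) :
    minor_step (CGraph b) (CGraph (toggle b e)).

Definition cgraph_iso (G H : cgraph) : Prop :=
  exists (f : vertex G -> vertex H) (g : edge G -> edge H),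
    [/\ bijective f, bijective g,
        forall e, ends (g e) = [set f v | v in ends e]
      & forall v, colour_of (f v) = colour_of v].

(* Minors are taken up to isomorphism of coloured graphs. *)
Definition cgraph_minor (H G : cgraph) : Prop :=
  exists2 H' : cgraph, clos_refl_trans cgraph minor_step G H' & cgraph_iso H' H.

Definition Kmn_ends (m n : nat) (e : 'I_m * 'I_n) : {set 'I_m + 'I_n} :=
  [set inl e.1; inr e.2].

Fact card_Kmn_ends (m n : nat) (e : 'I_m * 'I_n) : #|Kmn_ends e| == 2.
Proof. by rewrite cards2. Qed.

Definition Kmn (m n : nat) : mgraph := MGraph (@card_Kmn_ends m n).

Definition Kn_edge (n : nat) : finType := {A : {set 'I_n} | #|A| == 2}.

Definition Kn (n : nat) : mgraph :=
  @MGraph 'I_n (Kn_edge n) (fun A => val A) (fun A => valP A).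

Fact card_C2_ends (e : bool) : #|[set: bool]| == 2.
Proof. by rewrite cardsT card_bool. Qed.

Definition C2 : mgraph := @MGraph bool bool (fun=> [set: bool]) card_C2_ends.

Definition disj_ends (G H : mgraph) (e : edge G + edge H) :
    {set vertex G + vertex H} :=
  match e with
  | inl f => [set inl v | v in ends f]
  | inr f => [set inr v | v in ends f]
  end.

Fact card_disj_ends (G H : mgraph) (e : edge G + edge H) : #|disj_ends e| == 2.
Proof. by case: e => f; rewrite card_imset ?card_ends // => x y []. Qed.

Definition disj_union (G H : mgraph) : mgraph := MGraph (@card_disj_ends G H).

(* Main.v *)
(* Gamma(G, b) is commutative iff in every group the elements x_e, J subject to its
   relations commute. A solution for a minor extends to a solution for the graph (a
   deleted edge gets the value 1, a contracted edge the value forced by one of its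
   ends), so it suffices to exhibit noncommuting solutions for the four forbidden
   graphs; they are found among real Pauli operators.

   Conversely, contracting an edge at a vertex of degree at most two does not change
   the group, so one may assume minimum degree three. Excluding C2 + C2 means that
   there are no two disjoint cycles, and by Lovász's theorem the graph then either
   becomes a forest after deleting a vertex, or is a wheel with multiple spokes, or
   K5, or is covered by three vertices joined once to each of the remaining, pairwise
   nonadjacent, vertices. In each case the relations can be solved by hand; the magic
   square and pentagram identities give commutativity precisely when the parity is
   even, and the opposite parity is ruled out by the forbidden minors. Lovász's
   theorem is proved by edge counting: a set of vertices is called cyclic when it
   spans at least as many edges as it has vertices, and a tree is a set of an acyclic
   graph that spans one edge less. *)

From HB Require Import structures.
Require Import Defs.
From mathcomp Require Import boolp zify.

Set Implicit Arguments.
Unset Strict Implicit.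
Unset Printing Implicit Defensive.

Import GRing.Theory.

(** * Multigraphs without two disjoint cycles *)

(** Toggling all edges of a path changes only the colours of its two ends. So on a connected graph
    only the parity of the colouring matters, and one noncommuting solution of the right parity
    settles a connected forbidden graph. Connectedness of G also turns two disjoint cycles into the
    minor C2 + C2: an outside vertex of colour 1 cannot be deleted, but it can be contracted into a
    cycle.

    The reduction to minimum degree three has one obstacle: contracting an edge deletes its
    parallels. A parallel pair at a vertex of degree at most two is therefore not contracted;
    without disjoint cycles, deleting the other end of the pair already leaves a forest.

    The numbers 3 and 4 arise as follows. Let n vertices be joined once to each of three covering
    vertices. Surplus vertices can be contracted into a covering vertex, which keeps the parity. So
    odd parity with n >= 3 is excluded by K_{3,3}, even parity with n >= 4 by K_{3,4}; even parity
    with n = 3 is the magic square, and for n <= 2 the vertex relations alone give commutativity. *)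

Lemma disjoint_setD (T : finType) (A B : {set T}) : [disjoint A & B :\: A].
Proof. by rewrite disjoints_subset; apply/subsetP => x xA; rewrite !inE xA. Qed.

Lemma setD_subK (T : finType) (A B : {set T}) : A \subset B -> A :|: (B :\: A) = B.
Proof.
move=> /subsetP sAB; apply/setP => x; rewrite !inE.
by case: (boolP (x \in A)) => // /sAB.
Qed.

Lemma sum_const_tight (T : finType) (S : {set T}) (f : T -> nat) k :
  (forall i, i \in S -> k <= f i) -> \sum_(i in S) f i = #|S| * k ->
  forall i, i \in S -> f i = k.
Proof.
move=> gek sumE i iS; apply/eqP; rewrite eqn_leq gek // andbT.
have : \sum_(j in S :\ i) k <= \sum_(j in S :\ i) f j.
  by apply: leq_sum => j; rewrite !inE => /andP[_]; apply: gek.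
move: sumE; rewrite (big_setD1 i) //= sum_nat_const (cardsD1 i S) iS mulnDl mul1n.
clear; lia.
Qed.

(** * Edge counts, forests and trees *)

Section EdgeCounting.

Variables (V : finType) (m : V -> V -> nat).

Definition edges_to (v : V) (S : {set V}) := \sum_(u in S) m v u.

Definition edges_between (A B : {set V}) := \sum_(u in A) edges_to u B.

(* The half is exact when [m] is symmetric and vanishes on the diagonal. *)
Definition edges_in (S : {set V}) := (edges_between S S)./2.

Definition cyclic_set (S : {set V}) := 0 < #|S| <= edges_in S.

Definition acyclic (F : {set V}) :=
  forall X : {set V}, X \subset F -> X != set0 -> edges_in X < #|X|.

Definition no_disjoint_cycles :=
  forall X Y : {set V}, cyclic_set X -> cyclic_set Y -> ~~ [disjoint X & Y].

Definition tree (T : {set V}) := (edges_in T).+1 = #|T|.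

Notation dg := edges_to.
Notation cr := edges_between.
Notation ein := edges_in.

Hypotheses (m_sym : forall u v, m u v = m v u) (m_irr : forall v, m v v = 0).

Lemma edges_to1 v u : dg v [set u] = m v u.
Proof. exact: big_set1. Qed.

Lemma edges_toU v (A B : {set V}) :
  [disjoint A & B] -> dg v (A :|: B) = dg v A + dg v B.
Proof. by move=> dAB; rewrite /edges_to -bigU //=; apply: eq_bigl => u; rewrite inE. Qed.

Lemma edges_toU1 v u (S : {set V}) :
  u \notin S -> dg v (u |: S) = m v u + dg v S.
Proof. by move=> uS; rewrite /edges_to big_setU1. Qed.

Lemma edges_toD1 v u (S : {set V}) :
  u \in S -> dg v S = m v u + dg v (S :\ u).
Proof. by move=> uS; rewrite /edges_to (big_setD1 u). Qed.

Lemma edges_toD1_self v (S : {set V}) : dg v (S :\ v) = dg v S.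
Proof.
case: (boolP (v \in S)) => vS; first by rewrite (edges_toD1 v vS) m_irr.
by congr dg; apply/setDidPl; rewrite disjoint_sym disjoints1.
Qed.

Lemma edges_to_sub v (A B : {set V}) : A \subset B -> dg v A <= dg v B.
Proof.
move=> /setIidPr sAB; rewrite /edges_to [leqRHS](big_setID A) /= sAB.
exact: leq_addr.
Qed.

Lemma edges_to_ge v u (S : {set V}) : u \in S -> m v u <= dg v S.
Proof. by move=> uS; rewrite (edges_toD1 v uS) leq_addr. Qed.

Lemma edges_to_gt0P v (S : {set V}) :
  reflect (exists2 u, u \in S & 0 < m v u) (0 < dg v S).
Proof.
apply: (iffP idP) => [|[u uS vu]]; last first.
  exact: leq_trans vu (edges_to_ge _ uS).
rewrite lt0n sum_nat_eq0 negb_forall => /existsP[u].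
by rewrite negb_imply -lt0n => /andP[]; exists u.
Qed.

Lemma edges_betweenC (A B : {set V}) : cr A B = cr B A.
Proof.
rewrite /edges_between /edges_to exchange_big /=.
by apply: eq_bigr => i _; apply: eq_bigr.
Qed.

Lemma edges_betweenUl (A B C : {set V}) :
  [disjoint A & B] -> cr (A :|: B) C = cr A C + cr B C.
Proof. by move=> dAB; rewrite /edges_between -bigU //=; apply: eq_bigl => u; rewrite inE. Qed.

Lemma edges_betweenUr (A B C : {set V}) :
  [disjoint A & B] -> cr C (A :|: B) = cr C A + cr C B.
Proof. by move=> dAB; rewrite edges_betweenC edges_betweenUl // !(edges_betweenC C). Qed.

Lemma edges_between1l v (A : {set V}) : cr [set v] A = dg v A.
Proof. by rewrite /edges_between big_set1. Qed.

Lemma edges_between1r v (A : {set V}) : cr A [set v] = dg v A.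
Proof. by rewrite edges_betweenC edges_between1l. Qed.

Lemma edges_between0 (A : {set V}) : cr A set0 = 0.
Proof. by rewrite edges_betweenC /edges_between big_set0. Qed.

Lemma edges_between_even (S : {set V}) : ~~ odd (cr S S).
Proof.
have [n] := ubnP #|S|; elim: n S => // n IHn S ltn.
have [->|[v vS]] := set_0Vmem S; first by rewrite edges_between0.
have dv : [disjoint [set v] & S :\ v] by rewrite disjoints1 !inE eqxx.
rewrite -(setD1K vS) edges_betweenUl // !edges_betweenUr //.
rewrite !edges_between1l edges_between1r edges_to1 m_irr.
have /IHn : #|S :\ v| < n by move: ltn; rewrite (cardsD1 v S) vS; lia.
by rewrite !oddD; case: (odd _) => //=; case: (odd _).
Qed.

Lemma edges_in_double (S : {set V}) : (ein S).*2 = cr S S.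
Proof. by rewrite -[RHS]odd_double_half (negbTE (edges_between_even S)). Qed.

Lemma edges_in0 : ein set0 = 0.
Proof. by rewrite /edges_in edges_between0. Qed.

Lemma edges_inU (A B : {set V}) :
  [disjoint A & B] -> ein (A :|: B) = ein A + ein B + cr A B.
Proof.
move=> dAB; apply: double_inj.
rewrite !doubleD !edges_in_double edges_betweenUl // !edges_betweenUr //.
rewrite (edges_betweenC B A); lia.
Qed.

Lemma edges_in1 v : ein [set v] = 0.
Proof. by rewrite /edges_in edges_between1l edges_to1 m_irr. Qed.

Lemma edges_inU1 v (S : {set V}) :
  v \notin S -> ein (v |: S) = ein S + dg v S.
Proof.
move=> vS; rewrite edges_inU ?disjoints1 // edges_in1 edges_between1l; lia.
Qed.

Lemma edges_inD1 v (S : {set V}) :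
  v \in S -> ein S = ein (S :\ v) + dg v S.
Proof.
move=> vS; rewrite -{1}(setD1K vS) edges_inU1 ?setD11 //.
by rewrite edges_toD1_self.
Qed.

Lemma edges_in2 u v : u != v -> ein [set u; v] = m u v.
Proof. by move=> uv; rewrite edges_inU1 ?inE // edges_in1 edges_to1. Qed.

Lemma edges_in_sum (S : {set V}) : \sum_(v in S) dg v S = (ein S).*2.
Proof. by rewrite edges_in_double. Qed.

Lemma acyclic_sub (A B : {set V}) : A \subset B -> acyclic B -> acyclic A.
Proof. by move=> sAB acB X sX; apply: acB; apply: subset_trans sAB. Qed.

Lemma acyclicVcyclic (F : {set V}) :
  acyclic F \/ exists2 X : {set V}, X \subset F & cyclic_set X.
Proof.
have [/existsP[X /andP[sX cX]]|/existsPn H] :=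
  boolP [exists X : {set V}, (X \subset F) && cyclic_set X]; first by right; exists X.
left=> X sX X0; have := H X; rewrite sX /= /cyclic_set card_gt0 X0 /=.
by rewrite ltnNge.
Qed.

Lemma acyclicPn (F : {set V}) :
  ~ acyclic F -> exists2 X : {set V}, X \subset F & cyclic_set X.
Proof. by case: (acyclicVcyclic F). Qed.

Lemma acyclic_or (F : {set V}) : acyclic F \/ ~ acyclic F.
Proof.
case: (acyclicVcyclic F) => [|[X sX cX]]; [by left | right=> acF].
by case/andP: cX => X0; rewrite leqNgt acF // -card_gt0.
Qed.

Lemma cyclic_set_n0 (X : {set V}) : cyclic_set X -> X != set0.
Proof. by case/andP; rewrite card_gt0. Qed.

Lemma cyclic_card_gt1 (X : {set V}) : cyclic_set X -> 1 < #|X|.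
Proof.
move=> /andP[]; rewrite leq_eqVlt => /orP[/eqP/esym/eqP/cards1P[x ->]|//].
by rewrite edges_in1 cards1.
Qed.

Lemma cyclic_setI F : acyclic F ->
  forall X : {set V}, cyclic_set X -> exists2 x, x \in X & x \notin F.
Proof.
move=> acF X cX; apply/subsetPn; apply/negP => sXF.
by have := acF X sXF (cyclic_set_n0 cX); case/andP: cX; lia.
Qed.

(* A maximal set with at least [#|T| - 1] edges around a given one is a
   connected component, so connectedness never has to be mentioned. *)
Lemma component_exists (F T0 : {set V}) :
  acyclic F -> T0 \subset F -> T0 != set0 -> #|T0| <= (ein T0).+1 ->
  exists T : {set V}, [/\ T0 \subset T, T \subset F, tree T
    & forall t, t \in T -> dg t (F :\: T) = 0].
Proof.
move=> acF sT0 n0 geT0.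
pose P := [pred T : {set V} | (T \subset F) && (#|T| <= (ein T).+1)].
have PT0 : P T0 by rewrite inE sT0.
have [T /maxsetP[/andP[sTF geT] Tmax] sT0T] := maxset_exists PT0.
have Tn0 : T != set0 by apply: contraNneq n0 => T_0; rewrite -subset0 -T_0.
exists T; split=> // [|t tT].
  by have := acF T sTF Tn0; rewrite /tree; lia.
apply/eqP; rewrite -leqn0 leqNgt; apply/negP => /edges_to_gt0P[u].
rewrite inE => /andP[uT uF] tu.
have PuT : P (u |: T).
  rewrite !inE /= subUset sub1set uF sTF /= cardsU1 uT edges_inU1 //.
  by move: geT tu; have := edges_to_ge u tT; rewrite m_sym; clear; lia.
have uTE := Tmax _ PuT (subsetUr _ _).
by move: uT; rewrite -uTE setU11.
Qed.

Lemma component_of (F : {set V}) x :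
  acyclic F -> x \in F ->
  exists T : {set V}, [/\ x \in T, T \subset F, tree T
    & forall t, t \in T -> dg t (F :\: T) = 0].
Proof.
move=> acF xF; have [||| T [xT sT tT clT]] := @component_exists F [set x] acF.
- by rewrite sub1set.
- by apply/set0Pn; exists x; rewrite inE.
- by rewrite cards1.
by exists T; split; rewrite // -sub1set.
Qed.

Lemma edges_between_closed (F T : {set V}) :
  (forall t, t \in T -> dg t (F :\: T) = 0) -> cr T (F :\: T) = 0.
Proof. by move=> cl; rewrite /edges_between big1. Qed.

Lemma tree_n0 (T : {set V}) : tree T -> T != set0.
Proof. by move=> tT; rewrite -card_gt0 -tT. Qed.

Lemma tree1 v : tree [set v].
Proof. by rewrite /tree edges_in1 cards1. Qed.

Lemma tree_edge_to (T : {set V}) t :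
  acyclic T -> tree T -> 1 < #|T| -> t \in T -> 0 < dg t T.
Proof.
move=> acT tT gt1 tinT; have := acT (T :\ t) (subsetDl _ _).
move: gt1 tT; rewrite /tree (edges_inD1 tinT) (cardsD1 t) tinT => gt1 tT.
rewrite -card_gt0; lia.
Qed.

(** A tree is one edge short of being cyclic and [v] adds one more vertex, so two edges from [v],
    possibly parallel, make up the difference. *)
Lemma tree_cyclic v (T : {set V}) :
  tree T -> v \notin T -> 1 < dg v T -> cyclic_set (v |: T).
Proof.
move=> tT vT gt1; rewrite /cyclic_set cardsU1 vT edges_inU1 //.
move: tT; rewrite /tree; lia.
Qed.

Lemma tree_leaf_removal (T : {set V}) l :
  tree T -> l \in T -> dg l T = 1 -> tree (T :\ l).
Proof.
move=> + lT dl; rewrite /tree (edges_inD1 lT) (cardsD1 l T) lT dl; lia.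
Qed.

(** The degrees in a tree sum to 2|T| - 2 and are all positive, so at least two of them equal
    one. *)
Lemma two_leaves (T : {set V}) :
  acyclic T -> tree T -> 1 < #|T| ->
  exists l l', [/\ l \in T, l' \in T, l != l', dg l T = 1 & dg l' T = 1].
Proof.
move=> acT tT gt1.
have dgpos := tree_edge_to acT tT gt1.
pose L := [set l in T | dg l T == 1].
have sLT : L \subset T by apply/subsetP => x; rewrite inE => /andP[].
suff /card_gt1P[l [l' [+ + ll']]] : 1 < #|L|.
  rewrite !inE => /andP[lT /eqP dl] /andP[l'T /eqP dl'].
  by exists l, l'.
have := edges_in_sum T; rewrite (big_setID L) /= (setIidPr sLT) => sumE.
have geL : #|L| <= \sum_(v in L) dg v T.
  rewrite -sum1_card; apply: leq_sum => l lL; apply: dgpos.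
  exact: (subsetP sLT).
have geC : #|T :\: L| * 2 <= \sum_(v in T :\: L) dg v T.
  rewrite -sum_nat_const; apply: leq_sum => l; rewrite !inE => /andP[+ lT].
  by rewrite lT /= => d1; have := dgpos _ lT; lia.
have := cardsID L T; rewrite (setIidPr sLT).
move: tT; rewrite /tree; lia.
Qed.

Lemma acyclic_leaf (F : {set V}) :
  acyclic F -> F != set0 -> exists2 l, l \in F & dg l F <= 1.
Proof.
move=> acF n0; apply/exists_inP; apply: contraT.
rewrite negb_exists_in => /forall_inP H.
have : #|F| * 2 <= \sum_(v in F) dg v F.
  by rewrite -sum_nat_const; apply: leq_sum => v /H; rewrite -ltnNge.
rewrite edges_in_sum; have := acF F (subxx _) n0; lia.
Qed.

(** A new cycle runs through [v] and a single component of [F]: if it used several, one of them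
    together with [v] would already be cyclic. That component receives two edges from [v]. *)
Lemma extend_acyclic (F : {set V}) v :
  acyclic F -> v \notin F -> ~ acyclic (v |: F) ->
  exists T : {set V}, [/\ T \subset F, tree T,
    forall t, t \in T -> dg t (F :\: T) = 0 & 1 < dg v T].
Proof.
move=> acF vF /acyclicPn[X sX cX].
pose P := [pred Y : {set V} | (Y \subset F) && cyclic_set (v |: Y)].
have vX : v \in X.
  have [x xX] := cyclic_setI acF cX.
  by have := subsetP sX x xX; rewrite !inE => /orP[/eqP<-|->].
have PX : P (X :\ v).
  by rewrite !inE /= setD1K // cX andbT subDset.
have [Y /minsetP[/andP[sYF cY] Ymin] _] := minset_exists PX.
have vY (Z : {set V}) : Z \subset F -> v \notin Z by move/subsetP/(_ v)/contra; apply.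
have [y yY] : exists y, y \in Y.
  apply/set0Pn; apply: contraTneq cY => ->; rewrite setU0.
  by apply/negP => /cyclic_card_gt1; rewrite cards1.
have acY := acyclic_sub sYF acF.
have [T [yT sTY tT clT]] := component_of acY yY.
have YE : Y = T :|: (Y :\: T) by rewrite setD_subK.
have cE : #|Y| = #|T| + #|Y :\: T|.
  by rewrite -(cardsID T Y) (setIidPr sTY).
(* If [T] were a proper part of [Y], minimality would make neither [v |: T] nor [v |: (Y :\: T)]
   cyclic; adding the two inequalities contradicts the cyclicity of [v |: Y]. *)
have TY : T = Y.
  apply/eqP; case: (eqVneq T Y) => // nTY.
  have Y'n0 : Y :\: T != set0 by rewrite setD_eq0; apply: contra nTY; rewrite eqEsubset sTY.
  have sY'F := subset_trans (subsetDl Y T) sYF.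
  have nT : ~~ cyclic_set (v |: T).
    apply: contra nTY => cT; apply/eqP; apply: Ymin => //.
    by rewrite inE /= cT (subset_trans sTY).
  have nY' : ~~ cyclic_set (v |: (Y :\: T)).
    apply/negP => cY'.
    have Y'Y : Y :\: T = Y by apply: Ymin; rewrite ?subsetDl // inE /= cY' sY'F.
    by move: yY; rewrite -Y'Y inE yT.
  have einY : ein Y = ein T + ein (Y :\: T).
    by rewrite {1}YE edges_inU ?disjoint_setD // edges_between_closed // addn0.
  have dgY : dg v Y = dg v T + dg v (Y :\: T).
    by rewrite {1}YE edges_toU // disjoint_setD.
  move: cY nT nY'; rewrite /cyclic_set !cardsU1 !vY ?(subset_trans sTY) //.
  rewrite !edges_inU1 ?vY ?(subset_trans sTY) // einY dgY cE; clear; lia.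
(* [Y] is a tree but need not be closed in [F]; enlarging it to a closed tree can only add edges
   from [v]. *)
have [||| T' [sTT' sT'F tT' clT']] := @component_exists F T acF.
- by rewrite TY.
- exact: tree_n0.
- by rewrite tT.
exists T'; split=> //; apply: leq_trans (edges_to_sub v sTT').
move: cY tT; rewrite -TY /cyclic_set /tree cardsU1 edges_inU1 ?vY ?TY //; clear; lia.
Qed.

(** Otherwise [T] would fall into two nonempty forests, inside and outside [T'], with no edge
    between them, and would span at most |T| - 2 edges. *)
Lemma closed_trees_eq (F T T' : {set V}) :
  acyclic F -> T \subset F -> T' \subset F -> tree T ->
  (forall t, t \in T' -> dg t (F :\: T') = 0) ->
  ~~ [disjoint T & T'] -> T \subset T'.
Proof.
move=> acF sT sT' tT clT'; rewrite -setI_eq0 => nd.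
apply: contraT; rewrite -setD_eq0 => nD.
have cE := cardsID T' T.
have TE : ein T = ein (T :&: T') + ein (T :\: T').
  rewrite -{1}(setID T T') edges_inU; last first.
    by rewrite disjoints_subset; apply/subsetP => x; rewrite !inE => /andP[_ ->].
  suff -> : cr (T :&: T') (T :\: T') = 0 by rewrite addn0.
  rewrite /edges_between big1 // => x; rewrite inE => /andP[_ /clT' d0].
  by apply/eqP; rewrite -leqn0 -d0; apply/edges_to_sub/setSD.
have := acF _ (subset_trans (subsetIl T T') sT) nd.
have := acF _ (subset_trans (subsetDl T T') sT) nD.
move: tT; rewrite /tree; lia.
Qed.

(** [X] is the component of [s] after deletion of [t]. All edges from [X] to the rest end at [t],
    and there is only one, since two would make [t |: X] cyclic; counting edges then shows that the
    rest is a tree. *)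
Lemma tree_split (T : {set V}) s t :
  acyclic T -> tree T -> s \in T -> t \in T -> 0 < m s t ->
  exists X Y : {set V},
    [/\ X :|: Y = T, [disjoint X & Y], s \in X, t \in Y & tree X /\ tree Y].
Proof.
move=> acT tT sT tinT st.
have nst : s != t by apply: contraTneq st => ->; rewrite m_irr.
have acTt := acyclic_sub (subsetDl T [set t]) acT.
have [||X [sX sXT tX clX]] := @component_of (T :\ t) s => //.
  by rewrite !inE nst.
have sXT' := subset_trans sXT (subsetDl _ _).
have tX' : t \notin X by apply: contraTN isT => /(subsetP sXT); rewrite !inE eqxx.
have TE := setD_subK sXT'.
exists X, (T :\: X); split=> //; first exact: disjoint_setD.
  by rewrite inE tX'.
split=> //.
have crE : cr X (T :\: X) = dg t X.
  rewrite edges_betweenC /edges_between (big_setD1 t) /=; last by rewrite inE tX'.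
  rewrite big1 ?addn0 // => u; rewrite !inE => /and3P[ut uX uT].
  apply/eqP; rewrite sum_nat_eq0; apply/forall_inP => x xX.
  rewrite -leqn0 -(clX x xX) m_sym; apply: edges_to_ge.
  by rewrite !inE uX ut.
have : ein (t |: X) < #|t |: X|.
  by apply: acT; rewrite ?subUset ?sub1set ?tinT // -card_gt0 cardsU1 tX'.
have := edges_to_ge t sX; rewrite m_sym.
have := cardsID X T; rewrite (setIidPr sXT').
have := edges_inU (disjoint_setD X T); rewrite TE crE.
rewrite cardsU1 tX' edges_inU1 //.
move: tT tX; rewrite /tree; lia.
Qed.

(** The hub is [w], and spokes may be multiple. The rim is only required to be 2-regular, which
    admits a digon; that it is a single cycle is later drawn from the absence of disjoint cycles. *)
Definition simple_wheel := exists w, forall h, h != w -> dg h (~: [set w]) = 2.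

(** This is K_{3,n} with arbitrary multiple edges added among the three vertices of the first
    side. *)
Definition three_covered := exists v w c, [/\ v != w, v != c, w != c
  & forall b, b \notin [set v; w; c] ->
    [/\ m b v = 1, m b w = 1, m b c = 1
      & forall b', b' \notin [set v; w; c] -> m b b' = 0]].

Definition complete5 := #|V| = 5 /\ forall u v, u != v -> m u v = 1.

Hypothesis deg3 : forall v, 3 <= dg v setT.
Hypothesis ndc : no_disjoint_cycles.

Lemma degree_sum (X : {set V}) : 3 * #|X| <= (ein X).*2 + cr X (~: X).
Proof.
rewrite edges_in_double -edges_betweenUr ?setUCr; last by rewrite -setTD disjoint_setD.
by rewrite mulnC -sum_nat_const; apply: leq_sum.
Qed.

Lemma ndc_acyclic (X : {set V}) : cyclic_set X -> acyclic (~: X).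
Proof.
move=> cX Y sY Y0; rewrite ltnNge; apply/negP => leY.
have cY : cyclic_set Y by rewrite /cyclic_set card_gt0 Y0.
by have := ndc cY cX; rewrite disjoints_subset sY.
Qed.

(** * Two vertices that meet every cycle *)

Section TwoVertexFeedback.

Variables (v w : V) (T : {set V}).
Hypotheses (vw : v != w) (TE : T = ~: [set v; w]) (acT : acyclic T).

Let vT : v \notin T. Proof. by rewrite TE !inE eqxx. Qed.
Let wT : w \notin T. Proof. by rewrite TE !inE eqxx orbT. Qed.

Let compl1 u : u \notin T -> ~: [set u] = (if u == v then w else v) |: T.
Proof.
move=> uT; apply/setP => x; rewrite TE !inE.
move: uT; rewrite TE !inE negbK => /orP[]/eqP->.
  by rewrite eqxx; case: (eqVneq x w) => [->|]; rewrite ?orbF ?andbT // eq_sym (negbTE vw).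
rewrite (eq_sym w) (negbTE vw); by case: (eqVneq x v) => [->|].
Qed.

Lemma feedback_degree t : dg t setT = m t v + m t w + dg t T.
Proof.
have -> : setT = v |: (w |: T).
  by apply/setP => x; rewrite TE !inE; case: eqP => //; case: eqP.
rewrite !edges_toU1 ?addnA //; first by rewrite !inE negb_or vw.
Qed.

(** Each of [v] and [w] closes a cycle with some component of [T]; the two cycles meet, so it is the
    same component [A]. Another component [B] receives at most one edge from [v] and one from [w],
    since more would give a cycle disjoint from that of the other vertex with [A]. *)
Lemma feedback_tree :
  ~ acyclic (~: [set v]) -> ~ acyclic (~: [set w]) ->
  [/\ tree T, 1 < dg v T & 1 < dg w T].
Proof.
rewrite !compl1 // eqxx eq_sym (negbTE vw) => nv nw.
have [A [sA tA clA dA]] := extend_acyclic acT vT nw.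
have [B [sB tB clB dB]] := extend_acyclic acT wT nv.
have nvA : v \notin A by apply: contra vT; apply: (subsetP sA).
have nwB : w \notin B by apply: contra wT; apply: (subsetP sB).
have ndAB : ~~ [disjoint A & B].
  have := ndc (tree_cyclic tA nvA dA) (tree_cyclic tB nwB dB).
  apply: contra => dAB; rewrite disjoints_subset; apply/subsetP => x.
  rewrite !inE => /orP[/eqP->|xA].
    by rewrite negb_or vw /=; apply: contra vT; apply: (subsetP sB).
  rewrite negb_or (disjointFr dAB xA) andbT.
  by apply: contra wT => /eqP<-; apply: (subsetP sA).
have AB : A = B.
  apply/eqP; rewrite eqEsubset (closed_trees_eq acT) //=.
  by apply: (closed_trees_eq acT) => //; rewrite disjoint_sym.
rewrite -AB in dB; clear B sB tB clB nwB ndAB AB.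
suff TA : T = A by rewrite TA.
apply/eqP; rewrite eqEsubset sA andbT -setD_eq0; apply: contraT => n0.
have [x xD] := set0Pn _ n0.
have acD := acyclic_sub (subsetDl T A) acT.
have [B [xB sB tB clB]] := component_of acD xD.
have sBT := subset_trans sB (subsetDl _ _).
have dAB : [disjoint A & B].
  rewrite disjoints_subset; apply/subsetP => y yA; rewrite inE.
  by apply/negP => /(subsetP sB); rewrite inE yA.
have nvB : v \notin B by apply: contra vT; apply: (subsetP sBT).
have nwB : w \notin B by apply: contra wT; apply: (subsetP sBT).
have dis p q : p != q -> p \notin T -> q \notin T -> [disjoint p |: A & q |: B].
  move=> pq pT qT; rewrite disjoints_subset; apply/subsetP => y.
  rewrite !inE => /orP[/eqP->|yA]; rewrite negb_or.
    by rewrite pq; apply: contra pT; apply: (subsetP sBT).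
  rewrite (disjointFr dAB yA) andbT.
  by apply: contra qT => /eqP<-; apply: (subsetP sA).
have leB p q : p != q -> p \notin T -> q \notin T -> 1 < dg p A -> dg q B <= 1.
  move=> pq pT qT dpA; rewrite leqNgt; apply/negP => dqB.
  have pA : p \notin A by apply: contra pT; apply: (subsetP sA).
  have qB : q \notin B by apply: contra qT; apply: (subsetP sBT).
  by have := ndc (tree_cyclic tA pA dpA) (tree_cyclic tB qB dqB); rewrite dis.
have := leB _ _ vw vT wT dA; have := leB w v; rewrite eq_sym vw => /(_ isT wT vT dB).
(* At most two edges leave the tree [B], so its degrees sum to at most 2(|B| - 1) + 2, which is less
   than 3|B|. *)
have := degree_sum B.
have -> : cr B (~: B) = dg v B + dg w B.
  have -> : ~: B = [set v; w] :|: (T :\: B).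
    apply/setP => y; rewrite !inE; case: (boolP (y \in B)) => yB; last first.
      by rewrite TE !inE; case: (y == v); case: (y == w).
    by rewrite orbF; have := subsetP sBT y yB; rewrite TE !inE => /negbTE->.
  rewrite edges_betweenUr; last first.
    rewrite disjoints_subset; apply/subsetP => y yvw.
    by rewrite !inE negb_and; apply/orP; right; rewrite TE inE negbK.
  rewrite [X in _ + X](_ : _ = 0) ?addn0; last first.
    rewrite /edges_between big1 // => y yB; apply/eqP; rewrite -leqn0.
    have -> : T :\: B = A :|: ((T :\: A) :\: B).
      apply/setP => z; rewrite !inE; case: (boolP (z \in A)) => //= zA.
      by rewrite (disjointFr dAB zA) (subsetP sA).
    rewrite edges_toU; last first.
      by rewrite disjoints_subset; apply/subsetP => z zA; rewrite !inE zA andbF.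
    rewrite clB // addn0 leqn0 sum_nat_eq0; apply/forall_inP => a aA.
    rewrite -leqn0 -(clA a aA) m_sym; apply: edges_to_ge.
    by have := subsetP sB y yB.
  rewrite edges_betweenUr ?disjoints1 ?inE // !edges_between1r //.
move: tB; rewrite /tree; clear; lia.
Qed.

Definition simple_leaf x := [/\ x \in T, m x v = 1, m x w = 1 & dg x T = 1].

Hypotheses (tT : tree T) (dv : 1 < dg v T) (dw : 1 < dg w T).

(** A single edge joins [X] to [Y], so at most three edges leave [X], and 3|X| <= 2(|X| - 1) + 3
    forces |X| = 1. Minimum degree three then requires all three edges. *)
Lemma thin_side (X Y : {set V}) :
  X :|: Y = T -> [disjoint X & Y] -> tree X -> tree Y ->
  dg v X <= 1 -> dg w X <= 1 -> exists2 x, X = [set x] & simple_leaf x.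
Proof.
move=> XY dXY tX tY dvX dwX.
have sX : X \subset T by rewrite -XY subsetUl.
have crXY : cr X Y = 1.
  have := edges_inU dXY; rewrite XY; have := cardsUI X Y.
  rewrite XY; move: (dXY); rewrite -setI_eq0 => /eqP->; rewrite cards0.
  move: tT tX tY; rewrite /tree; lia.
have crC : cr X (~: X) = dg v X + dg w X + cr X Y.
  have -> : ~: X = [set v; w] :|: Y.
    apply/setP => y; rewrite !inE; case: (boolP (y \in X)) => yX.
      rewrite (disjointFr dXY yX) orbF /=.
      by have := subsetP sX y yX; rewrite TE !inE => /negbTE->.
    case: (boolP (y \in T)); first by rewrite -XY inE (negbTE yX) /= => ->; rewrite orbT.
    by rewrite TE !inE negbK => ->.
  rewrite edges_betweenUr; last first.
    rewrite disjoints_subset; apply/subsetP => y yvw; rewrite !inE.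
    apply/negP => yY; have : y \in T by rewrite -XY inE yY orbT.
    by rewrite TE inE yvw.
  by rewrite edges_betweenUr ?disjoints1 ?inE // !edges_between1r.
have : #|X| = 1.
  have := degree_sum X; rewrite crC crXY; move: tX; rewrite /tree; lia.
move/eqP/cards1P => [x Xx]; exists x => //.
move: dvX dwX crXY; rewrite Xx !edges_to1 edges_between1l => dvX dwX dxY.
have xT : x \in T by rewrite -XY Xx !inE eqxx.
have dxT : dg x T = 1.
  by rewrite -XY edges_toU // Xx edges_to1 m_irr dxY.
have := deg3 x; rewrite feedback_degree dxT (m_sym x v) (m_sym x w).
by split=> //; rewrite m_sym; lia.
Qed.

(** [v] with [X] and [w] with [Y] cannot both close cycles, nor can [w] with [X] and [v] with [Y].
    So either one side is thin for both vertices, or one of the vertices sends at most one edge to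
    each side and, having two in all, exactly one. *)
Lemma split_cases (X Y : {set V}) :
  X :|: Y = T -> [disjoint X & Y] -> tree X -> tree Y ->
  [\/ exists2 x, X = [set x] & simple_leaf x,
      exists2 y, Y = [set y] & simple_leaf y,
      dg v X = 1 /\ dg v Y = 1
    | dg w X = 1 /\ dg w Y = 1].
Proof.
move=> XY dXY tX tY.
have dvE : dg v T = dg v X + dg v Y by rewrite -XY edges_toU.
have dwE : dg w T = dg w X + dg w Y by rewrite -XY edges_toU.
have excl (A B : {set V}) p q : A \subset T -> B \subset T -> [disjoint A & B] ->
    tree A -> tree B -> p != q -> p \notin T -> q \notin T ->
    (dg p A <= 1) || (dg q B <= 1).
  move=> sA sB dAB tA tB pq pT qT; rewrite !(leqNgt _ 1) -negb_and.
  apply/negP => /andP[dpA dqB].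
  have pA : p \notin A by apply: contra pT; apply: (subsetP sA).
  have qB : q \notin B by apply: contra qT; apply: (subsetP sB).
  have := ndc (tree_cyclic tA pA dpA) (tree_cyclic tB qB dqB).
  apply/negP; rewrite negbK disjoints_subset; apply/subsetP => y.
  rewrite !inE => /orP[/eqP->|yA]; rewrite negb_or.
    by rewrite pq; apply: contra pT; apply: (subsetP sB).
  rewrite (disjointFr dAB yA) andbT.
  by apply: contra qT => /eqP<-; apply: (subsetP sA).
have sX : X \subset T by rewrite -XY subsetUl.
have sY : Y \subset T by rewrite -XY subsetUr.
have wv : w != v by rewrite eq_sym.
have c1 := excl _ _ _ _ sX sY dXY tX tY vw vT wT.
have c2 := excl _ _ _ _ sX sY dXY tX tY wv wT vT.
have thX := thin_side XY dXY tX tY.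
have thY : dg v Y <= 1 -> dg w Y <= 1 -> exists2 y, Y = [set y] & simple_leaf y.
  by apply: (@thin_side Y X); rewrite // 1?setUC // disjoint_sym.
case/orP: c1 => c1; case/orP: c2 => c2.
- by constructor 1; apply: thX.
- by constructor 3; lia.
- by constructor 4; lia.
- by constructor 2; apply: thY.
Qed.

Let in_cover c x : c \in T -> (x \notin [set v; w; c]) = (x \in T) && (x != c).
Proof. by move=> cT; rewrite TE !inE !negb_or -!andbA. Qed.

Lemma cover_by_center c :
  c \in T -> (forall b, b \in T -> b != c -> [/\ m b v = 1, m b w = 1, m b c = 1
    & forall b', b' \in T -> b' != c -> m b b' = 0]) -> three_covered.
Proof.
move=> cT H; exists v, w, c; split=> //.
- by apply: contraNneq vT => ->.
- by apply: contraNneq wT => ->.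
move=> b; rewrite in_cover // => /andP[bT bc].
have [-> -> -> H0] := H b bT bc; split=> // b'.
by rewrite in_cover // => /andP[]; apply: H0.
Qed.

(** Let B be the simple leaves and C the other vertices of [T]. C spans no edge and the vertices of
    B have degree one in [T], so the edge count of a tree reduces to [ein B] + |C| = 1: [T] is a
    star around the vertex of C, or a single edge when C is empty. *)
Lemma star_covered :
  (forall s t, s \in T -> t \in T -> 0 < m s t -> simple_leaf s \/ simple_leaf t) ->
  three_covered.
Proof.
move=> H.
pose sl x := [&& x \in T, m x v == 1, m x w == 1 & dg x T == 1].
have slP x : simple_leaf x <-> sl x.
  rewrite /sl; split=> [[-> -> -> ->]|/and4P[xT /eqP ? /eqP ? /eqP ?]] //.
pose B := [set x | sl x]; pose C := T :\: B.
have sBT : B \subset T by apply/subsetP => x; rewrite inE => /andP[].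
have dBC : [disjoint B & C] by exact: disjoint_setD.
have BC : B :|: C = T by exact: setD_subK.
have cBC := cardsID B T; rewrite (setIidPr sBT) -/C in cBC.
have crC : ein C = 0.
  apply: double_inj; rewrite edges_in_double.
  rewrite /edges_between big1 // => x xC; apply/eqP; rewrite sum_nat_eq0.
  apply/forall_inP => y yC; rewrite -leqn0 leqNgt; apply/negP => xy.
  move: xC yC; rewrite !inE => /andP[/negP nx xT] /andP[/negP ny yT].
  by case: (H x y xT yT xy) => /slP.
have crB : (ein B).*2 + cr B C = #|B|.
  rewrite edges_in_double -edges_betweenUr // BC -sum1_card.
  by apply: eq_bigr => x; rewrite inE => /slP[].
have einT := edges_inU dBC; rewrite BC crC in einT.
move: (tT); rewrite /tree einT => tTE.
have [C0|[c cC]] := set_0Vmem C.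
  have [c cT] := set0Pn _ (tree_n0 tT).
  have crB0 : cr B C = 0 by rewrite C0 edges_between0.
  have T2 : #|T| = 2 by move: cBC tTE crB; rewrite crB0 C0 cards0; clear; lia.
  apply: (cover_by_center cT) => b bT bc.
  have TB : T = B by rewrite -BC C0 setU0.
  have : b \in B by rewrite -TB.
  rewrite inE => /slP[_ -> -> dgb].
  have TE2 : T = [set b; c].
    apply/esym/eqP; rewrite eqEcard cards2 bc T2 leqnn andbT.
    by rewrite subUset !sub1set bT.
  move: dgb; rewrite TE2 edges_toU1 ?inE // m_irr edges_to1 add0n => dgb.
  split=> // b'; rewrite !inE => /orP[]/eqP->; rewrite ?m_irr //.
  by rewrite eqxx.
have C1 : C = [set c].
  apply/eqP; rewrite eq_sym eqEcard sub1set cC cards1.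
  by move: cBC tTE crB; clear; lia.
have B0 : ein B = 0 by move: cBC tTE crB; rewrite C1 cards1; clear; lia.
have cT : c \in T by move: cC; rewrite inE => /andP[].
apply: (cover_by_center cT) => b bT bc.
have inB x : x \in T -> x != c -> x \in B.
  by rewrite -BC C1 !inE => /orP[//|/eqP->]; rewrite eqxx.
have bB := inB b bT bc.
have mB0 x : x \in B -> m b x = 0.
  move=> xB; have : m b x <= cr B B.
    rewrite /edges_between (big_setD1 b) //=.
    by apply: leq_trans (leq_addr _ _); apply: edges_to_ge.
  by rewrite -edges_in_double B0 leqn0 => /eqP.
move: (bB); rewrite inE => /slP[_ -> -> dgb]; split=> //.
  move: dgb; rewrite -BC C1 edges_toU -?C1 // C1 edges_to1.
  by rewrite /edges_to big1 // => x /mB0.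
by move=> b' b'T b'c; apply: mB0; apply: inB.
Qed.

Lemma singleton_covered : #|T| = 1 -> three_covered.
Proof.
move/eqP/cards1P => [c Tc]; apply: (@cover_by_center c); first by rewrite Tc inE.
by move=> b; rewrite Tc inE => ->.
Qed.

Lemma leaf_split t : t \in T -> 1 < #|T| -> dg t T = 1 ->
  [\/ simple_leaf t, exists2 y, T :\ t = [set y] & simple_leaf y,
      m t v = 1 /\ dg v (T :\ t) = 1
    | m t w = 1 /\ dg w (T :\ t) = 1].
Proof.
move=> tinT gt1 dt.
have [|||||||] := @split_cases [set t] (T :\ t).
- exact: setD1K.
- by rewrite disjoints1 !inE eqxx.
- exact: tree1.
- exact: tree_leaf_removal.
- by case=> x /set1_inj<-; constructor 1.
- by case=> y; constructor 2; exists y.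
- by rewrite edges_to1 m_sym; constructor 3.
- by rewrite edges_to1 m_sym; constructor 4.
Qed.

(** [v |: T] has as many edges as vertices, so it is 2-regular as soon as all its degrees are at
    least two. Only the leaves of [T] are in doubt, and [leaf_split] joins each of them to [v]. *)
Lemma two_spokes_wheel : dg v T = 2 -> 2 < dg w T -> 1 < #|T| -> simple_wheel.
Proof.
move=> dv2 dw3 gt1; exists w.
have HE : ~: [set w] = v |: T by rewrite compl1 // eq_sym (negbTE vw).
rewrite HE; have vTE t : t \in T -> dg t (v |: T) = m t v + dg t T.
  by move=> tinT; rewrite edges_toU1.
have ge2 t : t \in T -> 2 <= dg t (v |: T).
  move=> tinT; rewrite vTE //; have := tree_edge_to acT tT gt1 tinT.
  rewrite leq_eqVlt => /orP[/eqP/esym dt|]; last lia.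
  suff -> : m t v = 1 by rewrite dt.
  have [[]|[y Ty [yT yv yw dy]]|[]|[tw dwt]] // := leaf_split tinT gt1 dt.
    by have := edges_toD1 v tinT; rewrite Ty edges_to1 !(m_sym v) yv dv2; lia.
  by have := edges_toD1 w tinT; rewrite m_sym tw dwt; lia.
have dvH : dg v (v |: T) = 2 by rewrite edges_toU1 // m_irr.
have sumE : \sum_(t in T) dg t (v |: T) = #|T| * 2.
  have := edges_in_sum (v |: T); rewrite big_setU1 //= dvH edges_inU1 //.
  by move: tT; rewrite /tree; lia.
have eq2 := sum_const_tight ge2 sumE.
move=> h hw; case: (eqVneq h v) => [->//|hv]; apply: eq2.
by rewrite TE !inE negb_or hv.
Qed.

End TwoVertexFeedback.

Definition almost_forest := exists x, acyclic (~: [set x]).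

(** The numbers of edges from [v] and from [w] into the tree [T] decide. If both exceed two, the
    last two cases of [split_cases] are void and every edge of [T] has a simple leaf. If exactly one
    equals two, the other vertex is the hub of a wheel, unless [T] is a single vertex. If both equal
    two, the degree count leaves |T| <= 2. *)
Lemma feedback_pair v w : v != w -> acyclic (~: [set v; w]) ->
  [\/ almost_forest, simple_wheel | three_covered].
Proof.
move=> vw acT.
have [ac|nv] := acyclic_or (~: [set v]); first by constructor 1; exists v.
have [ac|nw] := acyclic_or (~: [set w]); first by constructor 1; exists w.
set T := ~: [set v; w] in acT *; have TE : T = ~: [set v; w] by [].
have TE' : T = ~: [set w; v] by rewrite setUC.
have wv : w != v by rewrite eq_sym.
have [tT dv dw] := feedback_tree vw TE acT nv nw.
have T1 : #|T| = 1 -> three_covered by apply: (singleton_covered vw TE).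
have T0 : 0 < #|T| by rewrite card_gt0 tree_n0.
case: (ltngtP 2 (dg v T)) => [dv3||dv2]; [|lia|]; last first.
  case: (ltngtP 2 (dg w T)) => [dw3||dw2]; [|lia|]; last first.
    constructor 3; apply: (star_covered vw TE tT) => s t sT tinT st.
    have [X [Y [XY dXY sX tY [tX tY']]]] := tree_split acT tT sT tinT st.
    have nst : s != t by apply: contraTneq st => ->; rewrite m_irr.
    have T2 : #|T| <= 2.
      have := degree_sum T; rewrite {3}TE setCK edges_betweenUr ?disjoints1 ?inE //.
      rewrite !edges_between1r // -dv2 -dw2; move: tT; rewrite /tree; clear; lia.
    have TE2 : T = [set s; t].
      apply/esym/eqP; rewrite eqEcard cards2 nst T2 andbT.
      by rewrite subUset !sub1set sT.
    have mst : m s t = 1.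
      by move: tT; rewrite /tree TE2 edges_in2 // cards2 nst => -[].
    have Xs : X = [set s].
      apply/eqP; rewrite eqEsubset sub1set sX andbT; apply/subsetP => x xX.
      have : x \in T by rewrite -XY inE xX.
      rewrite TE2 !inE => /orP[->//|/eqP xt].
      by move: tY; rewrite -xt (disjointFr dXY xX).
    have Yt : Y = [set t].
      apply/eqP; rewrite eqEsubset sub1set tY andbT; apply/subsetP => x xY.
      have : x \in T by rewrite -XY inE xY orbT.
      rewrite TE2 !inE => /orP[/eqP xs|->//].
      by move: sX; rewrite -xs (disjointFl dXY xY).
    have dsT : dg s T = 1 by rewrite TE2 edges_toU1 ?inE // m_irr edges_to1.
    have dtT : dg t T = 1.
      by rewrite TE2 setUC edges_toU1 ?inE 1?eq_sym // m_irr edges_to1 m_sym.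
    have := deg3 s; have := deg3 t; rewrite !(feedback_degree vw TE) dsT dtT => g1 g2.
    have dgT u : dg u T = m s u + m t u.
      by rewrite TE2 edges_toU1 ?inE // edges_to1 !(m_sym u).
    rewrite !dgT in dv2 dw2.
    have [[x]|[y]|[]|[]] := split_cases vw TE tT dv dw XY dXY tX tY'.
    - by rewrite Xs => /set1_inj-> sl; left.
    - by rewrite Yt => /set1_inj-> sl; right.
    - rewrite Xs Yt !edges_to1 !(m_sym v) => e1 e2; left; split=> //.
      by move: g1 g2 dw2; rewrite e1 e2; clear; lia.
    - rewrite Xs Yt !edges_to1 !(m_sym w) => e1 e2; left; split=> //.
      by move: g1 g2 dv2; rewrite e1 e2; clear; lia.
  case: (ltngtP 1 #|T|) => [gt1||/esym/T1]; [|lia|by constructor 3].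
  constructor 2; by apply: (two_spokes_wheel vw TE acT tT).
case: (ltngtP 2 (dg w T)) => [dw3||dw2]; [|lia|]; last first.
  case: (ltngtP 1 #|T|) => [gt1||/esym/T1]; [|lia|by constructor 3].
  constructor 2; by apply: (two_spokes_wheel wv TE' acT tT).
constructor 3; apply: (star_covered vw TE tT) => s t sT tinT st.
have [X [Y [XY dXY sX tY [tX tY']]]] := tree_split acT tT sT tinT st.
have [[x Xx]|[y Yy]|[e1 e2]|[e1 e2]] := split_cases vw TE tT dv dw XY dXY tX tY'.
- by move: sX; rewrite Xx inE => /eqP->; left.
- by move: tY; rewrite Yy inE => /eqP->; right.
- by move: dv3; rewrite -XY edges_toU // e1 e2.
- by move: dw3; rewrite -XY edges_toU // e1 e2.
Qed.

Lemma tree_union_cyclic (A T : {set V}) :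
  tree T -> [disjoint A & T] -> #|A| < ein A + cr A T -> cyclic_set (A :|: T).
Proof.
move=> tT dAT; rewrite /cyclic_set edges_inU //.
have := cardsUI A T; move: (dAT); rewrite -setI_eq0 => /eqP->; rewrite cards0.
move: tT; rewrite /tree; clear; lia.
Qed.

(** The form in which the absence of disjoint cycles is applied below: [A] and [B] are disjoint
    parts of a short cycle, each completed by a tree off that cycle. *)
Lemma ndc_tree_union (A B T T' : {set V}) :
  tree T -> tree T' -> [disjoint A & T] -> [disjoint B & T'] ->
  [disjoint A :|: T & B :|: T'] ->
  #|A| < ein A + cr A T -> ein B + cr B T' <= #|B|.
Proof.
move=> tT tT' dAT dBT' dd gtA; rewrite leqNgt; apply/negP => gtB.
have := ndc (tree_union_cyclic tT dAT gtA) (tree_union_cyclic tT' dBT' gtB).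
by rewrite dd.
Qed.

(** * Smallest cyclic sets *)

Section MinimumCycle.

Variable S : {set V}.
Hypothesis cS : cyclic_set S.
Hypothesis minS : forall X : {set V}, cyclic_set X -> #|S| <= #|X|.
Hypothesis gt2 : 2 < #|S|.

Lemma smaller_acyclic (X : {set V}) : X != set0 -> #|X| < #|S| -> ein X < #|X|.
Proof.
move=> X0 ltX; rewrite ltnNge; apply/negP => leX.
have /minS : cyclic_set X by rewrite /cyclic_set card_gt0 X0.
by rewrite leqNgt ltX.
Qed.

Lemma minimum_cycle_regular : ein S = #|S| /\ forall s, s \in S -> dg s S = 2.
Proof.
have ge s : s \in S -> ein S + 2 <= dg s S + #|S|.
  move=> sS; have := cardsD1 s S; rewrite sS => cS1.
  have /smaller_acyclic : S :\ s != set0 by rewrite -card_gt0; move: gt2 cS1; clear; lia.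
  by rewrite {1}(edges_inD1 sS); move: gt2 cS1; clear; lia.
have geS : #|S| <= ein S by case/andP: cS.
have leS : ein S <= #|S|.
  have : \sum_(s in S) (ein S + 2) <= \sum_(s in S) (dg s S + #|S|) by apply: leq_sum.
  rewrite sum_nat_const big_split /= sum_nat_const edges_in_sum.
  move: gt2; clear; nia.
have eS : ein S = #|S| by apply/eqP; rewrite eqn_leq leS.
split=> //; apply: sum_const_tight; last by rewrite edges_in_sum eS; lia.
by move=> s /ge; rewrite eS; clear; lia.
Qed.

Lemma minimum_cycle_simple u v : m u v <= 1.
Proof.
case: (eqVneq u v) => [->|uv]; first by rewrite m_irr.
have := @smaller_acyclic [set u; v]; rewrite cards2 uv edges_in2 //.
by apply=> //; apply/set0Pn; exists u; rewrite !inE eqxx.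
Qed.

Lemma minimum_cycle_outside : ~: S != set0.
Proof.
have [s sS] := set0Pn _ (cyclic_set_n0 cS).
apply: contraTneq (deg3 s) => C0.
have -> : setT = S by rewrite -setC0 -C0 setCK.
by rewrite (proj2 minimum_cycle_regular).
Qed.

Lemma minimum_cycle_leaf l : l \notin S -> dg l (~: S) <= 1 -> 2 <= dg l S.
Proof.
move=> lS dl; have := deg3 l.
rewrite -(setUCr S) edges_toU; first by move: dl; clear; lia.
by rewrite -setTD disjoint_setD.
Qed.

(** On a longer cycle, a vertex l of degree at most one in the outer forest has two neighbours p and
    q on [S], and some edge rr' of [S] avoids both. Trading r and r' for l produces a cyclic set
    with one vertex less. *)
Lemma minimum_cycle_le4 : #|S| <= 4.
Proof.
rewrite leqNgt; apply/negP => gt4.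
have [eS dS] := minimum_cycle_regular.
have [l] := acyclic_leaf (ndc_acyclic cS) minimum_cycle_outside.
rewrite inE => lS /(minimum_cycle_leaf lS) dl.
have /edges_to_gt0P[p pS lp] : 0 < dg l S by apply: leq_trans dl.
have /edges_to_gt0P[q] : 0 < dg l (S :\ p).
  by move: dl; rewrite (edges_toD1 l pS); have := minimum_cycle_simple l p; clear; lia.
rewrite inE => /andP[qp qS] lq; rewrite inE in qp.
have qSp : q \in S :\ p by rewrite !inE qp.
pose R := S :\ p :\ q.
(* Removing [p] and [q] destroys at most four of the |S| > 4 edges. *)
have eR : 0 < ein R.
  have := edges_inD1 pS; rewrite dS // (edges_inD1 qSp) -/R.
  have := edges_to_sub q (subsetDl S [set p]); rewrite dS // eS.
  by move: gt4; clear; lia.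
have [r rR] : exists2 r, r \in R & 0 < dg r R.
  apply/exists_inP; apply: contraTT eR; rewrite negb_exists_in => /forall_inP H.
  rewrite -leqNgt leqn0 -double_eq0 -edges_in_sum sum_nat_eq0.
  by apply/forall_inP => x /H; rewrite -leqNgt leqn0.
case/edges_to_gt0P => r' r'R rr'.
have nrr' : r' != r by apply: contraTneq rr' => ->; rewrite m_irr.
move: rR r'R; rewrite !inE => /and3P[rq rp rS] /and3P[r'q r'p r'S].
pose X := S :\ r :\ r'.
have r'Sr : r' \in S :\ r by rewrite !inE nrr'.
have lX : l \notin X by rewrite !inE (negbTE lS) !andbF.
have cX : #|S| = #|X| + 2 by rewrite (cardsD1 r S) rS (cardsD1 r' (S :\ r)) r'Sr -/X; clear; lia.
have dlX : 2 <= dg l X.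
  have <- : dg l [set p; q] = 2.
    rewrite edges_toU1 ?inE 1?eq_sym // edges_to1.
    have := minimum_cycle_simple l p; have := minimum_cycle_simple l q.
    by move: lp lq; clear; lia.
  apply: edges_to_sub; rewrite subUset !sub1set !inE pS qS.
  by rewrite ![p == _]eq_sym ![q == _]eq_sym rp rq r'p r'q.
have /minS : cyclic_set (l |: X).
  rewrite /cyclic_set cardsU1 lX edges_inU1 //.
  have := edges_inD1 rS; rewrite (edges_inD1 r'Sr) -/X dS //.
  have := edges_toD1 r' rS; rewrite dS // eS m_sym.
  by move: rr' cX dlX; clear; lia.
by rewrite cardsU1 lX cX; clear; lia.
Qed.

End MinimumCycle.

(** * Simple graphs with a triangle *)

Section Triangle.

Hypothesis m_le1 : forall u v, m u v <= 1.

Lemma three_cyclic x y z : x != y -> x != z -> y != z ->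
  0 < m x y -> 0 < m x z -> 0 < m y z -> cyclic_set [set x; y; z].
Proof.
move=> xy xz yz mxy mxz myz.
rewrite /cyclic_set -setUA cardsU1 !inE negb_or xy xz cards2 yz.
rewrite edges_inU1 ?inE ?negb_or ?xy // edges_in2 // edges_toU1 ?inE //.
by rewrite edges_to1; move: mxy mxz myz; clear; lia.
Qed.

Lemma triangle_degree x y z t : x != y -> x != z -> y != z ->
  dg t setT = m t x + m t y + m t z + dg t (~: [set x; y; z]).
Proof.
move=> xy xz yz; rewrite -(setUCr [set x; y; z]) edges_toU; last first.
  by rewrite -setTD disjoint_setD.
rewrite -setUA edges_toU1 ?inE ?negb_or ?xy // edges_toU1 ?inE // edges_to1.
by rewrite setUA; clear; lia.
Qed.

(** As [x] closes a cycle with [T], the edge yz and another component B span none, so [y] and [z]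
    together send at most one edge to B; [x] sends at most |B| by simplicity. The degrees in B would
    then sum to at most 3|B| - 1. *)
Lemma triangle_component x y z (F T : {set V}) :
  x != y -> x != z -> y != z -> F = ~: [set x; y; z] -> acyclic F ->
  0 < m y z -> T \subset F -> tree T ->
  (forall t, t \in T -> dg t (F :\: T) = 0) -> 1 < dg x T -> T = F.
Proof.
move=> xy xz yz FE acF myz sTF tT clT dxT.
apply/eqP; rewrite eqEsubset sTF -setD_eq0; apply: contraT => /set0Pn[u uD].
have [B [uB sB tB clB]] := component_of (acyclic_sub (subsetDl F T) acF) uD.
have sBF := subset_trans sB (subsetDl _ _).
have nF w : w \in [set x; y; z] -> w \notin F by rewrite FE [w \in ~: _]inE negbK.
have nT w : w \in [set x; y; z] -> w \notin T.
  by move=> /nF; apply: contra; apply: (subsetP sTF).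
have nB w : w \in [set x; y; z] -> w \notin B.
  by move=> /nF; apply: contra; apply: (subsetP sBF).
have dTB : [disjoint T & B].
  rewrite disjoints_subset; apply/subsetP => w wT; rewrite inE.
  by apply/negP => /(subsetP sB); rewrite inE wT.
have dyz : dg y B + dg z B <= 1.
  have H1 : [disjoint [set x] & T] by rewrite disjoints1 nT ?inE ?eqxx.
  have H2 : [disjoint [set y; z] & B].
    rewrite disjoints_subset subUset !sub1set.
    by rewrite ![_ \in ~: B]inE !nB ?inE ?eqxx ?orbT.
  have H3 : [disjoint x |: T & [set y; z] :|: B].
    rewrite disjoints_subset; apply/subsetP => w; rewrite !inE !negb_or.
    case/orP => [/eqP->|wT]; first by rewrite xy xz nB ?inE ?eqxx.
    rewrite (disjointFr dTB wT) andbT.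
    by apply/andP; split; apply: contraTneq wT => ->; rewrite nT ?inE ?eqxx ?orbT.
  have := ndc_tree_union tT tB H1 H2 H3.
  rewrite cards1 cards2 yz edges_in1 edges_in2 // edges_between1l.
  rewrite [cr [set y; z] B]edges_betweenUl ?disjoints1 ?inE // !edges_between1l.
  by move/(_ dxT); move: myz; clear; lia.
have dxB : dg x B <= #|B|.
  by rewrite -sum1_card; apply: leq_sum => w _; apply: m_le1.
have := degree_sum B.
have -> : cr B (~: B) = dg x B + dg y B + dg z B.
  have -> : ~: B = [set x; y; z] :|: (F :\: B).
    apply/setP => w; rewrite [in RHS]inE [w \in F :\: B]inE.
    case: (boolP (w \in B)) => wB; rewrite inE wB /=.
      by rewrite orbF; apply/esym/negbTE; apply: contraL wB; apply: nB.
    by rewrite FE [w \in ~: _]inE orbN.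
  rewrite edges_betweenUr; last first.
    rewrite disjoints_subset; apply/subsetP => w wA.
    by rewrite inE inE negb_and (nF _ wA) orbT.
  rewrite [X in _ + X](_ : _ = 0) ?addn0; last first.
    rewrite /edges_between big1 // => w wB; apply/eqP; rewrite -leqn0.
    have -> : F :\: B = T :|: ((F :\: T) :\: B).
      apply/setP => t; rewrite !inE; case: (boolP (t \in T)) => //= tinT.
      by rewrite (disjointFr dTB tinT) (subsetP sTF).
    rewrite edges_toU; last first.
      by rewrite disjoints_subset; apply/subsetP => t tinT; rewrite !inE tinT andbF.
    rewrite clB // addn0 leqn0 sum_nat_eq0; apply/forall_inP => t tinT.
    rewrite -leqn0 -(clT t tinT) m_sym; apply: edges_to_ge.
    exact: (subsetP sB).
  rewrite -setUA edges_betweenUr; last by rewrite disjoints1 !inE negb_or xy.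
  by rewrite edges_betweenUr ?disjoints1 ?inE // !edges_between1r // addnA.
move: tB dyz dxB; rewrite /tree; clear; lia.
Qed.

(** The triangle on [l], [y], [z] is disjoint from [x] and from the tree [F :\ l], so these may not
    close a cycle. *)
Lemma triangle_leaf x y z l (F : {set V}) :
  x != y -> x != z -> y != z -> F = ~: [set x; y; z] -> tree F ->
  l \in F -> dg l F = 1 -> 0 < m y z -> 0 < m l y -> 0 < m l z ->
  dg x (F :\ l) <= 1.
Proof.
move=> xy xz yz FE tF lF dl myz mly mlz; rewrite leqNgt; apply/negP => gt1.
have [lx ly lz] : [/\ l != x, l != y & l != z].
  by move: lF; rewrite FE !inE !negb_or -andbA => /and3P.
have xF : x \notin F by rewrite FE !inE eqxx.
have xFl : x \notin F :\ l by rewrite !inE (negbTE xF) andbF.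
have := ndc (three_cyclic ly lz yz mly mlz myz)
            (tree_cyclic (tree_leaf_removal tF lF dl) xFl gt1).
rewrite disjoints_subset; case/negP; apply/subsetP => w.
rewrite !inE FE !inE => /orP[/orP[]|]/eqP->; rewrite ?eqxx ?orbT ?andbF ?orbF //.
- by rewrite eq_sym.
- by rewrite eq_sym.
Qed.

Lemma edgeless_covered a b c : a != b -> a != c -> b != c ->
  ein (~: [set a; b; c]) = 0 -> three_covered.
Proof.
move=> ab ac bc e0; exists a, b, c; split=> // t tA.
have tF : t \in ~: [set a; b; c] by rewrite inE.
have d0 : dg t (~: [set a; b; c]) = 0.
  apply/eqP; rewrite -leqn0.
  have <- : cr (~: [set a; b; c]) (~: [set a; b; c]) = 0.
    by rewrite -edges_in_double e0.
  by rewrite /edges_between (big_setD1 t) //= leq_addr.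
have := deg3 t; rewrite (triangle_degree _ ab ac bc) d0.
have := m_le1 t a; have := m_le1 t b; have := m_le1 t c => h1 h2 h3 h4.
split; try by move: h1 h2 h3 h4; clear; lia.
move=> t' t'A; apply/eqP; rewrite -leqn0 -d0; apply: edges_to_ge.
by rewrite inE.
Qed.

(** At most four edges leave the tree T' = [F :\ l]: one to [l] and one to each of [a], [b], [c].
    The degree count gives |T'| <= 2. A second vertex p beside [l'] would have no neighbour on the
    triangle, whose edges into T' all go to [l'], and so would have degree at most two. *)
Lemma triangle_two_full_leaves a b c l l' (F : {set V}) :
  a != b -> a != c -> b != c -> F = ~: [set a; b; c] -> tree F ->
  (forall x y, x \in [set a; b; c] -> y \in [set a; b; c] -> x != y -> m x y = 1) ->
  l \in F -> l' \in F -> l != l' -> dg l F = 1 ->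
  (forall x, x \in [set a; b; c] -> [/\ m l x = 1, m l' x = 1 & dg x (F :\ l) <= 1]) ->
  complete5.
Proof.
move=> ab ac bc FE tF mA lF l'F ll' dl H.
pose T' := F :\ l.
have l'T' : l' \in T' by rewrite !inE eq_sym ll'.
have CT' : ~: T' = l |: [set a; b; c].
  apply/setP => x; rewrite inE [x \in T']inE [x \in l |: _]inE !in_set1.
  by case: (x == l) => //=; rewrite FE inE negbK.
have lA : l \notin [set a; b; c] by move: lF; rewrite FE inE.
have inA : [/\ a \in [set a; b; c], b \in [set a; b; c] & c \in [set a; b; c]].
  by rewrite !inE !eqxx ?orbT.
case: inA => aA bA cA.
have dlT' : dg l T' = 1 by rewrite edges_toD1_self.
have [la l'a da] := H a aA; have [lb l'b db] := H b bA; have [lc l'c dc] := H c cA.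
have T'2 : #|T'| <= 2.
  have := degree_sum T'; rewrite CT' edges_betweenUr ?disjoints1 // edges_between1r //.
  rewrite dlT' -setUA edges_betweenUr; last by rewrite disjoints1 !inE negb_or ab ac.
  rewrite edges_betweenUr ?disjoints1 ?inE // !edges_between1r //.
  move: da db dc; have := tree_leaf_removal tF lF dl.
  by rewrite -/T' /tree; clear; lia.
have T'1 : T' = [set l'].
  apply/eqP; rewrite eq_sym eqEcard sub1set l'T' cards1 leqNgt /=.
  apply/negP => gt1.
  have [p pT' pl'] : exists2 p, p \in T' & p != l'.
    apply/exists_inP; apply: contraTT gt1; rewrite negb_exists_in -leqNgt => /forall_inP E.
    rewrite -(cards1 l'); apply/subset_leq_card/subsetP => x /E.
    by rewrite negbK inE.
  have T'E : T' = [set p; l'].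
    apply/esym/eqP; rewrite eqEcard cards2 pl' T'2 andbT.
    by rewrite subUset !sub1set pT'.
  have FE2 : F = l |: [set p; l'] by rewrite -T'E setD1K.
  have mp0 x : dg x T' <= 1 -> m l' x = 1 -> m p x = 0.
    rewrite T'E edges_toU1 ?inE // edges_to1 (m_sym x p) (m_sym x l') => h e; move: h; rewrite e.
    by clear; lia.
  have := deg3 p; rewrite (triangle_degree _ ab ac bc) -FE !mp0 // FE2.
  have lT' : l \notin [set p; l'] by rewrite -T'E !inE eqxx.
  rewrite edges_toU1 // edges_toU1 ?inE // edges_to1 m_irr.
  by have := m_le1 p l; have := m_le1 p l'; clear; lia.
have FE2 : F = [set l; l'] by rewrite -(setD1K lF) -/T' T'1.
have mll' : m l l' = 1.
  by move: dl; rewrite FE2 edges_toU1 ?inE // m_irr edges_to1.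
have VE x : (x \in [set a; b; c]) || (x \in [set l; l']).
  by rewrite -FE2 FE [x \in ~: _]inE orbN.
split.
  rewrite -cardsT -(setUCr [set a; b; c]) -FE FE2.
  have dAF : [set a; b; c] :&: [set l; l'] = set0.
    by rewrite -FE2 FE setICr.
  have := cardsUI [set a; b; c] [set l; l']; rewrite dAF cards0 addn0 => ->.
  by rewrite -setUA cardsU1 !inE negb_or ab ac !cards2 bc ll'.
have mx x u : u \in [set l; l'] -> x \in [set a; b; c] -> m u x = 1.
  by rewrite in_set2 => /orP[]/eqP-> xA; have [] := H x xA.
move=> u v uv; case/orP: (VE u) => uE; case/orP: (VE v) => vE.
- exact: mA.
- by rewrite m_sym mx.
- exact: mx.
- move: uE vE uv; rewrite !inE => /orP[]/eqP-> /orP[]/eqP->; rewrite ?eqxx //.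
  by rewrite m_sym.
Qed.

(** Two leaves of a component of the forest off the triangle have two neighbours each on the
    triangle, hence a common one, and [triangle_component] makes the forest a tree. If no two
    triangle vertices meet every cycle, each of the three sends two edges into the tree. A leaf that
    misses one of them would form a triangle with the other two, disjoint from a cycle through the
    missed one; so both leaves see the whole triangle. *)
Lemma triangle_cases a b c : a != b -> a != c -> b != c ->
  m a b = 1 -> m a c = 1 -> m b c = 1 ->
  [\/ almost_forest, simple_wheel, complete5 | three_covered].
Proof.
move=> ab ac bc mab mac mbc.
have FBP v w : v != w -> acyclic (~: [set v; w]) ->
    [\/ almost_forest, simple_wheel, complete5 | three_covered].
  by move=> vw /(feedback_pair vw)[];
    [constructor 1|constructor 2|constructor 4].
have cA : cyclic_set [set a; b; c].
  by apply: three_cyclic; rewrite ?mab ?mac ?mbc.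
pose F := ~: [set a; b; c]; have acF : acyclic F := ndc_acyclic cA.
have ba : b != a by rewrite eq_sym.
have ca : c != a by rewrite eq_sym.
have cb : c != b by rewrite eq_sym.
have FEa : F = ~: [set a; b; c] by [].
have FEb : F = ~: [set b; a; c].
  by rewrite FEa; apply/setP => x; rewrite !inE; case: eqP; case: eqP.
have FEc : F = ~: [set c; a; b].
  by rewrite FEa; apply/setP => x; rewrite !inE; do 3!case: eqP.
have [e0|] := posnP (ein F); first by constructor 4; apply: edgeless_covered e0.
rewrite -double_gt0 -edges_in_sum lt0n sum_nat_eq0 negb_forall.
case/existsP=> t; rewrite negb_imply -lt0n => /andP[tF dt].
have [T [tT sTF treeT clT]] := component_of acF tF.
have dgT u : u \in T -> dg u F = dg u T.
  move=> uT; rewrite -{1}(setD_subK sTF) edges_toU ?disjoint_setD //.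
  by rewrite clT // addn0.
have gt1 : 1 < #|T|.
  rewrite ltn_neqAle card_gt0 tree_n0 // andbT eq_sym.
  apply/negP => /cards1P[x Tx]; move: dt; rewrite dgT //.
  by move: tT; rewrite Tx inE => /eqP->; rewrite edges_to1 m_irr.
have [l [l' [lT l'T ll' dl dl']]] := two_leaves (acyclic_sub sTF acF) treeT gt1.
have lF := subsetP sTF l lT; have l'F := subsetP sTF l' l'T.
have hl := deg3 l; have hl' := deg3 l'.
rewrite !(triangle_degree _ ab ac bc) -FEa dgT // dl in hl.
rewrite !(triangle_degree _ ab ac bc) -FEa dgT // dl' in hl'.
have dge x : m l x = 1 -> m l' x = 1 -> 1 < dg x T.
  move=> e1 e2; have <- : dg x [set l; l'] = 2.
    by rewrite edges_toU1 ?inE // edges_to1 !(m_sym x) e1 e2.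
  by apply: edges_to_sub; rewrite subUset !sub1set lT.
have TF : T = F.
  have : [\/ m l a = 1 /\ m l' a = 1, m l b = 1 /\ m l' b = 1
           | m l c = 1 /\ m l' c = 1].
    have := m_le1 l a; have := m_le1 l b; have := m_le1 l c.
    have := m_le1 l' a; have := m_le1 l' b; have := m_le1 l' c.
    move: hl hl'; clear => *.
    have [h|[h|h]] : (m l a = 1 /\ m l' a = 1) \/ (m l b = 1 /\ m l' b = 1)
           \/ (m l c = 1 /\ m l' c = 1) by lia.
    - by constructor 1.
    - by constructor 2.
    - by constructor 3.
  case=> -[e1 e2].
  - by apply: (triangle_component ab ac bc FEa) => //; rewrite ?mbc ?dge.
  - by apply: (triangle_component ba bc ac FEb) => //; rewrite ?mac ?dge.
  - by apply: (triangle_component ca cb ab FEc) => //; rewrite ?mab ?dge.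
rewrite {}TF in treeT gt1 dl dl' dge clT dgT lT l'T tT sTF.
have big x y z : x != y -> x != z -> y != z -> F = ~: [set x; y; z] ->
    ~ acyclic (~: [set y; z]) -> 1 < dg x F.
  move=> xy xz yz FE.
  have -> : ~: [set y; z] = x |: F.
    apply/setP => w; rewrite FE !inE !negb_or; case: (eqVneq w x) => [->|] //=.
    by rewrite xy.
  have xF : x \notin F by rewrite FE !inE eqxx.
  move=> /(extend_acyclic acF xF)[T' [sT' _ _ d2]].
  exact: leq_trans d2 (edges_to_sub x sT').
have [ac1|/(big _ _ _ ab ac bc FEa) da] := acyclic_or (~: [set b; c]).
  exact: (FBP b c).
have [ac1|/(big _ _ _ ba bc ac FEb) db] := acyclic_or (~: [set a; c]).
  exact: (FBP a c).
have [ac1|/(big _ _ _ ca cb ab FEc) dc] := acyclic_or (~: [set a; b]).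
  exact: (FBP a b).
have full u : u \in F -> dg u F = 1 ->
    [/\ m u a = 1, m u b = 1 & m u c = 1] /\
    [/\ dg a (F :\ u) <= 1, dg b (F :\ u) <= 1 & dg c (F :\ u) <= 1].
  move=> uF du; have := deg3 u; rewrite (triangle_degree _ ab ac bc) -FEa du.
  have := m_le1 u a; have := m_le1 u b; have := m_le1 u c.
  have TLa := triangle_leaf ab ac bc FEa treeT uF du.
  have TLb := triangle_leaf ba bc ac FEb treeT uF du.
  have TLc := triangle_leaf ca cb ab FEc treeT uF du.
  rewrite mbc in TLa; rewrite mac in TLb; rewrite mab in TLc.
  have := edges_toD1 a uF; have := edges_toD1 b uF; have := edges_toD1 c uF.
  rewrite !(m_sym _ u) => e1 e2 e3 h1 h2 h3 h4.
  have ua : 0 < m u a.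
    rewrite lt0n; apply/negP => /eqP u0.
    by have := TLa isT; rewrite u0 in e3 h4; move: da h1 h2 e3 h4; clear; lia.
  have ub : 0 < m u b.
    rewrite lt0n; apply/negP => /eqP u0.
    by have := TLb isT; rewrite u0 in e2 h4; move: db h1 h3 e2 h4; clear; lia.
  have uc : 0 < m u c.
    rewrite lt0n; apply/negP => /eqP u0.
    by have := TLc isT; rewrite u0 in e1 h4; move: dc h2 h3 e1 h4; clear; lia.
  split; last by split; [apply: TLa | apply: TLb | apply: TLc].
  by split; apply/eqP; rewrite eqn_leq m_le1.
have [[la lb lc] [da1 db1 dc1]] := full l lT dl.
have [[l'a l'b l'c] _] := full l' l'T dl'.
constructor 3; apply: (triangle_two_full_leaves ab ac bc FEa treeT _ lT l'T ll' dl).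
  move=> x y; rewrite !inE => /orP[/orP[]|]/eqP-> /orP[/orP[]|]/eqP->;
    rewrite ?eqxx // => _; by rewrite ?mab ?mac ?mbc // m_sym.
by move=> x; rewrite !inE => /orP[/orP[]|]/eqP->; split.
Qed.

End Triangle.

(** * Simple triangle-free graphs with a square *)

Section Square.

Hypothesis m_le1 : forall u v, m u v <= 1.
Hypothesis triangle_free : forall x y z, 0 < m x y -> 0 < m y z -> m x z = 0.

Record square c1 c2 c3 c4 (C : {set V}) : Prop := Square {
  square_uniq : uniq [:: c1; c2; c3; c4];
  square_mem : C =i [:: c1; c2; c3; c4];
  square12 : m c1 c2 = 1;
  square23 : m c2 c3 = 1;
  square34 : m c3 c4 = 1;
  square41 : m c4 c1 = 1 }.

Lemma square_rot c1 c2 c3 c4 (C : {set V}) :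
  square c1 c2 c3 c4 C -> square c2 c3 c4 c1 C.
Proof.
case=> u eC m12 m23 m34 m41; split=> //.
  by rewrite -(rot_uniq 1) in u.
by move=> x; rewrite eC -(mem_rot 1).
Qed.

Lemma square_diagonal c1 c2 c3 c4 (C : {set V}) :
  square c1 c2 c3 c4 C -> m c1 c3 = 0.
Proof. by case=> _ _ m12 m23 _ _; apply: (@triangle_free c1 c2); rewrite ?m12 ?m23. Qed.

Lemma square_neq c1 c2 c3 c4 (C : {set V}) : square c1 c2 c3 c4 C ->
  [/\ c1 != c2, c1 != c3, c1 != c4 & [/\ c2 != c3, c2 != c4 & c3 != c4]].
Proof.
case=> /=; rewrite !inE !negb_or -!andbA => /and5P[-> -> -> ->].
by case/and3P=> -> ->.
Qed.

Lemma square_degree c1 c2 c3 c4 (C : {set V}) t : square c1 c2 c3 c4 C ->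
  dg t setT = m t c1 + m t c2 + m t c3 + m t c4 + dg t (~: C).
Proof.
move=> sq; have [n12 n13 n14 [n23 n24 n34]] := square_neq sq.
rewrite -(setUCr C) edges_toU; last by rewrite -setTD disjoint_setD.
have -> : C = c1 |: (c2 |: [set c3; c4]).
  by apply/setP => x; rewrite (square_mem sq) !inE.
do 3!rewrite edges_toU1 ?inE ?negb_or ?n12 ?n13 ?n14 ?n23 ?n24 //.
by rewrite edges_to1 !addnA.
Qed.

(** Without triangles [l] cannot see two consecutive corners, yet it needs at least two of them. So
    it sees exactly one pair of opposite corners, and its third edge leaves the square. *)
Lemma square_leaf_type c1 c2 c3 c4 (C : {set V}) l : square c1 c2 c3 c4 C ->
  dg l (~: C) <= 1 ->
  dg l (~: C) = 1 /\
  ([/\ m l c1 = 1, m l c2 = 0, m l c3 = 1 & m l c4 = 0] \/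
   [/\ m l c1 = 0, m l c2 = 1, m l c3 = 0 & m l c4 = 1]).
Proof.
move=> sq dl; have := deg3 l; rewrite (square_degree _ sq).
have tf x y : m x y = 1 -> m l x = 0 \/ m l y = 0.
  move=> xy; case: (posnP (m l x)) => [|lx]; [by left|right].
  by apply: (triangle_free lx); rewrite xy.
have := tf _ _ (square12 sq); have := tf _ _ (square23 sq).
have := tf _ _ (square34 sq); have := tf _ _ (square41 sq).
have := m_le1 l c1; have := m_le1 l c2; have := m_le1 l c3; have := m_le1 l c4.
move: dl; clear => *.
have [h1 [h2|h2]] : dg l (~: C) = 1 /\
   ((m l c1 = 1 /\ m l c2 = 0 /\ m l c3 = 1 /\ m l c4 = 0) \/
    (m l c1 = 0 /\ m l c2 = 1 /\ m l c3 = 0 /\ m l c4 = 1)) by lia.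
- by split=> //; left; case: h2 => ? [? []].
- by split=> //; right; case: h2 => ? [? []].
Qed.

Section TwoTrees.

Variables (c1 c2 c3 c4 : V) (C T T' : {set V}).
Hypotheses (sq : square c1 c2 c3 c4 C) (tT : tree T) (tT' : tree T').
Hypotheses (sT : T \subset ~: C) (sT' : T' \subset ~: C) (dTT' : [disjoint T & T']).

Lemma square_disjoint (A B : {set V}) : A \subset C -> B \subset C -> [disjoint A & B] ->
  #|A| < ein A + cr A T -> ein B + cr B T' <= #|B|.
Proof.
move=> sA sB dAB; apply: ndc_tree_union => //.
- rewrite disjoints_subset; apply: (subset_trans sA).
  by rewrite -[C]setCK setCS.
- rewrite disjoints_subset; apply: (subset_trans sB).
  by rewrite -[C]setCK setCS.
rewrite disjoints_subset; apply/subsetP => x; rewrite !inE negb_or.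
case/orP => [xA|xT].
  rewrite (disjointFr dAB xA) /=; apply/negP => /(subsetP sT').
  by rewrite inE (subsetP sA).
rewrite (disjointFr dTT' xT) andbT; apply/negP => /(subsetP sB) xC.
by have := subsetP sT x xT; rewrite inE xC.
Qed.

(** Otherwise [c1] with [T] and the path c2 c3 c4 with [T'] would contain disjoint cycles. The next
    lemma cuts the square into two opposite edges instead. *)
Lemma square_one : 1 < dg c1 T -> dg c2 T' + dg c3 T' + dg c4 T' <= 1.
Proof.
have [n12 n13 n14 [n23 n24 n34]] := square_neq sq.
have inC x : x \in [:: c1; c2; c3; c4] -> x \in C by rewrite (square_mem sq).
have sA : [set c1] \subset C by rewrite sub1set inC // !inE eqxx.
have sB : c2 |: [set c3; c4] \subset C.
  by rewrite !subUset !sub1set !inC // !inE eqxx ?orbT.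
have dAB : [disjoint [set c1] & c2 |: [set c3; c4]].
  by rewrite disjoints1 !inE !negb_or n12 n13.
have := square_disjoint sA sB dAB.
rewrite cards1 edges_in1 edges_between1l cardsU1 cards2 !inE negb_or n23 n24 n34.
rewrite edges_inU1 ?inE ?negb_or ?n23 // edges_in2 // edges_toU1 ?inE // edges_to1.
rewrite [cr (c2 |: _) _]edges_betweenUl ?disjoints1 ?inE ?negb_or ?n23 //.
rewrite edges_betweenUl ?disjoints1 ?inE // !edges_between1l.
rewrite (square23 sq) (square34 sq); clear; lia.
Qed.

Lemma square_two : 1 < dg c1 T + dg c4 T -> dg c2 T' + dg c3 T' <= 1.
Proof.
have [n12 n13 n14 [n23 n24 n34]] := square_neq sq.
have inC x : x \in [:: c1; c2; c3; c4] -> x \in C by rewrite (square_mem sq).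
have sA : [set c1; c4] \subset C.
  by rewrite subUset !sub1set !inC // !inE eqxx ?orbT.
have sB : [set c2; c3] \subset C.
  by rewrite subUset !sub1set !inC // !inE eqxx ?orbT.
have dAB : [disjoint [set c1; c4] & [set c2; c3]].
  rewrite disjoints_subset subUset !sub1set !inE !negb_or n12 n13.
  by rewrite ![c4 == _]eq_sym n24 n34.
have := square_disjoint sA sB dAB.
rewrite !cards2 n14 n23 !edges_in2 //.
rewrite !edges_betweenUl ?disjoints1 ?inE // !edges_between1l.
rewrite (square23 sq) (m_sym c1) (square41 sq); clear; lia.
Qed.

End TwoTrees.

(** The cycle l c1 c2 c3 is disjoint from [c4] and from the tree without [l], so [c4] sends at most
    one edge into the tree; symmetrically for [c2]. Since [c2] and [c4] are opposite, hence not
    adjacent, adding both to the tree closes no cycle. *)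
Lemma square_feedback c1 c2 c3 c4 (C : {set V}) l :
  square c1 c2 c3 c4 C -> tree (~: C) -> acyclic (~: C) -> l \notin C ->
  dg l (~: C) = 1 -> m l c1 = 1 -> m l c2 = 0 -> m l c3 = 1 -> m l c4 = 0 ->
  acyclic (~: [set c1; c3]).
Proof.
move=> sq tF acF lC dl l1 l2 l3 l4.
have lF : l \in ~: C by rewrite inE.
have tFl := tree_leaf_removal tF lF dl.
have le1 d1 d2 d3 d4 : square d1 d2 d3 d4 C -> m l d1 = 1 -> m l d3 = 1 ->
    m l d4 = 0 -> dg d4 (~: C) <= 1.
  move=> sd ld1 ld3 ld4; have [n12 n13 n14 [n23 n24 n34]] := square_neq sd.
  rewrite leqNgt; apply/negP => gt1.
  have d4F : d4 \notin ~: C by rewrite inE negbK (square_mem sd) !inE eqxx !orbT.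
  have c4F : cyclic_set (d4 |: (~: C) :\ l).
    apply: tree_cyclic => //; first by rewrite !inE (square_mem sd) !inE eqxx !orbT andbF.
    by move: gt1; rewrite (edges_toD1 d4 lF) m_sym ld4.
  have [ld1n ld2n ld3n ld4n] : [/\ l != d1, l != d2, l != d3 & l != d4].
    by move: lC; rewrite (square_mem sd) !inE !negb_or => /and4P.
  have cl : cyclic_set (l |: (d1 |: [set d2; d3])).
    rewrite /cyclic_set !cardsU1 cards1 !inE !negb_or ld1n ld2n ld3n n12 n13 n23.
    rewrite !edges_inU1 ?inE ?negb_or ?ld1n ?ld2n ?n12 // edges_in1.
    rewrite !edges_toU1 ?inE ?negb_or ?n12 // !edges_to1.
    by rewrite ld1 ld3 (square12 sd) (square23 sd); clear; lia.
  have := ndc cl c4F; rewrite disjoints_subset; case/negP.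
  rewrite !subUset !sub1set !inE !(square_mem sd) !inE !eqxx.
  by rewrite ?orbT /= ?andbF ?orbF ld4n n14 n24 n34.
have d4 : dg c4 (~: C) <= 1 := le1 _ _ _ _ sq l1 l3 l4.
have d2 : dg c2 (~: C) <= 1.
  by apply: (le1 c3 c4 c1 c2) => //; do 2!apply: square_rot.
have [n12 n13 n14 [n23 n24 n34]] := square_neq sq.
have -> : ~: [set c1; c3] = c2 |: (c4 |: ~: C).
  apply/setP => x; rewrite !inE (square_mem sq) !inE.
  case: (eqVneq x c2) => [->|] /=; first by rewrite negb_or eq_sym n12 n23.
  case: (eqVneq x c4) => [->|] /=; last by rewrite orbF.
  by rewrite negb_or ![c4 == _]eq_sym n14 n34.
have inC x : x \in [:: c1; c2; c3; c4] -> x \notin ~: C.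
  by rewrite [x \in ~: C]inE negbK (square_mem sq).
have ac4 : acyclic (c4 |: ~: C).
  case: (acyclic_or (c4 |: ~: C)) => // /extend_acyclic[] //.
    by apply: inC; rewrite !inE eqxx !orbT.
  move=> T [sT _ _]; rewrite ltnNge => /negP[].
  exact: leq_trans (edges_to_sub _ sT) d4.
case: (acyclic_or (c2 |: (c4 |: ~: C))) => // /extend_acyclic[] //.
  by rewrite in_setU1 negb_or n24 inC // !inE eqxx !orbT.
move=> T [sT _ _]; rewrite ltnNge => /negP[].
apply: leq_trans (edges_to_sub _ sT) _.
rewrite edges_toU1; last by apply: inC; rewrite !inE eqxx !orbT.
by rewrite (square_diagonal (square_rot sq)).
Qed.

(** Every component off the square has two leaves, each seeing a pair of opposite corners. Two
    components would give disjoint cycles, so there is only one, and the pair seen by one of its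
    leaves meets every cycle. *)
Lemma square_cases c1 c2 c3 c4 (C : {set V}) :
  square c1 c2 c3 c4 C -> acyclic (~: C) -> ~: C != set0 ->
  [\/ almost_forest, simple_wheel | three_covered].
Proof.
move=> sq acF /set0Pn[x xF].
(* [D] stands for the whole forest and later for what remains of it off a first component; the last
   assumption says that components of [D] have no further edges in the forest. *)
have leaves (D : {set V}) y : y \in D -> D \subset ~: C ->
    (forall T : {set V}, T \subset D -> (forall t, t \in T -> dg t (D :\: T) = 0) ->
      forall t, t \in T -> dg t (~: C) = dg t T) ->
    exists T : {set V}, [/\ T \subset D, tree T, forall t, t \in T -> dg t (D :\: T) = 0
      & exists l l', [/\ l \in T, l' \in T, l != l', dg l (~: C) = 1 & dg l' (~: C) = 1]].
  move=> yD sD dgE.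
  have [T [yT sTD tT clT]] := component_of (acyclic_sub sD acF) yD.
  have dgT := dgE T sTD clT.
  have gt1 : 1 < #|T|.
    rewrite ltn_neqAle card_gt0 tree_n0 // andbT eq_sym.
    apply/negP => /cards1P[z Tz].
    have dz : dg z (~: C) = 0 by rewrite dgT Tz ?inE // edges_to1 m_irr.
    by have [] := @square_leaf_type _ _ _ _ _ z sq; rewrite dz.
  have acT : acyclic T by apply: acyclic_sub acF; apply: subset_trans sD.
  have [l [l' [lT l'T ll' dl dl']]] := two_leaves acT tT gt1.
  by exists T; split=> //; exists l, l'; split=> //; rewrite dgT.
have [|T [sT tT clT [l [l' [lT l'T ll' dl dl']]]]] := leaves _ _ xF (subxx _).
  move=> T sT clT t tT; rewrite -{1}(setD_subK sT) edges_toU ?disjoint_setD //.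
  by rewrite clT // addn0.
have TF : T = ~: C.
  apply/eqP; rewrite eqEsubset sT -setD_eq0; apply: contraT => /set0Pn[y yD].
  have [|T' [sT' tT' clT' [k [k' [kT k'T kk' dk dk']]]]] :=
      leaves _ _ yD (subsetDl (~: C) T).
    move=> T' sT' clT' t tT'; rewrite -{1}(setD_subK sT).
    rewrite edges_toU ?disjoint_setD // -(setD_subK sT').
    rewrite edges_toU ?disjoint_setD // clT' // addn0.
    rewrite [dg t T](_ : _ = 0) //; apply/eqP; rewrite sum_nat_eq0.
    apply/forall_inP => u uT; rewrite -leqn0 -(clT u uT) m_sym.
    exact/edges_to_ge/(subsetP sT').
  have sT'F := subset_trans sT' (subsetDl _ _).
  have dTT' : [disjoint T & T'].
    rewrite disjoints_subset; apply/subsetP => z zT; rewrite inE.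
    by apply/negP => /(subsetP sT'); rewrite inE zT.
  have dT'T : [disjoint T' & T] by rewrite disjoint_sym.
  have ge (U : {set V}) u u' c : u \in U -> u' \in U -> u != u' ->
      m u c + m u' c <= dg c U.
    move=> uU u'U uu'; rewrite -(m_sym c u) -(m_sym c u') -(edges_to1 c u').
    rewrite -edges_toU1 ?inE //; apply: edges_to_sub.
    by rewrite subUset !sub1set uU.
  have sq2 := square_rot sq; have sq3 := square_rot sq2; have sq4 := square_rot sq3.
  have a1 := square_one sq tT tT' sT sT'F dTT'.
  have a2 := square_one sq2 tT tT' sT sT'F dTT'.
  have b1 := square_one sq tT' tT sT'F sT dT'T.
  have b2 := square_one sq2 tT' tT sT'F sT dT'T.
  have a3 := square_two sq tT tT' sT sT'F dTT'.
  have := ge T l l' c1 lT l'T ll'; have := ge T l l' c2 lT l'T ll'.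
  have := ge T l l' c3 lT l'T ll'; have := ge T l l' c4 lT l'T ll'.
  have := ge T' k k' c1 kT k'T kk'; have := ge T' k k' c2 kT k'T kk'.
  have := ge T' k k' c3 kT k'T kk'; have := ge T' k k' c4 kT k'T kk'.
  have [_ tl] := @square_leaf_type _ _ _ _ _ l sq (eq_leq dl).
  have [_ tl'] := @square_leaf_type _ _ _ _ _ l' sq (eq_leq dl').
  have [_ tk] := @square_leaf_type _ _ _ _ _ k sq (eq_leq dk).
  have [_ tk'] := @square_leaf_type _ _ _ _ _ k' sq (eq_leq dk').
  (* Each of the sixteen ways to assign the four leaves to the two pairs of opposite corners
     violates one of the inequalities. *)
  case: tl => -[-> -> -> ->]; case: tl' => -[-> -> -> ->];
  case: tk => -[-> -> -> ->]; case: tk' => -[-> -> -> ->];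
  move: a1 a2 b1 b2 a3; clear; lia.
have [n12 n13 n14 [n23 n24 n34]] := square_neq sq.
have lC : l \notin C by have := subsetP sT l lT; rewrite inE.
rewrite TF in tT.
have [_ [[l1 l2 l3 l4]|[l1 l2 l3 l4]]] := @square_leaf_type _ _ _ _ _ l sq (eq_leq dl).
  apply: (feedback_pair n13).
  exact: (square_feedback sq tT acF lC dl l1 l2 l3 l4).
apply: (feedback_pair n24).
exact: (square_feedback (square_rot sq) tT acF lC dl l2 l3 l4 l1).
Qed.

End Square.

(* Lovász's description of the multigraphs of minimum degree three without two
   disjoint cycles. *)
Theorem no_disjoint_cycles_cases : 0 < #|V| ->
  [\/ almost_forest, simple_wheel, complete5 | three_covered].
Proof.
case/card_gt0P=> x0 _.
have FBP v w : v != w -> acyclic (~: [set v; w]) ->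
    [\/ almost_forest, simple_wheel, complete5 | three_covered].
  by move=> vw /(feedback_pair vw)[];
    [constructor 1|constructor 2|constructor 4].
have [ac|[S0 _ cS0]] := acyclicVcyclic (~: [set x0]); first by constructor 1; exists x0.
(* The size of a smallest cyclic set decides: the two vertices of a digon meet every cycle, size
   three is a triangle, and size four is a square in a triangle-free graph. *)
case: (@arg_minnP _ S0 cyclic_set (fun X : {set V} => #|X|) cS0) => S cS minS.
have acF := ndc_acyclic cS.
have := cyclic_card_gt1 cS; rewrite leq_eqVlt => /orP[/eqP/esym/eqP|gt2].
  by case/cards2P=> v [w [vw SE]]; apply: (FBP v w vw); rewrite -SE.
have [eS dS] := minimum_cycle_regular cS minS gt2.
have le1 := minimum_cycle_simple minS gt2.
have le4 := minimum_cycle_le4 cS minS gt2.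
have [c1 c1S] := set0Pn _ (cyclic_set_n0 cS).
have := dS c1 c1S => d1.
have /edges_to_gt0P[c2 c2S m12] : 0 < dg c1 S by rewrite d1.
have /edges_to_gt0P[c4] : 0 < dg c1 (S :\ c2).
  by move: d1; rewrite (edges_toD1 c1 c2S); have := le1 c1 c2; clear; lia.
rewrite !inE => /andP[n42 c4S] m14.
have e12 : m c1 c2 = 1 by apply/eqP; rewrite eqn_leq le1.
have e14 : m c1 c4 = 1 by apply/eqP; rewrite eqn_leq le1.
have n12 : c1 != c2 by apply: contraTneq m12 => ->; rewrite m_irr.
have n14 : c1 != c4 by apply: contraTneq m14 => ->; rewrite m_irr.
have n24 : c2 != c4 by rewrite eq_sym.
have card3 : #|c1 |: [set c2; c4]| = 3 by rewrite cardsU1 cards2 !inE negb_or n12 n14 n24.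
have sub3 : c1 |: [set c2; c4] \subset S by rewrite !subUset !sub1set c1S c2S c4S.
case: (ltngtP #|S| 3) => [|gt3|e3]; first by move: gt2; clear; lia.
- have tf x y z : 0 < m x y -> 0 < m y z -> m x z = 0.
    move=> xy yz; apply/eqP; rewrite -leqn0 leqNgt; apply/negP => xz.
    have nxy : x != y by apply: contraTneq xy => ->; rewrite m_irr.
    have nyz : y != z by apply: contraTneq yz => ->; rewrite m_irr.
    have nxz : x != z by apply: contraTneq xz => ->; rewrite m_irr.
    have /minS := three_cyclic nxy nxz nyz xy xz yz.
    by rewrite -setUA cardsU1 cards2 !inE negb_or nxy nxz nyz leqNgt gt3.
  have : #|S :\: (c1 |: [set c2; c4])| = 1.
    by rewrite cardsD (setIidPr sub3) card3; move: gt3 le4; clear; lia.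
  move/eqP/cards1P=> [c3 SD].
  have c3D : c3 \in S :\: (c1 |: [set c2; c4]) by rewrite SD inE.
  move: (c3D); rewrite !inE !negb_or -!andbA => /and4P[n31 n32 n34 c3S].
  have SE : S = c3 |: (c1 |: [set c2; c4]).
    by rewrite -(setD_subK sub3) SD setUC.
  have m13 : m c1 c3 = 0.
    move: d1; rewrite SE !edges_toU1 ?inE ?negb_or ?n31 ?n32 ?n12 //.
    by rewrite edges_to1 e12 e14 m_irr; clear; lia.
  have m24 : m c2 c4 = 0 by apply: (@tf c2 c1 c4); rewrite // m_sym.
  have dgS u : dg u S = m u c3 + (m u c1 + (m u c2 + m u c4)).
    rewrite SE !edges_toU1 ?inE ?negb_or ?n31 ?n32 ?n12 //.
    by rewrite edges_to1.
  have e23 : m c2 c3 = 1.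
    have := dS c2 c2S; rewrite dgS (m_sym c2 c1) e12 m_irr m24; clear; lia.
  have e34 : m c3 c4 = 1.
    have := dS c4 c4S; rewrite dgS (m_sym c4 c1) (m_sym c4 c2) e14 m_irr m24.
    by rewrite m_sym; clear; lia.
  have sq : square c1 c2 c3 c4 S.
    split=> //.
    - rewrite /= !inE !negb_or n12 n14 n24 ![c1 == c3]eq_sym ![c2 == c3]eq_sym.
      by rewrite n31 n32 n34.
    - by move=> x; rewrite SE !inE; do 4!case: eqP.
    - by rewrite m_sym.
  have F0 := minimum_cycle_outside cS minS gt2.
  have [] := square_cases le1 tf sq acF F0.
  + by constructor 1.
  + by constructor 2.
  + by constructor 4.
have SE : S = c1 |: [set c2; c4].
  by apply/esym/eqP; rewrite eqEcard sub3 card3 e3.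
have e24 : m c2 c4 = 1.
  have := dS c2 c2S; rewrite SE edges_toU1 ?inE ?negb_or ?n12 //.
  rewrite edges_toU1 ?inE // m_irr (m_sym c2 c1) e12 edges_to1; clear; lia.
exact: (triangle_cases le1 n12 n14 n24).
Qed.

End EdgeCounting.

(** * Models of minors *)

Lemma ends2 (G : mgraph) (e : edge G) :
  exists v w, v != w /\ ends e = [set v; w].
Proof. by have /cards2P[v [w [vw E]]] := card_ends e; exists v, w. Qed.

Lemma ends2_eq (G : mgraph) (e f : edge G) v w :
  v != w -> ends e = [set v; w] -> v \in ends f -> w \in ends f -> ends f = ends e.
Proof.
move=> vw -> vf wf; apply/esym/eqP; rewrite eqEcard cards2 vw (eqP (card_ends f)).
by rewrite subUset !sub1set vf wf.
Qed.

Lemma connect_map (T T' : finType) (r : rel T) (r' : rel T') (f : T -> T') :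
  (forall x y, r x y -> connect r' (f x) (f y)) ->
  forall x y, connect r x y -> connect r' (f x) (f y).
Proof.
move=> H x y /connectP[p]; elim: p x => [|z p IHp] x /=; first by move=> _ ->.
by case/andP=> /H xz pth lst; apply: connect_trans xz (IHp z pth lst).
Qed.

Lemma connect_exit (T : finType) (r : rel T) (S : {set T}) x y :
  connect r x y -> x \in S -> y \notin S ->
  exists u v, [/\ u \in S, v \notin S & r u v].
Proof.
case/connectP=> p; elim: p x => [|z p IHp] x /=; first by move=> _ -> ->.
case/andP=> xz pth lst xS yS; case: (boolP (z \in S)) => zS; first exact: (IHp z).
by exists x, z.
Qed.

Lemma card_sig_lt (T : finType) (P : pred T) x : ~~ P x -> #|{: {y | P y}}| < #|T|.
Proof.
move=> Px; rewrite card_sig; apply: proper_card; apply/properP.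
by split; [exact/subsetP | exists x].
Qed.

(** * Contraction of an edge *)

Section Contraction.

Variables (G : mgraph) (e : edge G).

Lemma contr_proj_in w : w \in ends e -> contr_proj e w = None.
Proof. by move=> we; rewrite /contr_proj insubN ?negbK. Qed.

Lemma contr_proj_out w (we : w \notin ends e) : contr_proj e w = Some (Sub w we).
Proof. by rewrite /contr_proj insubT. Qed.

Lemma contr_proj_inj u v : contr_proj e u = contr_proj e v ->
  u = v \/ u \in ends e /\ v \in ends e.
Proof.
case: (boolP (u \in ends e)) => ue; case: (boolP (v \in ends e)) => ve; first by right.
- by rewrite contr_proj_in // contr_proj_out.
- by rewrite contr_proj_out contr_proj_in.
- by rewrite !contr_proj_out => -[]; left.
Qed.

Lemma contr_proj_surj (o : vertex (contract e)) : exists v, contr_proj e v = o.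
Proof.
case: o => [[w we]|]; first by exists w; rewrite contr_proj_out.
by have [u [v [_ E]]] := ends2 e; exists u; rewrite contr_proj_in // E !inE eqxx.
Qed.

Lemma contract_adjacent u v : adjacent u v ->
  contr_proj e u = contr_proj e v \/
  @adjacent (contract e) (contr_proj e u) (contr_proj e v).
Proof.
case/existsP=> f /eqP fE; case: (eqVneq (ends f) (ends e)) => [fe|fe].
  by left; rewrite !contr_proj_in // -fe fE !inE eqxx ?orbT.
right; apply/existsP; exists (Sub f fe : contr_edge e).
by rewrite /= /contr_ends /= fE imsetU1 imset_set1.
Qed.

Lemma contract_connected : connected_graph G -> connected_graph (contract e).
Proof.
move=> conn o o'; have [u <-] := contr_proj_surj o; have [v <-] := contr_proj_surj o'.
apply: connect_map (conn u v) => x y /contract_adjacent[->|]; first exact: connect0.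
exact: connect1.
Qed.

Lemma contract_col_sum (b : colouring G) (o : vertex (contract e)) :
  (contract_col b e o = \sum_(v | contr_proj e v == o) b v)%R.
Proof.
case: o => [[w we]|] /=.
  rewrite (big_pred1 w) // => v /=; apply/eqP/eqP => [|->]; last by rewrite contr_proj_out.
  case: (boolP (v \in ends e)) => ve; first by rewrite contr_proj_in.
  by rewrite contr_proj_out => -[].
apply: eq_bigl => v; case: (boolP (v \in ends e)) => ve.
  by rewrite contr_proj_in // eqxx.
by rewrite contr_proj_out.
Qed.

Lemma contract_vertex_card : #|vertex (contract e)| < #|vertex G|.
Proof.
rewrite /= card_option card_sig.
have : #|[pred w | w \notin ends e]| + #|ends e| = #|vertex G|.
  by rewrite addnC -(cardC (mem (ends e))); congr (_ + _); apply: eq_card.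
rewrite (eqP (card_ends e)) => <-; rewrite addn2 ltnS.
by rewrite -[X in X < _]/(#|[pred w | w \notin ends e]|) leqnn.
Qed.

Lemma contract_edge_card : #|edge (contract e)| < #|edge G|.
Proof.
by apply: (card_sig_lt (x := e)); rewrite eqxx.
Qed.

End Contraction.

Lemma minor_trans_step (H G G' : cgraph) :
  minor_step G G' -> cgraph_minor H G' -> cgraph_minor H G.
Proof.
move=> GG' [H' G'H' H'H]; exists H' => //.
by apply: rt_trans G'H'; apply: rt_step.
Qed.

(* A model of [H] in [G]: the branch set of a vertex [h] is its fibre under [phi].
   Since the branch sets cover [G], no vertex has to be deleted and the colours are
   simply pushed forward. *)
Lemma model_minor (H G : mgraph) (b : colouring G) (c : colouring H)
    (phi : vertex G -> vertex H) (psi : edge H -> edge G) :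
  injective psi -> (forall h, exists v, phi v = h) ->
  (forall e, [set phi v | v in ends (psi e)] = ends e) ->
  (forall u v, phi u = phi v ->
     connect (fun x y => (phi x == phi y) && adjacent x y) u v) ->
  (forall h, c h = \sum_(v | phi v == h) b v)%R ->
  cgraph_minor (CGraph c) (CGraph b).
Proof.
have [n] := ubnP #|edge G|; elim: n G b phi psi => // n IHn G b phi psi ltn.
move=> psiI phiS endsE fib cE.
(* An edge inside a branch set is contracted. Neither it nor a parallel edge is in the image of
   [psi], whose edges join two branch sets. *)
case: (boolP [exists e, #|phi @: ends e| == 1]) => [/existsP[e e1]|/existsPn all2].
  have [u [w [uw eE]]] := ends2 e.
  have phie v : v \in ends e -> phi v = phi u.
    have ue : u \in ends e by rewrite eE !inE eqxx.
    move=> ve; case/cards1P: e1 => h hE.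
    have : phi v \in [set h] by rewrite -hE imset_f.
    have : phi u \in [set h] by rewrite -hE imset_f.
    by rewrite !inE => /eqP-> /eqP->.
  pose phi' (o : vertex (contract e)) := if o is Some w then phi (val w) else phi u.
  have phi'E v : phi' (contr_proj e v) = phi v.
    case: (boolP (v \in ends e)) => ve; first by rewrite contr_proj_in // /phi' phie.
    by rewrite contr_proj_out /phi' SubK.
  have psine h : ends (psi h) != ends e.
    apply: contraTneq e1 => E; rewrite -E endsE.
    by rewrite (eqP (card_ends h)).
  pose psi' h : edge (contract e) := Sub (psi h) (psine h).
  apply: minor_trans_step (step_contract b e) _.
  apply: (IHn _ _ phi' psi').
  - exact: leq_trans (contract_edge_card e) ltn.
  - by move=> h h' /(congr1 val) /psiI.
  - by move=> h; have [v <-] := phiS h; exists (contr_proj e v).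
  - move=> h; rewrite -endsE /= /contr_ends /= -imset_comp.
    by apply: eq_imset => v; rewrite /= phi'E.
  - move=> o o'; have [x <-] := contr_proj_surj o; have [y <-] := contr_proj_surj o'.
    rewrite !phi'E => /fib; apply: connect_map => {}x {}y /andP[xy].
    case/(contract_adjacent e) => [->|adj]; first exact: connect0.
    by apply: connect1; rewrite !phi'E xy.
  - move=> h; rewrite cE (partition_big (contr_proj e) (fun o => phi' o == h)) /=.
      apply: eq_bigr => o /eqP oh; rewrite contract_col_sum; apply: eq_bigl => v.
      rewrite -(phi'E v); case: (eqVneq (contr_proj e v) o) => [->|_].
        by rewrite oh eqxx.
      by rewrite andbF.
    by move=> v; rewrite phi'E.
(* Connected branch sets without inner edges are single vertices; only the edges missed by [psi]
   remain to be deleted. *)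
have phiI : injective phi.
  move=> u v /fib/connectP[[|w p] //= /andP[/andP[/eqP uw /existsP[e /eqP eE]] _] _].
  by have := all2 e; rewrite eE imsetU1 imset_set1 uw setUid cards1.
case: (boolP [exists e, e \notin codom psi]) => [/existsP[e eN]|/existsPn allc].
  have psine h : psi h != e by apply: contraNneq eN => <-; apply: codom_f.
  pose psi' h : edge (del_edge e) := Sub (psi h) (psine h).
  apply: minor_trans_step (step_del_edge b e) _.
  apply: (IHn (del_edge e) (del_edge_col b e) phi psi') => //.
  - rewrite ltnS in ltn; apply: leq_trans ltn.
    by apply: (card_sig_lt (x := e)); rewrite eqxx.
  - by move=> h h' /(congr1 val) /psiI.
  - by move=> u v /phiI->; apply: connect0.
have [phi' phi'K] := fin_all_exists phiS.
have psiS e : exists h, psi h = e.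
  by have := allc e; rewrite negbK => /codomP[h ->]; exists h.
have [psi' psi'K] := fin_all_exists psiS.
exists (CGraph b); first exact: rt_refl.
exists phi, psi'; split.
- by exists phi' => // v; apply: phiI.
- by exists psi => // h; apply: psiI.
- by move=> e; rewrite -endsE psi'K.
- move=> v /=; rewrite cE (big_pred1 v) // => u /=.
  by apply/eqP/eqP => [/phiI|->].
Qed.

(** * Edge counts of a multigraph *)

Section EdgeCounts.

Variable G : mgraph.

Definition multiplicity (u v : vertex G) := #|[set e | ends e == [set u; v]]|.

Lemma multiplicity_sym u v : multiplicity u v = multiplicity v u.
Proof. by rewrite /multiplicity setUC. Qed.

Lemma multiplicity_irr v : multiplicity v v = 0.
Proof.
apply: eq_card0 => e; rewrite !inE; apply/negP => /eqP E.
by have := card_ends e; rewrite E setUid cards1.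
Qed.

Lemma edges_to_card v (S : {set vertex G}) :
  edges_to multiplicity v S = #|[set e in incident v | ends e :\ v \subset S]|.
Proof.
rewrite -sum1_card /edges_to /multiplicity.
under eq_bigr => u _ do rewrite -sum1_card.
under eq_bigr => u _ do under eq_bigl => e do rewrite inE.
rewrite (exchange_big_dep xpredT) //= [RHS]big_mkcond /=.
apply: eq_bigr => e _; rewrite sum1_card !inE.
case: (boolP (v \in ends e)) => ve /=; last first.
  apply: eq_card0 => u; rewrite unfold_in; apply/negP => /andP[_ /eqP E].
  by move: ve; rewrite E !inE eqxx.
have [w wv eE] : exists2 w, w != v & ends e = [set v; w].
  have [x [y [xy E]]] := ends2 e; move: ve; rewrite E !inE => /orP[]/eqP->.
    by exists y; rewrite 1?eq_sym.
  by exists x; rewrite // setUC.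
have -> : ends e :\ v = [set w].
  rewrite eE; apply/setP => u; rewrite !inE.
  by case: (eqVneq u v) => [->|] //=; rewrite eq_sym (negbTE wv).
rewrite sub1set; have E u : ([set v; w] == [set v; u]) = (u == w).
  apply/eqP/eqP => [E|->//]; have : w \in [set v; u] by rewrite -E !inE eqxx orbT.
  by rewrite !inE (negbTE wv) => /eqP.
case: (boolP (w \in S)) => wS.
  rewrite (eq_card1 (x := w)) // => u; rewrite unfold_in eE E inE.
  by case: eqP => [->|]; rewrite ?wS ?andbF.
apply: eq_card0 => u; rewrite unfold_in eE E; apply/negP => /andP[uS /eqP uw].
by move: wS; rewrite -uw uS.
Qed.

Lemma degree_card v : edges_to multiplicity v setT = #|incident v|.
Proof. by rewrite edges_to_card; apply: eq_card => e; rewrite !inE subsetT andbT. Qed.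

Lemma edges_in_card (S : {set vertex G}) :
  edges_in multiplicity S = #|[set e | ends e \subset S]|.
Proof.
have [n] := ubnP #|S|; elim: n S => // n IHn S ltn.
have [->|[v vS]] := set_0Vmem S.
  rewrite (edges_in0 multiplicity_sym); apply/esym/eq_card0 => e; rewrite !inE subset0.
  by apply/negP => /eqP E; have := card_ends e; rewrite E cards0.
rewrite (edges_inD1 multiplicity_sym multiplicity_irr vS) IHn; last first.
  by move: ltn; rewrite (cardsD1 v S) vS.
rewrite edges_to_card -(cardsID (incident v) [set e | ends e \subset S]) addnC.
congr (_ + _); apply: eq_card => e; rewrite !inE.
  case: (boolP (v \in ends e)) => ve; rewrite ?andbF //= andbT.
  by rewrite subDset (setUidPr _) ?sub1set.
by rewrite subsetD1 andbC.
Qed.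

End EdgeCounts.

(** * Disjoint cycles and the minor C2 + C2 *)

Section TwoCycles.

Notation cyclic := (cyclic_set (@multiplicity _)).

Lemma cyclicE (G : mgraph) (S : {set vertex G}) :
  cyclic S = (0 < #|S| <= #|[set e | ends e \subset S]|).
Proof. by rewrite /cyclic_set edges_in_card. Qed.

Lemma parallel_cyclic (G : mgraph) (e f : edge G) :
  e != f -> ends f = ends e -> cyclic (ends e).
Proof.
move=> ef E; rewrite cyclicE (eqP (card_ends e)) /=.
apply: leq_trans (_ : #|[set e; f]| <= _); first by rewrite cards2 ef.
by apply: subset_leq_card; rewrite subUset !sub1set !inE E subxx.
Qed.

Definition contract_set (G : mgraph) (e : edge G) (S : {set vertex G}) :
  {set vertex (contract e)} := [set contr_proj e v | v in S].

Lemma contract_edges_in (G : mgraph) (e : edge G) (S : {set vertex G}) :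
  #|[set f | (ends f \subset S) && (ends f != ends e)]|
    <= #|[set f : edge (contract e) | ends f \subset contract_set e S]|.
Proof.
apply: leq_trans (_ : #|[set f : contr_edge e | ends (val f) \subset S]| <= _).
  rewrite -(card_imset _ val_inj); apply: subset_leq_card; apply/subsetP => f.
  rewrite inE => /andP[fS fe]; apply/imsetP.
  by exists (Sub f fe); rewrite ?inE SubK.
by apply: subset_leq_card; apply/subsetP => f; rewrite !inE; apply: imsetS.
Qed.

(** If [e] lies inside [S], the contraction loses one vertex of [S] and, as [e] has no parallel,
    only one edge. Otherwise no edge inside [S] is lost. *)
Lemma contract_cyclic (G : mgraph) (e : edge G) (S : {set vertex G}) :
  cyclic S -> (ends e \subset S -> forall f, ends f = ends e -> f = e) ->
  cyclic (contract_set e S).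
Proof.
move=> + simple; rewrite !cyclicE => /andP[S0 geS].
have S'0 : 0 < #|contract_set e S|.
  by have /card_gt0P[v vS] := S0; apply/card_gt0P; exists (contr_proj e v); apply: imset_f.
rewrite S'0 /=; apply: leq_trans (contract_edges_in e S).
case: (boolP (ends e \subset S)) => eS; last first.
  apply: leq_trans (leq_imset_card _ _) (leq_trans geS _).
  apply: subset_leq_card; apply/subsetP => f; rewrite !inE => fS; rewrite fS /=.
  by apply: contraNneq eS => <-.
have [u [v [uv E]]] := ends2 e.
have [uS vS] : u \in S /\ v \in S.
  by split; apply: (subsetP eS); rewrite E !inE eqxx ?orbT.
have le1 : #|contract_set e S| <= #|S :\ u|.
  apply: leq_trans (leq_imset_card (contr_proj e) _); apply: subset_leq_card.
  apply/subsetP => o /imsetP[w wS ->]; case: (eqVneq w u) => [->|wu]; last first.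
    by apply: imset_f; rewrite !inE wu.
  apply/imsetP; exists v; first by rewrite !inE eq_sym uv.
  by rewrite !contr_proj_in // E !inE eqxx ?orbT.
apply: leq_trans le1 _.
have : #|[set f | ends f \subset S]| <= (#|[set f | (ends f \subset S) && (ends f != ends e)]|).+1.
  rewrite (cardsD1 e) inE eS add1n ltnS; apply: subset_leq_card.
  apply/subsetP => f; rewrite !inE => /andP[fe ->] /=.
  by apply: contraNneq fe => /(simple eS)->.
by move: geS; rewrite (cardsD1 u S) uS; clear; lia.
Qed.

Lemma contract_disjoint (G : mgraph) (e : edge G) (S1 S2 : {set vertex G}) :
  [disjoint S1 & S2] ->
  (forall x y, x \in ends e -> y \in ends e -> x \in S1 -> y \in S2 -> False) ->
  [disjoint contract_set e S1 & contract_set e S2].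
Proof.
move=> dS cross; rewrite disjoints_subset; apply/subsetP => o /imsetP[x xS ->].
rewrite inE; apply/negP => /imsetP[y yS /contr_proj_inj[xy|[xe ye]]].
  by move: yS; rewrite -xy (disjointFr dS xS).
exact: (cross x y).
Qed.

(** A cyclic set contains a digon, or else an edge that [contract_cyclic] permits to contract. *)
Lemma cyclic_normal (G : mgraph) (S : {set vertex G}) : cyclic S ->
  (exists e f, [/\ e != f, ends f = ends e & ends e \subset S]) \/
  (exists2 e, ends e \subset S &
    forall f, ends f = ends e -> f = e).
Proof.
rewrite cyclicE => /andP[S0 geS].
have /card_gt0P[e] := leq_trans S0 geS; rewrite inE => eS.
case: (boolP [exists f, (f != e) && (ends f == ends e)]) => [|/existsPn H].
  by case/existsP=> f /andP[fe /eqP E]; left; exists e, f; rewrite eq_sym.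
right; exists e => // f E; have := H f; rewrite E eqxx andbT negbK.
by move/eqP.
Qed.

Lemma two_digons_minor (G : mgraph) (b : colouring G) (e1 f1 e2 f2 : edge G) :
  e1 != f1 -> e2 != f2 -> ends f1 = ends e1 -> ends f2 = ends e2 ->
  [disjoint ends e1 & ends e2] -> ends e1 :|: ends e2 = setT ->
  exists b' : colouring (disj_union C2 C2), cgraph_minor (CGraph b') (CGraph b).
Proof.
move=> n1 n2 E1 E2 dE cov.
have [u1 [v1 [uv1 ee1]]] := ends2 e1; have [u2 [v2 [uv2 ee2]]] := ends2 e2.
pose phi (v : vertex G) : vertex (disj_union C2 C2) :=
  if v \in ends e1 then inl (v == u1) else inr (v == u2).
pose psi (e : edge (disj_union C2 C2)) : edge G :=
  match e with
  | inl t => if t then e1 else f1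
  | inr t => if t then e2 else f2
  end.
have n2e1 v : v \in ends e2 -> v \in ends e1 = false by move=> ve; rewrite (disjointFl dE ve).
have in2 v : v \notin ends e1 -> v \in ends e2.
  by move=> nv; have := in_setT v; rewrite -cov inE (negbTE nv).
have phi1 : phi u1 = inl true by rewrite /phi ee1 !inE !eqxx.
have phi1' : phi v1 = inl false by rewrite /phi ee1 !inE !eqxx orbT eq_sym (negbTE uv1).
have phi2 : phi u2 = inr true.
  by rewrite /phi n2e1 ?eqxx // ee2 !inE eqxx.
have phi2' : phi v2 = inr false.
  by rewrite /phi n2e1 ?ee2 ?inE ?eqxx ?orbT // eq_sym (negbTE uv2).
have phiI : injective phi.
  have two (u v x y : vertex G) :
      x \in [set u; v] -> y \in [set u; v] -> (x == u) = (y == u) -> x = y.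
    rewrite !inE; case: (eqVneq x u) => [->|_] /=; case: (eqVneq y u) => [->|_] //=.
    by move=> /eqP-> /eqP->.
  move=> x y; rewrite /phi; case: ifP => x1; case: ifP => y1 // [].
    by apply: (two u1 v1); rewrite -ee1.
  by apply: (two u2 v2); rewrite -ee2 in2 ?x1 ?y1.
have digon1 f : ends f = ends e1 -> phi @: ends f = [set inl v | v in [set: bool]].
  move=> ->; rewrite ee1 imsetU1 imset_set1 phi1 phi1'.
  apply/setP => -[t|t]; rewrite !inE; last by apply/esym/imsetP => -[].
  by rewrite mem_imset ?inE; [case: t | move=> ? ? []].
have digon2 f : ends f = ends e2 -> phi @: ends f = [set inr v | v in [set: bool]].
  move=> ->; rewrite ee2 imsetU1 imset_set1 phi2 phi2'.
  apply/setP => -[t|t]; rewrite !inE; first by apply/esym/imsetP => -[].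
  by rewrite mem_imset ?inE; [case: t | move=> ? ? []].
pose c h := (\sum_(v | phi v == h) b v)%R.
exists c; apply: (@model_minor _ _ _ _ phi psi) => //.
- have ne12 e f : ends e = ends e1 -> ends f = ends e2 -> e <> f.
    move=> ee ff ef; have u1e : u1 \in ends e1 by rewrite ee1 !inE eqxx.
    by have := disjointFr dE u1e; rewrite -ff -ef ee u1e.
  move=> [[] | []] [[] | []] //= E; do ?[by rewrite E eqxx in n1 | by rewrite E eqxx in n2];
    by [case: (ne12 _ _ _ _ E) | case: (ne12 _ _ _ _ (esym E))].
- by move=> [[]|[]]; [exists u1|exists v1|exists u2|exists v2].
- by case=> -[] /=; [apply: digon1|apply: digon1|apply: digon2|apply: digon2].
- by move=> u v /phiI->; apply: connect0.
Qed.

(** Simple edges inside the two sets are contracted until digons appear on both sides. The sets then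
    shrink to two digons, and as long as other vertices exist, connectedness supplies an edge
    leaving the digons, whose contraction absorbs one of them. *)
Lemma disjoint_cycles_minor (G : mgraph) (b : colouring G) (S1 S2 : {set vertex G}) :
  connected_graph G -> cyclic S1 -> cyclic S2 -> [disjoint S1 & S2] ->
  exists b' : colouring (disj_union C2 C2), cgraph_minor (CGraph b') (CGraph b).
Proof.
have [n] := ubnP #|vertex G|; elim: n G b S1 S2 => // n IHn G b S1 S2 ltn conn c1 c2 dS.
have contr (A1 A2 : {set vertex G}) e : cyclic A1 -> cyclic A2 -> [disjoint A1 & A2] ->
    (ends e \subset A1 -> forall f, ends f = ends e -> f = e) ->
    (ends e \subset A2 -> forall f, ends f = ends e -> f = e) ->
    (forall x y, x \in ends e -> y \in ends e -> x \in A1 -> y \in A2 -> False) ->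
    exists b' : colouring (disj_union C2 C2), cgraph_minor (CGraph b') (CGraph b).
  move=> cA1 cA2 dA s1 s2 cross.
  have [|||||b' mb'] := IHn (contract e) (contract_col b e)
      (contract_set e A1) (contract_set e A2).
  - rewrite ltnS in ltn; exact: leq_trans (contract_vertex_card e) ltn.
  - exact: contract_connected.
  - exact: contract_cyclic.
  - exact: contract_cyclic.
  - exact: contract_disjoint.
  - by exists b'; apply: minor_trans_step (step_contract b e) mb'.
have inside (A1 A2 : {set vertex G}) e : [disjoint A1 & A2] -> ends e \subset A1 ->
    (forall x, x \in ends e -> x \in A2 -> False) /\ ~ (ends e \subset A2).
  move=> dA eA; have nA x : x \in ends e -> x \in A2 -> False.
    by move=> /(subsetP eA) xA; rewrite (disjointFr dA xA).
  split=> // eA2; have [u [v [_ E]]] := ends2 e.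
  have ue : u \in ends e by rewrite E !inE eqxx.
  exact: (nA u ue (subsetP eA2 _ ue)).
have [[e1 [f1 [n1 E1 s1]]]|[e eS simple]] := cyclic_normal c1; last first.
  have [cr no] := inside _ _ e dS eS.
  by apply: (contr S1 S2 e) => // x y _ ye _; apply: cr.
have [[e2 [f2 [n2 E2 s2]]]|[e eS simple]] := cyclic_normal c2; last first.
  have dS' : [disjoint S2 & S1] by rewrite disjoint_sym.
  have [cr no] := inside _ _ e dS' eS.
  by apply: (contr S1 S2 e) => // x y xe _ xS _; apply: (cr x).
have dE : [disjoint ends e1 & ends e2].
  by apply: disjointWl s1 _; apply: disjointWr s2 _.
case: (eqVneq (ends e1 :|: ends e2) setT) => [cov|nT].
  exact: (two_digons_minor b n1 n2 E1 E2 dE cov).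
have [y yN] : exists y, y \notin ends e1 :|: ends e2.
  apply/existsP; rewrite -negb_forall; apply: contra nT => /forallP H.
  by apply/eqP/setP => z; rewrite H inE.
have [u [v [_ ee1]]] := ends2 e1.
have uE : u \in ends e1 :|: ends e2 by rewrite !inE ee1 !inE eqxx.
(* One end of [e] lies outside both digons, so its contraction neither destroys a digon nor merges
   the two. *)
have [x [z [xE zN /existsP[e /eqP eE]]]] := connect_exit (conn u y) uE yN.
have pc1 := parallel_cyclic n1 E1; have pc2 := parallel_cyclic n2 E2.
have [zn1 zn2] : z \notin ends e1 /\ z \notin ends e2.
  by move: zN; rewrite inE negb_or => /andP.
have ze : z \in ends e by rewrite eE !inE eqxx orbT.
apply: (contr (ends e1) (ends e2) e) => //.
- by move=> /subsetP/(_ z ze); rewrite (negbTE zn1).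
- by move=> /subsetP/(_ z ze); rewrite (negbTE zn2).
move=> p q; rewrite eE !inE => /orP[]/eqP-> /orP[]/eqP->; rewrite ?(negbTE zn1) ?(negbTE zn2) //.
by move=> x1; rewrite (disjointFr dE x1).
Qed.

End TwoCycles.

Local Open Scope group_scope.

(** * Solutions in groups *)

Section CommutingProducts.

Variable gT : groupType.

(** Iterated products in a nonabelian group follow the enumeration of the index type. Freeing
    commuting families from it makes products over the edge types of a graph and of its minors
    comparable. *)
Lemma prodg_perm (I : eqType) (F : I -> gT) (s t : seq I) :
  {in s &, forall i j, commute (F i) (F j)} -> perm_eq s t ->
  \prod_(i <- s) F i = \prod_(i <- t) F i.
Proof.
elim: s t => [|i s IHs] t cF st.
  by move: st; rewrite perm_sym => /perm_nilP->.
have it : i \in t by rewrite -(perm_mem st) mem_head.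
case/splitPr: it st => t1 t2; rewrite perm_sym perm_catC cat_cons perm_cons perm_catC.
rewrite perm_sym => st.
rewrite big_cons big_cat big_cons /= (IHs (t1 ++ t2)) // => [|j k js ks]; last first.
  by apply: cF; rewrite inE ?js ?ks orbT.
rewrite big_cat /= !mulgA; congr (_ * _).
rewrite big_seq; apply: commute_prod => j jt1; apply: cF; first exact: mem_head.
by rewrite inE (perm_mem st) mem_cat jt1 orbT.
Qed.

Variables (I : finType) (F : I -> gT).
Implicit Types D : {set I}.

Lemma prodg_enum D : \prod_(i in D) F i = \prod_(i <- enum D) F i.
Proof. by rewrite -big_filter [index_enum I]unlock. Qed.

Definition commuting D := {in D &, forall i j, commute (F i) (F j)}.

Lemma commuting_sub D D' : D \subset D' -> commuting D' -> commuting D.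
Proof. by move=> /subsetP sD cD i j /sD iD /sD jD; apply: cD. Qed.

Lemma prodg_seq D (s : seq I) : commuting D -> uniq s -> s =i D ->
  \prod_(i in D) F i = \prod_(i <- s) F i.
Proof.
move=> cD us sD; rewrite prodg_enum; apply: prodg_perm.
  by move=> i j; rewrite !mem_enum; apply: cD.
by apply: uniq_perm; rewrite ?enum_uniq // => i; rewrite mem_enum sD.
Qed.

Lemma prodgU D1 D2 : commuting (D1 :|: D2) -> [disjoint D1 & D2] ->
  \prod_(i in D1 :|: D2) F i = \prod_(i in D1) F i * \prod_(i in D2) F i.
Proof.
move=> cD dD; rewrite (@prodg_seq _ (enum D1 ++ enum D2)) //.
- by rewrite big_cat !prodg_enum.
- rewrite cat_uniq !enum_uniq andbT /=; apply/hasPn => i.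
  by rewrite !mem_enum => iD; rewrite (disjointFl dD).
- by move=> i; rewrite mem_cat !mem_enum inE.
Qed.

Lemma prodg_set1 i : \prod_(j in [set i]) F j = F i.
Proof.
rewrite (@prodg_seq _ [:: i]) ?big_seq1 // => [|j].
  by move=> j k; rewrite !inE => /eqP-> /eqP->.
by rewrite !inE.
Qed.

Lemma prodgD1 D i : commuting D -> i \in D ->
  \prod_(j in D) F j = F i * \prod_(j in D :\ i) F j.
Proof.
move=> cD iD; rewrite -{1}(setD1K iD) prodgU ?prodg_set1 ?setD1K //.
by rewrite disjoints1 setD11.
Qed.

Lemma prodg_commute D x : {in D, forall i, commute x (F i)} ->
  commute x (\prod_(i in D) F i).
Proof. exact: commute_prod. Qed.

Lemma prodg_involution D : commuting D -> {in D, forall i, F i * F i = 1} ->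
  (\prod_(i in D) F i) * (\prod_(i in D) F i) = 1.
Proof.
have [n] := ubnP #|D|; elim: n D => // n IHn D ltn cD iD.
have [->|[i ii]] := set_0Vmem D; first by rewrite big_set0 mulg1.
have c' : commuting (D :\ i) by apply: commuting_sub cD; apply: subsetDl.
have cc : commute (F i) (\prod_(j in D :\ i) F j).
  by apply: prodg_commute => j; rewrite !inE => /andP[_ jD]; apply: cD.
rewrite (prodgD1 cD ii) mulgA -[F i * _ * F i]mulgA -cc mulgA iD // mul1g.
apply: IHn => //; first by move: ltn; rewrite (cardsD1 i D) ii.
by move=> j; rewrite !inE => /andP[_]; apply: iD.
Qed.

End CommutingProducts.

Lemma prodg_reindex (gT : groupType) (I I' : finType) (F : I -> gT) (F' : I' -> gT)
    (h : I -> I') (D : {set I}) (D' : {set I'}) :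
  commuting F' D' -> {in D &, injective h} -> h @: D = D' ->
  {in D, forall i, F' (h i) = F i} ->
  \prod_(j in D') F' j = \prod_(i in D) F i.
Proof.
move=> cD' hI hD FE; rewrite (@prodg_seq _ _ _ _ (map h (enum D))) //.
- rewrite big_map -prodg_enum; exact: eq_bigr.
- rewrite map_inj_in_uniq ?enum_uniq // => i j; rewrite !mem_enum; exact: hI.
- move=> j; rewrite -hD; apply/mapP/imsetP => -[i]; rewrite ?mem_enum => iD ->;
    by exists i; rewrite ?mem_enum.
Qed.

(** * Families extended by the value 1 *)

Section Extension.

Variables (gT : groupType) (I : finType) (P : pred I) (x : {i : I | P i} -> gT).

Definition extend1 (i : I) : gT := oapp x 1 (insub i).

Lemma extend1_val (i : {i : I | P i}) : extend1 (val i) = x i.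
Proof. by rewrite /extend1 valK. Qed.

Lemma extend1_out i : ~~ P i -> extend1 i = 1.
Proof. by move=> nP; rewrite /extend1 insubN. Qed.

Lemma extend1_ind (Q : gT -> Prop) i :
  Q 1 -> (forall j, val j = i -> Q (x j)) -> Q (extend1 i).
Proof. by move=> Q1 QP; rewrite /extend1; case: insubP => //= j _ /QP. Qed.

Lemma extend1_commuting (D : {set I}) (D' : {set {i : I | P i}}) :
  commuting x D' -> (forall j, val j \in D -> j \in D') -> commuting extend1 D.
Proof.
move=> cD' DD' i j iD jD.
apply: (extend1_ind (Q := commute^~ _)) => [|i' i'E].
  exact/commute_sym/commute1.
apply: (extend1_ind (Q := commute _)) => [|j' j'E]; first exact: commute1.
by apply: cD'; rewrite DD' ?i'E ?j'E.
Qed.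

Lemma prodg_extend1 (D : {set I}) (D' : {set {i : I | P i}}) :
  commuting x D' -> (forall j, (j \in D') = (val j \in D)) ->
  \prod_(i in D) extend1 i = \prod_(j in D') x j.
Proof.
move=> cD' DE.
have -> : \prod_(i in D) extend1 i = \prod_(i in [set i in D | P i]) extend1 i.
  rewrite big_mkcond [RHS]big_mkcond; apply: eq_bigr => i _; rewrite inE.
  by case: (i \in D) => //=; case: (boolP (P i)) => // /extend1_out.
apply: (prodg_reindex (h := val)).
- apply: commuting_sub (extend1_commuting cD' (D := D) _).
    by apply/subsetP => i; rewrite inE => /andP[].
  by move=> j; rewrite DE.
- by move=> i j _ _; apply: val_inj.
- apply/setP => i; rewrite inE; apply/imsetP/andP => [[j]|[iD Pi]].
    by rewrite DE => jD ->; split=> //; apply: valP.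
  by exists (Sub i Pi); rewrite ?DE SubK.
- by move=> i _; apply: extend1_val.
Qed.

Lemma extend1_involution i : (forall j, x j * x j = 1) -> extend1 i * extend1 i = 1.
Proof.
move=> x2; apply: (extend1_ind (Q := fun y => y * y = 1)) => [|j _] //.
exact: mulg1.
Qed.

Lemma extend1_commute i z : (forall j, commute (x j) z) -> commute (extend1 i) z.
Proof.
move=> xz; apply: (extend1_ind (Q := commute^~ z)) => [|j _] //.
exact/commute_sym/commute1.
Qed.

End Extension.

Lemma Z2_cases (a : 'Z_2) : a = 0%R \/ a = 1%R.
Proof. by case: a => -[|[|]] // i; [left|right]; apply: val_inj. Qed.

Lemma expg_Z2D (gT : groupType) (J : gT) (a b : 'Z_2) :
  J * J = 1 -> J ^+ (a + b)%R = J ^+ a * J ^+ b.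
Proof.
move=> J2; case: (Z2_cases a) => ->; case: (Z2_cases b) => ->;
  rewrite /= ?expg0 ?expg1 ?mul1g ?mulg1 //.
Qed.

Lemma Z2_addrr (a : 'Z_2) : (a + a = 0)%R.
Proof. by case: (Z2_cases a) => ->; apply: val_inj. Qed.

(** * Solutions and the group Gamma *)

Section Solutions.

Record solution (gT : groupType) (G : mgraph) (b : colouring G)
    (x : edge G -> gT) (J : gT) : Prop := Solution {
  sol_JJ : J * J = 1;
  sol_xx : forall e, x e * x e = 1;
  sol_xJ : forall e, commute (x e) J;
  sol_comm : forall v, commuting x (incident v);
  sol_vertex : forall v, \prod_(e in incident v) x e = J ^+ b v }.

(** Commutation with [J] is part of a solution, so only the edge elements have to be compared. *)
Definition commutative_solutions (G : mgraph) (b : colouring G) :=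
  forall (gT : groupType) (x : edge G -> gT) (J : gT),
    solution b x J -> forall e f, commute (x e) (x f).

Variables (G : mgraph) (b : colouring G).

Notation X := (gamma_gen G).
Notation cls := (wclass (gamma_rel b)).

Lemma wclass_winv (w : word X) : cls (winv w) = (cls w)^-1.
Proof.
apply/esym/mulg1_eq; rewrite -wclassM; apply/wclassP; exact: wcongr_catV.
Qed.

Lemma wclass_wcomm (u v : word X) :
  cls (wcomm u v) = 1 -> commute (cls u) (cls v).
Proof.
rewrite /wcomm !wclassM !wclass_winv => e.
apply: (mulgI (cls v)^-1); apply: (mulgI (cls u)^-1).
by rewrite e mulKg mulVg.
Qed.

Lemma Gamma_solution : solution b (fun e => cls (genx e)) (cls (@genJ G)).
Proof.
have rel1 u v : gamma_rel b u v -> cls u = cls v.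
  by move=> r; apply/wclassP/wcongr_rel.
split.
- by rewrite -wclassM; apply: rel1; constructor.
- by move=> e; rewrite -wclassM; apply: rel1; constructor.
- by move=> e; apply: wclass_wcomm; apply: rel1; constructor.
- by move=> v e f ev fv; apply: wclass_wcomm; apply: rel1; apply: rel_comm ev fv.
- move=> v; have := rel1 _ _ (rel_vertex b v).
  rewrite (big_morph cls (wclassM _) (erefl _)) => ->.
  by elim: (nat_of_ord (b v)) => //= n IHn; rewrite -cat1s wclassM IHn expgS.
Qed.

Lemma Gamma_commutative :
  (forall e f, commute (cls (genx e)) (cls (genx f))) ->
  forall x y : Gamma b, x * y = y * x.
Proof.
move=> cxx; have sol := Gamma_solution.
have gen (y : Gamma b) : (forall g : X, commute y (cls (wgen g))) ->
    forall x : Gamma b, commute y x.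
  move=> cy x; rewrite -(wclass_repr x).
  elim: (repr x) => [|[g s] w IHw]; first exact: commute1.
  rewrite -cat1s wclassM; apply: commuteM => //.
  case: s; first exact: cy.
  have -> : cls [:: (g, false)] = (cls (wgen g))^-1 by rewrite -wclass_winv.
  exact/commuteV/cy.
have genJ_c (g : X) : commute (cls (@genJ G)) (cls (wgen g)).
  case: g => [e|]; last exact: commute_refl.
  exact/commute_sym/(sol_xJ sol).
move=> x; apply/(gen x) => g; apply/commute_sym/gen => h.
case: g => [e|]; last exact: genJ_c.
case: h => [f|]; first exact: cxx.
exact: (sol_xJ sol).
Qed.

Section Evaluation.

Variables (gT : groupType) (x : edge G -> gT) (J : gT).
Hypothesis sol : solution b x J.

Definition gen_value (g : X) : gT := if g is Some e then x e else J.

Definition word_value (w : word X) : gT :=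
  \prod_(a <- w) (if a.2 then gen_value a.1 else (gen_value a.1)^-1).

Lemma word_value_cat u v : word_value (u ++ v) = word_value u * word_value v.
Proof. exact: big_cat. Qed.

Lemma word_value_gen g : word_value (wgen g) = gen_value g.
Proof. exact: big_seq1. Qed.

Lemma word_value_comm g h : commute (gen_value g) (gen_value h) ->
  word_value (wcomm (wgen g) (wgen h)) = 1.
Proof.
move=> cgh; rewrite !word_value_cat /winv /rev /= !word_value_gen.
by rewrite /word_value !big_seq1 /= cgh !mulgA mulgVK mulVg.
Qed.

(** The universal property of [Gamma] on words: a solution defines a homomorphism from the presented
    group. *)
Lemma word_value_congr u v : wcongr (gamma_rel b) u v -> word_value u = word_value v.
Proof.
elim=> {u v} [//|u v _ -> //|u v w _ -> _ ->//|u u' v v' _ e _ e'|g s|u v].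
- by rewrite !word_value_cat e e'.
- rewrite /word_value big_cons big_seq1 big_nil /=.
  by case: s; rewrite /= ?mulgV ?mulVg.
case=> {u v}.
- by rewrite word_value_cat !word_value_gen (sol_JJ sol) /word_value big_nil.
- by move=> e; rewrite word_value_cat !word_value_gen (sol_xx sol) /word_value big_nil.
- by move=> e; rewrite word_value_comm ?/word_value ?big_nil //; apply: (sol_xJ sol).
- move=> v e f ev fv; rewrite word_value_comm ?/word_value ?big_nil //.
  exact: (sol_comm sol ev fv).
- move=> v; rewrite (big_morph word_value word_value_cat (erefl _)).
  rewrite (eq_bigr x) => [|e _]; last exact: word_value_gen.
  rewrite [word_value [::]]big_nil (sol_vertex sol).
  elim: (nat_of_ord (b v)) => /= [|n IHn]; first by rewrite /word_value big_nil.
  by rewrite -cat1s word_value_cat -IHn expgS word_value_gen.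
Qed.

End Evaluation.

Lemma Gamma_commutativeP :
  (forall x y : Gamma b, x * y = y * x) <-> commutative_solutions b.
Proof.
split=> [cG gT x J sol e f|cs]; last exact/Gamma_commutative/(cs _ _ _ Gamma_solution).
have := cG (cls (genx e)) (cls (genx f)); rewrite -!wclassM => /wclassP.
by move/(word_value_congr sol); rewrite !word_value_cat !word_value_gen.
Qed.

End Solutions.

(** * Solutions of a graph from solutions of its minors *)

Section MinorSolutions.

Variables (G : mgraph) (b : colouring G) (gT : groupType) (J : gT).

Lemma del_edge_solution (e : edge G) (x : del_edge_edge e -> gT) :
  solution (del_edge_col b e) x J -> solution b (extend1 x) J.
Proof.
move=> sol; have DE (v : vertex G) (j : del_edge_edge e) :
    (j \in @incident (del_edge e) v) = (val j \in incident v).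
  by rewrite !inE.
split=> [|f|f|v|v].
- exact: sol_JJ sol.
- exact/extend1_involution/(sol_xx sol).
- exact/extend1_commute/(sol_xJ sol).
- by apply: extend1_commuting (sol_comm sol (v := v)) _ => j; rewrite DE.
- by rewrite (prodg_extend1 (sol_comm sol (v := v)) (DE v)) (sol_vertex sol).
Qed.

(** All edges at [v] take the value 1, and the relation at [v] then holds because the colour there
    is 0. *)
Lemma del_vertex_solution (v : vertex G) (x : del_vertex_edge v -> gT) :
  b v = 0%R -> solution (del_vertex_col b v) x J -> solution b (extend1 x) J.
Proof.
move=> bv sol.
have DE w (wv : w != v) (j : del_vertex_edge v) :
    (j \in incident (Sub w wv : vertex (del_vertex v))) = (val j \in incident w).
  by rewrite !inE.
have out f : f \in incident v -> extend1 x f = 1.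
  by move=> fv; apply: extend1_out; rewrite fv.
split=> [|f|f|w|w].
- exact: sol_JJ sol.
- exact/extend1_involution/(sol_xx sol).
- exact/extend1_commute/(sol_xJ sol).
- have [->|wv] := eqVneq w v; first by move=> f g /out-> _; apply/commute_sym/commute1.
  by apply: extend1_commuting (sol_comm sol (v := Sub w wv)) _ => j; rewrite DE.
- have [->|wv] := eqVneq w v; first by rewrite bv big1.
  rewrite (prodg_extend1 (sol_comm sol (v := Sub w wv)) (DE w wv)) (sol_vertex sol).
  by rewrite /del_vertex_col SubK.
Qed.

Lemma toggle_solution (e : edge G) (x : edge G -> gT) :
  solution (toggle b e) x J ->
  solution b (fun f => if f == e then x f * J else x f) J.
Proof.
move=> sol; have xJ := sol_xJ sol; have JJ := sol_JJ sol.
set y := fun f => _.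
have yc f g : commute (x f) (x g) -> commute (y f) (y g).
  move=> cfg; have cJ h : commute (y h) J.
    rewrite /y; case: eqP => // _; apply: commute_sym; apply: commuteM; last by [].
    exact/commute_sym.
  have cx : commute (y f) (x g).
    rewrite /y; case: eqP => // _; apply: commute_sym.
    by apply: commuteM; [exact/commute_sym | exact: xJ].
  by rewrite {2}/y; case: eqP => // _; apply: commuteM.
have cy v : commuting y (incident v).
  by move=> f g fv gv; apply/yc/(sol_comm sol fv gv).
split=> // [f|f|v].
- rewrite /y; case: eqP => [->|_]; last exact: (sol_xx sol).
  by rewrite -mulgA (mulgA J) -xJ -mulgA JJ mulg1 (sol_xx sol).
- rewrite /y; case: eqP => // _; apply: commute_sym; apply: commuteM; last by [].
  exact/commute_sym.
- case: (boolP (v \in ends e)) => ve; last first.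
    rewrite (eq_bigr x) => [|f fv]; last first.
      by rewrite /y; case: eqP => // fe; move: fv; rewrite fe inE (negbTE ve).
    by rewrite (sol_vertex sol) /toggle (negbTE ve).
  have ei : e \in incident v by rewrite inE.
  have := sol_vertex sol v; rewrite (prodgD1 (cy v) ei) (prodgD1 (sol_comm sol (v := v)) ei).
  rewrite {1}/y eqxx /toggle ve expg_Z2D // expg1 => eqv.
  rewrite (eq_bigr x) => [|f]; last first.
    by rewrite !inE /y => /andP[/negbTE->].
  rewrite xJ -mulgA eqv.
  have : commute J (J ^+ b v) by apply/commuteX/commute_refl.
  by rewrite /commute => cJb; rewrite mulgA cJb -mulgA JJ mulg1.
Qed.

Section Contraction.

Variables (e : edge G) (v1 v2 : vertex G).
Hypotheses (v12 : v1 != v2) (ee : ends e = [set v1; v2]).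

Let in_ends u : (u \in ends e) = (u == v1) || (u == v2).
Proof. by rewrite ee !inE. Qed.

Lemma contr_incident_out (w : vertex G) (we : w \notin ends e) (f : contr_edge e) :
  (f \in incident (Some (Sub w we) : vertex (contract e))) = (val f \in incident w).
Proof.
rewrite !inE; apply/imsetP/idP => [[u uf]|wf]; last first.
  by exists w => //; rewrite /contr_proj insubT.
rewrite /contr_proj; case: insubP => // u' _ uE /Some_inj wE.
by move: uf; rewrite -uE -wE SubK.
Qed.

Lemma contr_incident_new (f : contr_edge e) :
  (f \in incident (None : vertex (contract e))) =
  (val f \in incident v1) || (val f \in incident v2).
Proof.
rewrite !inE; apply/imsetP/orP => [[u uf]|].
  rewrite /contr_proj; case: insubP => // /negPn ue _.
  by move: ue uf; rewrite in_ends => /orP[]/eqP->; [left|right].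
by case=> vf; [exists v1|exists v2] => //;
  rewrite /contr_proj insubN // negbK in_ends eqxx ?orbT.
Qed.

Lemma contr_not_both (f : contr_edge e) :
  val f \in incident v1 -> val f \in incident v2 -> False.
Proof.
rewrite !inE => f1 f2; have := valP f.
by rewrite /= (ends2_eq v12 ee f1 f2) eqxx.
Qed.

Lemma contract_col_new : contract_col b e None = (b v1 + b v2)%R.
Proof. by rewrite /contract_col [ends _]ee big_setU1 ?inE //= big_set1. Qed.

(** That the value chosen at [v1] also fits at [v2] is the relation at the merged vertex, which
    likewise provides all commutations at both ends. Edges parallel to [e] vanish in the contraction
    and take the value 1 through [extend1]. *)
Lemma contract_solution (x : contr_edge e -> gT) :
  solution (contract_col b e) x J ->
  solution b (fun f => if f == e then
    J ^+ b v1 * \prod_(g in [set g : contr_edge e | val g \in incident v1]) x g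
    else extend1 x f) J.
Proof.
move=> sol; have JJ := sol_JJ sol; have xJ := sol_xJ sol.
pose E v := [set g : contr_edge e | val g \in incident v].
set pe := J ^+ _ * _; set y := fun f => _.
have cN : commuting x (incident (None : vertex (contract e))) := sol_comm sol (v := None).
have sE v : v \in ends e -> E v \subset incident (None : vertex (contract e)).
  rewrite in_ends => /orP[]/eqP->; apply/subsetP => f;
    by rewrite contr_incident_new inE => ->; rewrite ?orbT.
have v1e : v1 \in ends e by rewrite in_ends eqxx.
have v2e : v2 \in ends e by rewrite in_ends eqxx orbT.
have cE v : v \in ends e -> commuting x (E v).
  by move=> /sE sv; apply: commuting_sub cN.
have EE v (j : contr_edge e) : (j \in E v) = (val j \in incident v) by rewrite inE.
have expe : extend1 x e = 1 by apply: extend1_out; rewrite eqxx.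
have cJX n z : commute z J -> commute z (J ^+ n) by move=> zJ; apply: commuteX.
have pJ : commute pe J.
  apply: commute_sym; apply: commuteM; first exact/cJX/commute_refl.
  by apply: prodg_commute => g _; apply/commute_sym.
have pN g : g \in incident (None : vertex (contract e)) -> commute (x g) pe.
  move=> gN; apply: commuteM; first exact: cJX.
  by apply: prodg_commute => h hE; apply: cN => //; apply: (subsetP (sE _ v1e)).
have pP : \prod_(g in E v1) x g * \prod_(g in E v1) x g = 1.
  by apply: prodg_involution => [|g _]; [apply: cE | apply: (sol_xx sol)].
have ext_v v f : v \in ends e -> f \in incident v -> commute (extend1 x f) pe.
  move=> ve fv; apply: (extend1_ind (Q := commute^~ pe)) => [|j jf].
    exact/commute_sym/commute1.
  by apply/pN/(subsetP (sE _ ve)); rewrite inE jf.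
have cext v : commuting (extend1 x) (incident v).
  case: (boolP (v \in ends e)) => ve.
    by apply: extend1_commuting (cE v ve) _ => j; rewrite EE.
  apply: extend1_commuting (sol_comm sol (v := Some (Sub v ve))) _ => j.
  by rewrite contr_incident_out.
have cy v : commuting y (incident v).
  move=> f g fv gv; rewrite /y; case: eqP => [fe|_]; case: eqP => [ge|_].
  - exact: commute_refl.
  - apply: commute_sym; apply: ext_v gv.
    by move: fv; rewrite fe inE.
  - by apply: ext_v fv; move: gv; rewrite ge inE.
  - exact: cext fv gv.
have prodE v : v \in ends e ->
    \prod_(f in incident v) y f = pe * \prod_(g in E v) x g.
  move=> ve; have ei : e \in incident v by rewrite inE.
  rewrite (prodgD1 (cy v) ei) {1}/y eqxx; congr (_ * _).
  rewrite -(prodg_extend1 (cE v ve) (EE v)) (prodgD1 (cext v) ei) expe mul1g.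
  by apply: eq_bigr => f; rewrite !inE /y => /andP[/negbTE->].
split=> // [f|f|v].
- rewrite /y; case: eqP => [_|_]; last exact/extend1_involution/(sol_xx sol).
  rewrite {2}/pe mulgA [pe * _](_ : _ = J ^+ b v1 * pe); last first.
    exact/cJX.
  rewrite /pe -!mulgA pP mulg1 -expg_Z2D // Z2_addrr; exact: expg0.
- rewrite /y; case: eqP => // _; exact/extend1_commute.
- case: (boolP (v \in ends e)) => ve; last first.
    rewrite (eq_bigr (extend1 x)) => [|f fv]; last first.
      by rewrite /y; case: eqP => // fe; move: fv; rewrite fe inE (negbTE ve).
    rewrite (prodg_extend1 (sol_comm sol (v := Some (Sub v ve)))); last first.
      by move=> j; rewrite contr_incident_out.
    by rewrite (sol_vertex sol) /contract_col SubK.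
  rewrite prodE //; move: (ve); rewrite in_ends => /orP[]/eqP vE.
    by rewrite vE /pe -mulgA pP mulg1.
  have := sol_vertex sol None.
  have -> : incident (None : vertex (contract e)) = E v1 :|: E v2.
    by apply/setP => f; rewrite contr_incident_new !inE.
  rewrite prodgU.
  + rewrite contract_col_new expg_Z2D // vE /pe -mulgA => ->.
    by rewrite mulgA -expg_Z2D // Z2_addrr expg0 mul1g.
  + by apply: commuting_sub cN; rewrite subUset !sE.
  + rewrite disjoints_subset; apply/subsetP => f; rewrite [f \in E v1]inE => f1.
    by rewrite inE; apply/negP; rewrite inE => /(contr_not_both f1).
Qed.

End Contraction.

End MinorSolutions.

Lemma minor_step_commutative (G H : cgraph) : minor_step G H ->
  commutative_solutions (@colour_of G) -> commutative_solutions (@colour_of H).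
Proof.
case=> {G H} G b => [e|e|v bv|e] cG gT x J /= sol f g.
- have := cG _ _ _ (del_edge_solution sol) (val f) (val g).
  by rewrite !extend1_val.
- have [v1 [v2 [v12 ee]]] := ends2 e.
  have := cG _ _ _ (contract_solution v12 ee sol) (val f) (val g).
  have ne (h : contr_edge e) : (val h == e) = false.
    by apply/eqP => he; have := valP h; rewrite /= he eqxx.
  by rewrite !ne !extend1_val.
- have := cG _ _ _ (del_vertex_solution bv sol) (val f) (val g).
  by rewrite !extend1_val.
- have xJ := sol_xJ sol.
  have JJ := sol_JJ sol.
  pose y h := if h == e then x h * J else x h.
  have cy : commute (y f) (y g) := cG _ _ _ (toggle_solution sol) f g.
  have yE h : x h = y h \/ x h = y h * J.
    by rewrite /y; case: eqP => _; [right; rewrite -mulgA JJ mulg1 | left].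
  have yJ h : commute (y h) J.
    rewrite /y; case: eqP => // _; apply: commute_sym; apply: commuteM; last by [].
    exact/commute_sym.
  have c1 : commute (y f) (x g) by case: (yE g) => ->; [exact: cy | apply: commuteM].
  case: (yE f) => ->; first exact: c1.
  by apply: commute_sym; apply: commuteM; [exact/commute_sym | exact: xJ].
Qed.

Lemma cgraph_iso_commutative (G H : cgraph) : cgraph_iso G H ->
  commutative_solutions (@colour_of G) -> commutative_solutions (@colour_of H).
Proof.
case=> f [g [bf bg endsg colf]] cG gT x J sol.
have [g' gK g'K] := bg.
have inc v e : (g e \in incident (f v)) = (e \in incident v).
  by rewrite !inE endsg mem_imset //; apply: bij_inj.
have imE v : g @: incident v = incident (f v).
  apply/setP => e; rewrite -[e]g'K mem_imset ?inc //; exact: bij_inj.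
suff solG : solution (@colour_of G) (x \o g) J.
  by move=> e e'; have := cG _ _ _ solG (g' e) (g' e'); rewrite /= !g'K.
split=> [|e|e|v e e' ev e'v|v].
- exact: sol_JJ sol.
- exact: sol_xx sol _.
- exact: sol_xJ sol _.
- by apply: (sol_comm sol (v := f v)); rewrite inc.
- rewrite -colf -(sol_vertex sol (f v)); apply/esym.
  apply: (prodg_reindex (h := g)) => //.
  + exact: (sol_comm sol (v := f v)).
  + by move=> e e' _ _; apply: bij_inj.
Qed.

Lemma cgraph_minor_commutative (G H : cgraph) : cgraph_minor H G ->
  commutative_solutions (@colour_of G) -> commutative_solutions (@colour_of H).
Proof.
case=> H' GH' H'H cG; apply: (cgraph_iso_commutative H'H).
elim: GH' cG => // [K L|K L M _ IH1 _ IH2 /IH1/IH2//].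
exact: minor_step_commutative.
Qed.

(** * Noncommuting solutions *)

Section Toggling.

Variable G : mgraph.

Lemma commutative_solutions_eq (b b' : colouring G) :
  b =1 b' -> commutative_solutions b -> commutative_solutions b'.
Proof.
move=> bb' cb gT x J sol; apply: (cb gT x J); case: sol => JJ xx xJ xc xv.
by split=> // v; rewrite xv bb'.
Qed.

Definition flip (b : colouring G) (u v : vertex G) : colouring G :=
  fun w => (b w + (w == u)%:R + (w == v)%:R)%R.

(** Interior vertices of a path from [u] to [v] are toggled twice, so only the colours of [u] and
    [v] change. *)
Lemma flip_commutative (b : colouring G) (u v : vertex G) :
  connect (@adjacent G) u v ->
  commutative_solutions b -> commutative_solutions (flip b u v).
Proof.
case/connectP=> p; elim: p u b => [|w p IHp] u b /=.
  move=> _ ->; apply: commutative_solutions_eq => w.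
  by rewrite /flip -addrA Z2_addrr addr0.
case/andP=> /existsP[e /eqP ee] pth lst cb.
have uw : u != w by have := card_ends e; rewrite ee cards2; case: (u == w).
have ct : commutative_solutions (toggle b e).
  exact: (minor_step_commutative (step_toggle b e)).
apply: commutative_solutions_eq (IHp w (toggle b e) pth lst ct) => z.
rewrite /flip /toggle ee !inE; case: (eqVneq z u) => [->|zu].
  by rewrite (negbTE uw) addr0.
case: (eqVneq z w) => [->|zw]; rewrite /= ?addr0 //.
by rewrite -!addrA (addrA 1%R) Z2_addrr add0r.
Qed.

(** With equal parities a vertex where the colourings differ cannot be the only one, and toggling
    along a path to a second such vertex repairs both. *)
Lemma parity_commutative (b b' : colouring G) :
  connected_graph G -> parity b = parity b' ->
  commutative_solutions b -> commutative_solutions b'.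
Proof.
move=> conn; have [n] := ubnP #|[set v | b v != b' v]|.
elim: n b => // n IHn b ltn par cb.
have [D0|[u uD]] := set_0Vmem [set v | b v != b' v].
  apply: commutative_solutions_eq cb => v; apply/eqP; apply: contraT => vD.
  by have := in_set0 v; rewrite -D0 inE vD.
have [v vD vu] : exists2 v, b v != b' v & v != u.
  apply/exists_inP; apply: contraT; rewrite negb_exists_in => /forall_inP H.
  have : (\sum_v (b v - b' v))%R = 0%R by rewrite sumrB [X in (X - _)%R]par subrr.
  rewrite (bigD1 u) //= big1 => [|v vu].
    by rewrite addr0 => /eqP; rewrite subr_eq0; move: uD; rewrite inE => /negbTE->.
  apply/eqP; rewrite subr_eq0; apply: contraT => /H.
  by rewrite negbK => /eqP vE; rewrite vE eqxx in vu.
rewrite inE in uD.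
have flipE (a c : 'Z_2) : a != c -> (a + 1)%R = c.
  by case: (Z2_cases a) => ->; case: (Z2_cases c) => -> // _; apply: val_inj.
apply: (IHn (flip b u v)).
- apply: leq_trans (_ : #|[set v | b v != b' v]| <= n) => //.
  apply: proper_card; apply/properP; split.
    apply/subsetP => w; rewrite !inE /flip.
    case: (eqVneq w u) => [->|wu]; first by rewrite uD.
    by case: (eqVneq w v) => [->|wv]; rewrite ?vD ?addr0.
  exists u; first by rewrite inE.
  by rewrite inE negbK /flip eqxx (eq_sym u v) (negbTE vu) addr0 (flipE _ _ uD).
- rewrite -par /parity /flip !big_split /= -addrA.
  have sd w : (\sum_(z : vertex G) (z == w)%:R = 1 :> 'Z_2)%R.
    by rewrite (bigD1 w) //= eqxx big1 ?addr0 // => z /negbTE->.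
  by rewrite !sd Z2_addrr addr0.
- exact: flip_commutative.
Qed.

End Toggling.

(* [(p, q, s)] stands for the real three-qubit Pauli operator [(-1)^s X^p Z^q]. *)
Definition bits := (bool * bool * bool)%type.

Definition bits_add (a b : bits) : bits :=
  (a.1.1 (+) b.1.1, a.1.2 (+) b.1.2, a.2 (+) b.2).

Definition bits_dot (a b : bits) : bool :=
  a.1.1 && b.1.1 (+) a.1.2 && b.1.2 (+) a.2 && b.2.

Definition pauli : Type := (bits * bits * bool)%type.

HB.instance Definition _ := Choice.on pauli.

Definition pauli_one : pauli :=
  ((false, false, false), (false, false, false), false).

Definition pauli_mul (a b : pauli) : pauli :=
  (bits_add a.1.1 b.1.1, bits_add a.1.2 b.1.2,
   a.2 (+) b.2 (+) bits_dot a.1.2 b.1.1).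

(** The square of X^p Z^q is (-1)^(p.q), and the sign compensates for it. *)
Definition pauli_inv (a : pauli) : pauli :=
  (a.1.1, a.1.2, a.2 (+) bits_dot a.1.2 a.1.1).

Lemma bits_addA : associative bits_add.
Proof. by move=> a b c; rewrite /bits_add /= !addbA. Qed.

Lemma bits_dotDl a b c : bits_dot (bits_add a b) c = bits_dot a c (+) bits_dot b c.
Proof.
case: a => -[a1 a2] a3; case: b => -[b1 b2] b3; case: c => -[c1 c2] c3.
by case: c1; case: c2; case: c3; rewrite /bits_dot /= ?andbT ?andbF ?addbF ?addFb;
  case: a1; case: a2; case: a3; case: b1; case: b2; case: b3.
Qed.

Lemma bits_dotC a b : bits_dot a b = bits_dot b a.
Proof. by rewrite /bits_dot ![_ && b.1.1]andbC ![_ && b.1.2]andbC ![_ && b.2]andbC. Qed.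

Lemma bits_dotDr a b c : bits_dot a (bits_add b c) = bits_dot a b (+) bits_dot a c.
Proof. by rewrite bits_dotC bits_dotDl !(bits_dotC a). Qed.

Fact pauli_mulA : associative pauli_mul.
Proof.
move=> a b c; rewrite /pauli_mul /= !bits_addA bits_dotDl bits_dotDr.
congr (_, _, _); move: a.2 b.2 c.2 (bits_dot _ _) (bits_dot _ _) (bits_dot _ _).
by do 6!case.
Qed.

Fact pauli_mul1 : left_id pauli_one pauli_mul.
Proof. by case=> -[[[p1 p2] p3] [[q1 q2] q3]] s; rewrite /pauli_mul /= addbF. Qed.

Fact pauli_1mul : right_id pauli_one pauli_mul.
Proof.
case=> -[[[p1 p2] p3] [[q1 q2] q3]] s.
by rewrite /pauli_mul /bits_add /bits_dot /= !andbF !addbF.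
Qed.

Fact pauli_mulV : left_inverse pauli_one pauli_inv pauli_mul.
Proof.
case=> -[[[p1 p2] p3] [[q1 q2] q3]] s.
rewrite /pauli_mul /bits_add /pauli_inv /= !addbb -addbA addbC.
by case: s => /=; rewrite ?addbb //; case: (bits_dot _ _).
Qed.

Fact pauli_Vmul : right_inverse pauli_one pauli_inv pauli_mul.
Proof.
case=> -[[[p1 p2] p3] [[q1 q2] q3]] s.
rewrite /pauli_mul /bits_add /pauli_inv /= !addbb.
by case: s => /=; rewrite ?addbb //; case: (bits_dot _ _).
Qed.

HB.instance Definition _ := isGroup.Build pauli
  pauli_mulA pauli_mul1 pauli_1mul pauli_mulV pauli_Vmul.

Definition pauliX (p1 p2 p3 : bool) : pauli := ((p1, p2, p3), (false, false, false), false).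
Definition pauliZ (q1 q2 q3 : bool) : pauli := ((false, false, false), (q1, q2, q3), false).
Definition pauliJ : pauli := ((false, false, false), (false, false, false), true).

(** * Pauli solutions on complete bipartite graphs *)

Section CompleteBipartite.

Variables (m n : nat) (gT : groupType) (y : 'I_m -> 'I_n -> gT) (J : gT).
Variables (r : 'I_m -> 'Z_2) (c : 'I_n -> 'Z_2).

Definition Kmn_colouring : colouring (Kmn m n) :=
  fun v => match v with inl i => r i | inr j => c j end.

Lemma Kmn_solution :
  J * J = 1 -> (forall i j, y i j * y i j = 1) -> (forall i j, commute (y i j) J) ->
  (forall i j j', commute (y i j) (y i j')) -> (forall i i' j, commute (y i j) (y i' j)) ->
  (forall i, \prod_(j < n) y i j = J ^+ r i) -> (forall j, \prod_(i < m) y i j = J ^+ c j) ->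
  solution Kmn_colouring (fun e : edge (Kmn m n) => y e.1 e.2) J.
Proof.
move=> JJ yy yJ rowC colC rowP colP.
have incl i (e : 'I_m * 'I_n) : (e \in incident (inl i : vertex (Kmn m n))) = (e.1 == i).
  by rewrite !inE /= orbF eq_sym.
have incr j (e : 'I_m * 'I_n) : (e \in incident (inr j : vertex (Kmn m n))) = (e.2 == j).
  by rewrite !inE /= eq_sym.
have cv v : commuting (fun e : edge (Kmn m n) => y e.1 e.2) (incident v).
  case: v => [i|j] -[i1 j1] [i2 j2]; rewrite ?incl ?incr /= => /eqP-> /eqP->;
    by [apply: rowC | apply: colC].
split=> //; case=> [i|j].
- rewrite -rowP (eq_bigl (mem [set: 'I_n])) => [|j]; last by rewrite /= !inE.
  apply: (prodg_reindex (h := fun j => (i, j))) => //.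
  + by move=> j j' _ _ [].
  + apply/setP => -[i1 j1]; rewrite incl /=; apply/imsetP/eqP => [[j _ []//]|->].
    by exists j1; rewrite ?inE.
- rewrite -colP (eq_bigl (mem [set: 'I_m])) => [|i]; last by rewrite /= !inE.
  apply: (prodg_reindex (h := fun i => (i, j))) => //.
  + by move=> i i' _ _ [].
  + apply/setP => -[i1 j1]; rewrite incr /=; apply/imsetP/eqP => [[i _ []//]|->].
    by exists i1; rewrite ?inE.
Qed.

End CompleteBipartite.

Lemma Kmn_adjacent m n (i : 'I_m) (j : 'I_n) :
  @adjacent (Kmn m n) (inl i) (inr j) && @adjacent (Kmn m n) (inr j) (inl i).
Proof.
apply/andP; split; apply/existsP; exists ((i, j) : edge (Kmn m n));
  by rewrite /= /Kmn_ends // setUC.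
Qed.

Lemma Kmn_connected m n : connected_graph (Kmn m.+1 n.+1).
Proof.
have lr i j : connect (@adjacent (Kmn m.+1 n.+1)) (inl i) (inr j).
  by apply: connect1; case/andP: (Kmn_adjacent i j).
have rl i j : connect (@adjacent (Kmn m.+1 n.+1)) (inr j) (inl i).
  by apply: connect1; case/andP: (Kmn_adjacent i j).
move=> [i|j] [i'|j'] //.
- exact: connect_trans (lr i ord0) (rl i' ord0).
- exact: connect_trans (rl ord0 j) (lr ord0 j').
Qed.

Lemma Kmn_parity m n (r : 'I_m -> 'Z_2) (c : 'I_n -> 'Z_2) :
  parity (Kmn_colouring r c) = (\sum_i r i + \sum_j c j)%R.
Proof. by rewrite /parity big_sumType. Qed.

Definition table_entry m n (t : seq (seq pauli)) (i : 'I_m) (j : 'I_n) : pauli :=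
  nth 1 (nth [::] t i) j.

Ltac case_ords := repeat (let i := fresh in let h := fresh in
  case=> i h; do ?[case: i h => [|i] h //]).

(* The Mermin-Peres magic square. *)
Definition square_table : seq (seq pauli) :=
  let X := pauliX in let Z := pauliZ in
  [:: [:: X true false false; X false true false; X true true false];
      [:: Z false true false; Z true false false; Z true true false];
      [:: X true false false * Z false true false;
          Z true false false * X false true false;
          X true true false * Z true true false]].

Lemma K33_noncommutative (b : colouring (Kmn 3 3)) :
  parity b = 1%R -> ~ commutative_solutions b.
Proof.
move=> par cb.
(* Of the six row and column products only that of the third row is -1. *)
pose r (i : 'I_3) : 'Z_2 := ((i == 2 :> nat)%:R)%R; pose c (j : 'I_3) : 'Z_2 := 0%R.
have sol : solution (Kmn_colouring r c)
    (fun e => table_entry square_table e.1 e.2) pauliJ.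
  apply: Kmn_solution => //.
  - by case_ords.
  - by case_ords.
  - by case_ords.
  - by case_ords.
  - by case_ords; rewrite !big_ord_recl big_ord0.
  - by case_ords; rewrite !big_ord_recl big_ord0.
have parE : parity b = parity (Kmn_colouring r c).
  by rewrite par Kmn_parity !big_ord_recl !big_ord0; apply: val_inj.
have := parity_commutative (@Kmn_connected 2 2) parE cb sol.
by move=> /(_ (@Ordinal 3 0 isT, @Ordinal 3 0 isT) (@Ordinal 3 1 isT, @Ordinal 3 1 isT)).
Qed.

(** Every row contains two values twice each, and every column two operators on different qubits
    with their product, so all products are 1. In the third row [z2 * x1] and [z1 * x2] commute
    because two anticommutations cancel, whereas the entries [z2] and [x2] of different rows and
    columns anticommute. *)
Definition rectangle_table : seq (seq pauli) :=
  let X := pauliX in let Z := pauliZ in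
  let x1 := X true false false in let x2 := X false true false in
  let z1 := Z true false false in let z2 := Z false true false in
  [:: [:: z2; z1; z1; z2]; [:: x1; x2; x2; x1];
      [:: z2 * x1; z1 * x2; z1 * x2; z2 * x1]].

Lemma K34_noncommutative (b : colouring (Kmn 3 4)) :
  parity b = 0%R -> ~ commutative_solutions b.
Proof.
move=> par cb.
pose r (i : 'I_3) : 'Z_2 := 0%R; pose c (j : 'I_4) : 'Z_2 := 0%R.
have sol : solution (Kmn_colouring r c)
    (fun e => table_entry rectangle_table e.1 e.2) pauliJ.
  apply: Kmn_solution => //.
  - by case_ords.
  - by case_ords.
  - by case_ords.
  - by case_ords.
  - by case_ords; rewrite !big_ord_recl big_ord0.
  - by case_ords; rewrite !big_ord_recl big_ord0.
have parE : parity b = parity (Kmn_colouring r c).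
  by rewrite par Kmn_parity !big_ord_recl !big_ord0; apply: val_inj.
have := parity_commutative (@Kmn_connected 2 3) parE cb sol.
by move=> /(_ (@Ordinal 3 0 isT, @Ordinal 4 0 isT) (@Ordinal 3 1 isT, @Ordinal 4 1 isT)).
Qed.

(** The graph is disconnected, so its colouring cannot be normalised by toggling. Instead [J] is
    taken to be 1, and the relation at a vertex reads the same for both colours: two parallel edges
    of equal value multiply to 1. *)
Lemma C2C2_noncommutative (b : colouring (disj_union C2 C2)) :
  ~ commutative_solutions b.
Proof.
move=> cb; pose x1 := pauliX true false false; pose z1 := pauliZ true false false.
pose x (e : edge (disj_union C2 C2)) := match e with inl _ => x1 | inr _ => z1 end.
suff /cb /(_ (inl true) (inr true)) : solution b x 1 by [].
have cv v : commuting x (incident v).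
  case: v => [i|j] -[e|e] [f|f]; rewrite !inE /=; case/imsetP => // u _ -[] //;
  by move=> _ /imsetP[].
split=> // [[]|e|v] //; first exact: commute1.
rewrite expg1n.
case: v => v; [rewrite (@prodg_seq _ _ _ _ [:: inl true; inl false]) //
              |rewrite (@prodg_seq _ _ _ _ [:: inr true; inr false]) //].
- by rewrite big_cons big_seq1.
- move=> [e|e]; rewrite !inE /=.
    by rewrite mem_imset ?inE; [case: e | move=> ? ? []].
  by apply/esym/imsetP => -[].
- by rewrite big_cons big_seq1.
- move=> [e|e]; rewrite !inE /=; first by apply/esym/imsetP => -[].
  by rewrite mem_imset ?inE; [case: e | move=> ? ? []].
Qed.

(** * Pauli solutions on complete graphs *)

Section CompleteGraph.

Variables (n : nat) (gT : groupType) (y : 'I_n -> 'I_n -> gT) (J : gT).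
Variables (x : edge (Kn n) -> gT) (b : 'I_n -> 'Z_2).
Hypothesis xE : forall (e : edge (Kn n)) i j, i != j -> ends e = [set i; j] -> x e = y i j.

Lemma Kn_incidentP i (e : edge (Kn n)) :
  reflect (exists2 j, i != j & ends e = [set i; j]) (e \in incident i).
Proof.
rewrite inE; apply: (iffP idP) => [ie|[j _ ->]]; last by rewrite !inE eqxx.
have [u [v [uv E]]] := ends2 e.
move: ie; rewrite E !inE => /orP[]/eqP->; first by exists v.
by exists u; rewrite 1?eq_sym // setUC.
Qed.

Lemma Kn_edge_exists i j : i != j -> exists e : edge (Kn n), ends e = [set i; j].
Proof.
move=> ij; have c2 : #|[set i; j]| == 2 by rewrite cards2 ij.
by exists (Sub [set i; j] c2 : Kn_edge n).
Qed.

(** Edges of [Kn] are two-element sets; giving their values through ordered pairs turns all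
    conditions into finite computations on ordinals. *)
Lemma Kn_solution :
  J * J = 1 -> (forall i j, i != j -> y i j * y i j = 1) ->
  (forall i j, i != j -> commute (y i j) J) ->
  (forall i j k, i != j -> i != k -> commute (y i j) (y i k)) ->
  (forall i, \prod_(j < n | i != j) y i j = J ^+ b i) ->
  solution (b : colouring (Kn n)) x J.
Proof.
move=> JJ yy yJ yc yP.
have cv (i : vertex (Kn n)) : commuting x (incident i).
  move=> e f /Kn_incidentP[j ij eE] /Kn_incidentP[k ik fE].
  by rewrite (xE ij eE) (xE ik fE); apply: yc.
split=> // [e|e|i].
- by have [u [v [uv E]]] := ends2 e; rewrite (xE uv E) yy.
- by have [u [v [uv E]]] := ends2 e; rewrite (xE uv E); apply: yJ.
(* [h] sends an edge at [i] to its other end; on such edges the default [i] is not reached. *)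
pose h (e : edge (Kn n)) : 'I_n := odflt i [pick j | (j != i) && (j \in ends e)].
have hE e j : i != j -> ends e = [set i; j] -> h e = j.
  move=> ij E; rewrite /h; case: pickP => [k|/(_ j)]; rewrite E !inE.
    by case/andP=> /negbTE-> /eqP.
  by rewrite eq_sym ij eqxx orbT.
rewrite -yP (eq_bigl (mem (~: [set i]))) => [|j]; last by rewrite /= !inE eq_sym.
apply/esym/(prodg_reindex (h := h)).
- by move=> j k; rewrite !inE ![_ == i]eq_sym; apply: yc.
- move=> e f /Kn_incidentP[j ij eE] /Kn_incidentP[k ik fE].
  rewrite (hE _ _ ij eE) (hE _ _ ik fE) => jk; apply: val_inj.
  by rewrite [LHS]eE [RHS]fE jk.
- apply/setP => j; rewrite !inE; apply/imsetP/idP => [[e /Kn_incidentP[k ik E] ->]|ji].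
    by rewrite (hE _ _ ik E) eq_sym.
  have ij : i != j by rewrite eq_sym.
  have [e E] := Kn_edge_exists ij; exists e; last by rewrite (hE _ _ ij E).
  by apply/Kn_incidentP; exists j.
- by move=> e /Kn_incidentP[j ij E]; rewrite (hE _ _ ij E) (xE ij E).
Qed.

Lemma Kn_connected : connected_graph (Kn n).
Proof.
move=> i j; case: (eqVneq i j) => [->|/Kn_edge_exists[e E]]; first exact: connect0.
by apply: connect1; apply/existsP; exists e; rewrite E.
Qed.

End CompleteGraph.

(* The magic pentagram: the factor X or Z on a given qubit occurs on the edges of a
   triangle of K5. *)
Definition pentagram_operator (inside : seq nat -> bool) : pauli :=
  ((inside [:: 0; 1; 2]%N, inside [:: 0; 1; 3]%N, inside [:: 0; 1; 4]%N),
   (inside [:: 0; 3; 4]%N, inside [:: 0; 2; 4]%N, inside [:: 0; 2; 3]%N), false).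

Lemma K5_noncommutative (b : colouring (Kn 5)) :
  parity b = 1%R -> ~ commutative_solutions b.
Proof.
move=> par cb.
pose y (i j : 'I_5) := pentagram_operator
  (fun s => ((i : nat) \in s) && ((j : nat) \in s)).
pose x (e : edge (Kn 5)) := pentagram_operator
  (fun s => [forall k in ends e, (k : nat) \in s]).
have xE (e : edge (Kn 5)) i j : i != j -> ends e = [set i; j] -> x e = y i j.
  move=> ij E.
  have H (s : seq nat) : [forall k in ends e, (k : nat) \in s] =
      ((i : nat) \in s) && ((j : nat) \in s).
    rewrite E; apply/forall_inP/andP => [H|[is_ js] k].
      by split; apply: H; rewrite !inE eqxx ?orbT.
    by rewrite !inE => /orP[]/eqP->.
  by rewrite /x /y /pentagram_operator !H.
(* The four operators at vertex 0 multiply to -1, those at any other vertex to 1. *)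
pose b0 (i : 'I_5) : 'Z_2 := ((i == 0 :> nat)%:R)%R.
have sol : solution (b0 : colouring (Kn 5)) x pauliJ.
  apply: (Kn_solution xE) => //.
  - by case_ords.
  - by case_ords.
  - by case_ords.
  - by case_ords; rewrite big_mkcond !big_ord_recl big_ord0.
have parE : parity b = parity (b0 : colouring (Kn 5)).
  by rewrite par /parity !big_ord_recl big_ord0; apply: val_inj.
have c := parity_commutative (@Kn_connected 5) parE cb sol.
have [e eE] := @Kn_edge_exists 5 (@Ordinal 5 0 isT) (@Ordinal 5 1 isT) isT.
have [f fE] := @Kn_edge_exists 5 (@Ordinal 5 2 isT) (@Ordinal 5 3 isT) isT.
by have := c e f; rewrite (xE _ _ _ _ eE) // (xE _ _ _ _ fE).
Qed.

(** * Commuting solutions *)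

Section SolutionCommutation.

Variables (G : mgraph) (b : colouring G) (gT : groupType) (x : edge G -> gT) (J : gT).
Hypothesis sol : solution b x J.

Implicit Types D E : {set edge G}.

Notation mult := (@multiplicity G).

Lemma edge_value u e : e \in incident u ->
  x e = J ^+ b u * \prod_(f in incident u :\ e) x f.
Proof.
move=> eu; rewrite -(sol_vertex sol) (prodgD1 (sol_comm sol (v := u)) eu) -mulgA.
rewrite prodg_involution ?mulg1 // => [|f _]; last exact: sol_xx sol _.
by apply: commuting_sub (sol_comm sol (v := u)); apply: subsetDl.
Qed.

Lemma vertex_commute u e z : e \in incident u -> commute z J ->
  (forall f, f \in incident u -> f != e -> commute z (x f)) -> commute z (x e).
Proof.
move=> eu zJ zf; rewrite (edge_value eu); apply: commuteM; first exact: commuteX.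
by apply: prodg_commute => f; rewrite !inE => /andP[fe fu]; apply: zf; rewrite ?inE.
Qed.

(* Double centralizers replace generated subgroups: they are closed under products,
   and commutative as soon as the generators commute. *)
Definition spanned D (z : gT) :=
  forall y, (forall f, f \in D -> commute y (x f)) -> commute y J -> commute y z.

Lemma spanned_gen D e : e \in D -> spanned D (x e).
Proof. by move=> eD y yD _; apply: yD. Qed.

Lemma spannedM D z z' : spanned D z -> spanned D z' -> spanned D (z * z').
Proof. by move=> sz sz' y yD yJ; apply: commuteM; [apply: sz | apply: sz']. Qed.

Lemma spanned_sub D D' z : D \subset D' -> spanned D z -> spanned D' z.
Proof. by move=> /subsetP sD sz y yD; apply: sz => f /sD; apply: yD. Qed.

Lemma spanned_prod D E :
  (forall f, f \in E -> spanned D (x f)) -> spanned D (\prod_(f in E) x f).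
Proof. by move=> sE y yD yJ; apply: prodg_commute => f fE; apply: sE. Qed.

Lemma spanned_commute D z z' : commuting x D -> spanned D z -> spanned D z' ->
  commute z z'.
Proof.
move=> cD sz sz'; apply: sz'; last first.
  by apply/commute_sym/sz; [move=> f _; apply/commute_sym/(sol_xJ sol) | apply: commute_refl].
move=> f fD; apply/commute_sym/sz; last exact: (sol_xJ sol).
by move=> g gD; apply: cD.
Qed.

Lemma spanned_vertex D u e : e \in incident u ->
  (forall f, f \in incident u -> f != e -> spanned D (x f)) -> spanned D (x e).
Proof. by move=> eu sf y yD yJ; apply: (vertex_commute eu yJ) => f fu fe; apply: sf. Qed.

Lemma spanned_commutative D : commuting x D -> (forall e, spanned D (x e)) ->
  forall e f, commute (x e) (x f).
Proof. by move=> cD sD e f; apply: (spanned_commute cD). Qed.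

(** The edges at the deleted vertex span all others. The ends of the unspanned edges form a subset
    of the forest, so some end u has only one edge within this subset; that edge is the only
    unspanned one at u, and the relation at u spans it after all. *)
Lemma almost_forest_commutative : almost_forest mult ->
  forall e f, commute (x e) (x f).
Proof.
case=> v acv; apply: (spanned_commutative (sol_comm sol (v := v))) => e0.
pose bad := [set e | ~~ `[< spanned (incident v) (x e) >]].
apply: contrapT => ns0.
pose X := [set u | [exists e in bad, u \in ends e]].
have badv e : e \in bad -> v \notin ends e.
  by rewrite inE; apply: contra => ve; apply/asboolP/spanned_gen; rewrite inE.
have inX e u : e \in bad -> u \in ends e -> u \in X.
  by move=> eb ue; rewrite inE; apply/existsP; exists e; rewrite eb.
have sX : X \subset ~: [set v].
  apply/subsetP => u; rewrite !inE => /exists_inP[e eb ue].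
  by apply: contraTneq ue => ->; apply: badv.
have X0 : X != set0.
  have [u [w [_ E]]] := ends2 e0; apply/set0Pn; exists u; apply: (inX e0).
    by rewrite inE; apply/negP => /asboolP.
  by rewrite E !inE eqxx.
have [u uX du] := acyclic_leaf (multiplicity_sym (G := G)) (multiplicity_irr (G := G))
  (acyclic_sub sX acv) X0.
move: (uX); rewrite inE => /exists_inP[e eb ue].
have eu : e \in incident u by rewrite inE.
move: (eb); rewrite inE => /negP[]; apply/asboolP.
apply: (spanned_vertex eu) => f fu fe; apply: contrapT => nf.
have fb : f \in bad by rewrite inE; apply/negP => /asboolP.
move: du; rewrite edges_to_card leqNgt => /negP[].
apply: leq_trans (_ : #|[set e; f]| <= _); first by rewrite cards2 eq_sym fe.
apply: subset_leq_card; rewrite subUset !sub1set !inE ue.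
rewrite inE in fu; rewrite fu /=; apply/andP; split; apply/subsetP => z; rewrite inE => /andP[_].
  exact: inX.
exact: inX.
Qed.

(** At a rim vertex the relation puts the product of the two rim edges into the span K of the
    spokes. Going round the rim, every rim edge equals a fixed one, r0, up to a factor in K. Hence
    r0 commutes with each spoke: it may be replaced by a rim edge that meets the spoke, since K
    commutes with the spokes. *)
Lemma wheel_commutative : no_disjoint_cycles mult -> simple_wheel mult ->
  forall e f, commute (x e) (x f).
Proof.
move=> ndc [w deg2].
case: (boolP [exists r, r \notin incident w]) => [/existsP[r0 r0w]|/existsPn all]; last first.
  apply: (spanned_commutative (sol_comm sol (v := w))) => e; apply: spanned_gen.
  by have := all e; rewrite negbK.
pose K := spanned (incident w).
pose D := [set r | (r \notin incident w) && `[< K (x r0 * x r) >]].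
pose X := [set h | [exists r in D, h \in ends r]].
have memD r : r \in D <-> r \notin incident w /\ K (x r0 * x r).
  rewrite inE; split=> [/andP[rw /asboolP]|[-> kr]] //.
  exact/asboolP.
have Xw h : h \in X -> h != w.
  rewrite inE => /exists_inP[r /memD[rw _] hr]; apply: contraNneq rw => <-.
  by rewrite inE.
have KJ n : K (J ^+ n) by move=> y _ yJ; apply: commuteX.
have other h r : h != w -> r \in incident h -> r \notin incident w ->
    exists2 r', r' != r & incident h :&: ~: incident w = [set r; r'].
  move=> hw rh rw.
  have c2 : #|incident h :&: ~: incident w| == 2.
    apply/eqP; rewrite -(deg2 h hw) edges_to_card; apply: eq_card => f.
    rewrite !inE; case: (boolP (h \in ends f)) => //= hf.
    rewrite -disjoints_subset disjoint_sym disjoints1 !inE.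
    by rewrite eq_sym (negbTE hw).
  have rI : r \in incident h :&: ~: incident w by rewrite inE rh inE rw.
  case/cards2P: c2 => p [q [pq E]].
  move: rI; rewrite E !inE => /orP[]/eqP->; first by exists q; rewrite 1?eq_sym.
  by exists p; rewrite // setUC.
have closed h r r' : h \in X -> r \in D -> r \in incident h ->
    r' \in incident h -> r' \notin incident w -> r' \in D.
  move=> hX rD rh r'h r'w; have [rw Kr] := (memD r).1 rD.
  have [->//|r'r] := eqVneq r' r.
  have [r'' r''r E] := other h r (Xw h hX) rh rw.
  have r'E : r' = r''.
    have : r' \in incident h :&: ~: incident w by rewrite inE r'h inE r'w.
    by rewrite E !inE (negbTE r'r) => /eqP.
  apply/memD; split=> //.
  have -> : x r0 * x r' = (x r0 * x r) * (x r * x r').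
    by rewrite -mulgA (mulgA (x r)) (sol_xx sol) mul1g.
  apply: spannedM => //.
  have r'D : r' \in incident h :\ r by rewrite !inE r'r; rewrite inE in r'h.
  have cD : commuting x (incident h :\ r).
    by apply: commuting_sub (sol_comm sol (v := h)); apply: subsetDl.
  have cP : commute (x r') (\prod_(f in incident h :\ r :\ r') x f).
    apply: prodg_commute => f; rewrite !inE => /and3P[_ _ fh].
    by apply: (sol_comm sol r'h); rewrite inE.
  rewrite (edge_value rh) (prodgD1 cD r'D) -mulgA -mulgA -cP (mulgA (x r')) (sol_xx sol) mul1g.
  apply: spannedM; first exact: KJ.
  apply: spanned_prod => f; rewrite !inE => /and3P[fr' fr fh].
  apply: spanned_gen; apply: contraT => fw.
  have : f \in incident h :&: ~: incident w by rewrite inE inE fh inE.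
  by rewrite E !inE (negbTE fr) -r'E (negbTE fr').
have inX r h : r \in D -> h \in ends r -> h \in X.
  by move=> rD hr; rewrite inE; apply/existsP; exists r; rewrite rD.
have r0D : r0 \in D by apply/memD; split=> //; rewrite (sol_xx sol); exact: (KJ 0%N).
(* The vertices reached by [D] and the remaining rim vertices both form 2-regular sets with no edge
   between them. If a rim edge were outside [D], both would be nonempty, hence disjoint cyclic
   sets. *)
have allD r : r \notin incident w -> r \in D.
  move=> rw; apply: contraT => rD.
  pose Y := ~: [set w] :\: X.
  have noXY h h' : h \in X -> h' \in Y -> mult h h' = 0%N.
    move=> hX h'Y; apply: eq_card0 => f; rewrite !inE; apply/negP => /eqP fE.
    move: (hX); rewrite inE => /exists_inP[r1 r1D hr1].
    move: h'Y; rewrite !inE => /andP[/negP h'X h'w]; apply: h'X.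
    have fD : f \in D.
      apply: (closed h r1) => //; rewrite ?inE // fE !inE ?eqxx //.
      by rewrite negb_or [w == h]eq_sym Xw // [w == _]eq_sym.
    by have := inX f h' fD; rewrite fE !inE eqxx orbT => /(_ isT).
  have XYE : ~: [set w] = X :|: Y.
    apply/esym/setD_subK; apply/subsetP => h /Xw; by rewrite !inE.
  have dXY : [disjoint X & Y] by apply: disjoint_setD.
  have dX h : h \in X -> edges_to mult h X = 2.
    move=> hX; rewrite -(deg2 h (Xw h hX)) XYE edges_toU //.
    by rewrite [X in (_ + X)%N]big1 ?addn0 // => h' h'Y; apply: noXY.
  have dY h : h \in Y -> edges_to mult h Y = 2.
    move=> hY; have hw : h != w by move: hY; rewrite !inE => /andP[].
    rewrite -(deg2 h hw) XYE edges_toU //.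
    by rewrite [X in (X + _)%N]big1 ?add0n // => h' h'X; rewrite multiplicity_sym; apply: noXY.
  have cyc (Z : {set vertex G}) : Z != set0 -> (forall h, h \in Z -> edges_to mult h Z = 2) ->
      cyclic_set mult Z.
    move=> Z0 dZ; rewrite /cyclic_set card_gt0 Z0 /=.
    have := edges_in_sum (multiplicity_sym (G := G)) (multiplicity_irr (G := G)) Z.
    rewrite (eq_bigr (fun=> 2)) // sum_nat_const muln2 => /double_inj<-; exact: leqnn.
  have := ndc X Y; rewrite dXY; apply.
  - have [u [v [_ E]]] := ends2 r0.
    by apply: cyc => //; apply/set0Pn; exists u; apply: (inX r0); rewrite // E !inE eqxx.
  - have [u [v [uv E]]] := ends2 r; apply: cyc => //; apply/set0Pn; exists u.
    have ur : r \in incident u by rewrite inE E !inE eqxx.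
    rewrite !inE; apply/andP; split; last first.
      by apply: contraNneq rw => <-.
    apply: contra rD => /exists_inP[r1 r1D ur1].
    apply: (closed u r1) => //; first exact: (inX r1).
    by rewrite inE.
have r0K z : z \in incident w -> commute (x r0) (x z).
  move=> zw.
  have [h hw zE] : exists2 h, h != w & h \in ends z.
    have [p [q [pq E]]] := ends2 z; move: zw; rewrite inE E !inE => /orP[]/eqP->.
      by exists q; rewrite 1?eq_sym // !inE eqxx orbT.
    by exists p; rewrite // !inE eqxx.
  have /card_gt0P[r] : (0 < #|incident h :&: ~: incident w|)%N.
    rewrite (_ : #|_| = 2) // -(deg2 h hw) edges_to_card; apply: eq_card => f.
    rewrite !inE; case: (boolP (h \in ends f)) => //= hf.
    rewrite -disjoints_subset disjoint_sym disjoints1 !inE.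
    by rewrite eq_sym (negbTE hw).
  rewrite inE [r \in ~: _]inE => /andP[rh rw].
  have [_ Kr] := (memD r).1 (allD r rw).
  have -> : x r0 = (x r0 * x r) * x r by rewrite -mulgA (sol_xx sol) mulg1.
  have zh : z \in incident h by rewrite inE.
  apply: commute_sym; apply: commuteM; last exact: (sol_comm sol zh rh).
  apply: Kr; last exact: (sol_xJ sol).
  by move=> f fw; apply: (sol_comm sol (v := w)).
apply: (@spanned_commutative (r0 |: incident w)).
  move=> e f; rewrite !in_setU1 => /orP[/eqP->|ew] /orP[/eqP->|fw].
  - exact: commute_refl.
  - exact: r0K.
  - exact/commute_sym/r0K.
  - exact: (sol_comm sol (v := w)).
move=> e; case: (boolP (e \in incident w)) => ew.
  by apply: spanned_gen; rewrite in_setU1 ew orbT.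
have [_ Ke] := (memD e).1 (allD e ew).
have -> : x e = x r0 * (x r0 * x e) by rewrite mulgA (sol_xx sol) mul1g.
apply: spannedM; first by apply: spanned_gen; rewrite in_setU1 eqxx.
by apply: spanned_sub Ke; apply: subsetUr.
Qed.

End SolutionCommutation.

(** * The magic square and pentagram identities *)

Section GroupIdentities.

Variable gT : groupType.

(** Computing [x33] along its row and along its column gives two words which, once their leading
    factors agree, differ only in the order of [x12] and [x21]. The factors are not limited to
    powers of J, because in the application they also contain the edges inside the cover. *)
Lemma magic_square_commute (x11 x12 x13 x21 x22 x23 x31 x32 x33 : gT)
    (c1 c2 c3 d1 d2 d3 : gT) :
  x13 = c1 * (x11 * x12) -> x23 = c2 * (x21 * x22) -> x33 = c3 * (x31 * x32) ->
  x31 = d1 * (x11 * x21) -> x32 = d2 * (x12 * x22) -> x33 = d3 * (x13 * x23) ->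
  commute d2 (x11 * x21) -> commute c2 (x11 * x12) ->
  c3 * d1 * d2 = d3 * c1 * c2 -> commute x12 x21.
Proof.
move=> e13 e23 e33 e31 e32; rewrite e33 e31 e32 e13 e23 => E cd cc cE.
have L : c3 * (d1 * (x11 * x21) * (d2 * (x12 * x22))) =
         c3 * d1 * d2 * (x11 * x21 * (x12 * x22)).
  by rewrite (mulgA (_ * _) d2) -(mulgA d1) -cd !mulgA.
have R : d3 * (c1 * (x11 * x12) * (c2 * (x21 * x22))) =
         d3 * c1 * c2 * (x11 * x12 * (x21 * x22)).
  by rewrite (mulgA (_ * _) c2) -(mulgA c1) -cc !mulgA.
move: E; rewrite L R cE => /mulgI; rewrite -!mulgA => /mulgI; rewrite !mulgA => /mulIg.
by move/esym.
Qed.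

(** [y45] is computed at vertex 4 and, after substituting [y15], [y25] and [y35], at vertex 5. The
    condition on the [j]s is even parity. Cancelling [y12], [y34], [y23] and [y14] leaves y13 y24
    y13 = y24. *)
Lemma pentagram_commute (y12 y13 y14 y15 y23 y24 y25 y34 y35 y45 j1 j2 j3 j4 j5 : gT) :
  y15 = j1 * (y12 * y13 * y14) -> y25 = j2 * (y12 * y23 * y24) ->
  y35 = j3 * (y13 * y23 * y34) -> y45 = j4 * (y14 * y24 * y34) ->
  y45 = j5 * (y15 * y25 * y35) -> j4 = j5 * j1 * j2 * j3 ->
  commute j2 (y12 * y13 * y14) ->
  commute j3 (y12 * y13 * y14 * (y12 * y23 * y24)) ->
  y12 * y12 = 1 -> y13 * y13 = 1 -> y23 * y23 = 1 ->
  commute y12 y13 -> commute y12 y14 -> commute y13 y14 ->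
  commute y23 y24 -> commute y23 y13 -> commute y13 y24.
Proof.
move=> e15 e25 e35 e45; rewrite e45 e15 e25 e35 => E jE c2 c3 i12 i13 i23.
move=> c1213 c1214 c1314 c2324 c2313.
set A := y12 * y13 * y14 in E c2 c3; set B := y12 * y23 * y24 in E c3.
set C := y13 * y23 * y34 in E.
have ABC : A * B * C = y14 * y24 * y34.
  apply/esym/(mulgI j4); rewrite E jE.
  have -> : j1 * A * (j2 * B) * (j3 * C) = j1 * j2 * j3 * (A * B * C).
    rewrite (mulgA (j1 * A) j2 B) -(mulgA j1 A j2) -c2 (mulgA j1) -(mulgA _ A B).
    by rewrite (mulgA _ j3 C) -(mulgA _ (A * B) j3) -c3 !mulgA.
  by rewrite !mulgA.
rewrite /C in ABC.
have AB : A * B = y13 * y14 * (y23 * y24).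
  have c : commute y12 (y13 * y14) by apply: commuteM.
  by rewrite /A /B -(mulgA y12 y13) c -(mulgA y12 y23) (mulgA _ y12) -(mulgA _ y12 y12) i12 mulg1.
move: ABC; rewrite AB => /(congr1 (fun z => z * y34^-1)).
rewrite !mulgA !mulgK => ABC.
have : y14 * (y13 * y24 * y13) = y14 * y24.
  have c : commute y23 (y24 * y13) by apply: commuteM.
  have e : y23 * y24 * y13 * y23 = y24 * y13.
    by rewrite -(mulgA y23 y24) c -mulgA i23 mulg1.
  rewrite -ABC !mulgA -c1314.
  have -> : y13 * y14 * y23 * y24 * y13 * y23 = y13 * y14 * (y23 * y24 * y13 * y23).
    by rewrite !mulgA.
  by rewrite e mulgA.
move/mulgI/(congr1 (fun z => z * y13)); rewrite -mulgA i13 mulg1.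
by [].
Qed.

End GroupIdentities.

Lemma card3_third (T : finType) (S : {set T}) p q :
  #|S| = 3 -> p \in S -> q \in S -> p != q ->
  exists r, [/\ r != p, r != q & S = [set p; q; r]].
Proof.
move=> S3 pS qS pq.
have : #|S :\ p :\ q| = 1%N.
  by move: S3; rewrite (cardsD1 p) pS (cardsD1 q) !inE eq_sym pq qS /= => -[].
move/eqP/cards1P=> [r E]; exists r.
have : r \in S :\ p :\ q by rewrite E inE.
rewrite !inE => /and3P[rq rp rS]; split=> //.
apply/setP => z; rewrite !inE; have : (z \in S :\ p :\ q) = (z == r) by rewrite E inE.
rewrite !inE => <-; case: (eqVneq z p) => [->|] //=.
by case: (eqVneq z q) => [->|].
Qed.

Section MultiplicityFacts.

Variable G : mgraph.

Lemma multiplicity_ex (u v : vertex G) : 0 < multiplicity u v ->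
  exists e, ends e = [set u; v].
Proof. by case/card_gt0P=> e; rewrite inE => /eqP; exists e. Qed.

Lemma multiplicity1_eq (u v : vertex G) (e f : edge G) : multiplicity u v = 1%N ->
  ends e = [set u; v] -> ends f = [set u; v] -> e = f.
Proof.
move=> /eqP/cards1P[g E] eE fE.
have : e \in [set g] by rewrite -E inE eE.
have : f \in [set g] by rewrite -E inE fE.
by rewrite !inE => /eqP-> /eqP->.
Qed.

Lemma ends_other (u : vertex G) (e : edge G) : e \in incident u ->
  exists2 v, v != u & ends e = [set u; v].
Proof.
rewrite inE => ue; have [p [q [pq E]]] := ends2 e.
move: ue; rewrite E !inE => /orP[]/eqP->; first by exists q; rewrite 1?eq_sym.
by exists p; rewrite // setUC.
Qed.

Lemma ends_neq (u v : vertex G) (e : edge G) : ends e = [set u; v] -> u != v.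
Proof. by move=> E; have := card_ends e; rewrite E cards2; case: (u == v). Qed.

Lemma ends_inj2 (u v w : vertex G) (e f : edge G) :
  ends e = [set u; v] -> ends f = [set u; w] -> e = f -> v = w.
Proof.
move=> eE fE ef; have uv := ends_neq eE.
have : v \in [set u; w] by rewrite -fE -ef eE !inE eqxx orbT.
by rewrite !inE eq_sym (negbTE uv) => /eqP.
Qed.

End MultiplicityFacts.

Lemma sum_seq_all (V : finType) (F : V -> 'Z_2) (s : seq V) :
  uniq s -> (forall v, v \in s) -> (\sum_v F v = \sum_(v <- s) F v)%R.
Proof.
move=> us all; apply: perm_big; apply: uniq_perm => //; first exact: index_enum_uniq.
by move=> v; rewrite all mem_index_enum.
Qed.

(** * The complete graph on five vertices with even parity *)

Section SmallGraphs.

Variables (G : mgraph) (b : colouring G) (gT : groupType) (x : edge G -> gT) (J : gT).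
Hypothesis sol : solution b x J.

Notation mult := (@multiplicity G).

Let JJ := sol_JJ sol.
Let xJ := sol_xJ sol.

Lemma share_commute u e f : u \in ends e -> u \in ends f -> commute (x e) (x f).
Proof. by move=> ue uf; apply: (sol_comm sol (v := u)); rewrite inE. Qed.

(** The relation at [u] solved for one edge and written along a list of neighbours, as the group
    identities require. [Q] collects the unlisted edges at [u]: none in K5, the edges inside the
    cover in the three-covered case. *)
Lemma star_value u t (s : seq (vertex G)) (ed : vertex G -> edge G) (Q : {set edge G}) :
  uniq (t :: s) -> (forall v, v \in t :: s -> ends (ed v) = [set u; v]) ->
  Q \subset incident u -> (forall v, v \in t :: s -> ed v \notin Q) ->
  (forall f, f \in incident u -> f \notin Q -> exists2 v, v \in t :: s & f = ed v) ->
  x (ed t) = J ^+ b u * (\prod_(v <- s) x (ed v) * \prod_(f in Q) x f).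
Proof.
move=> us edE sQ edQ cov.
have edu v : v \in t :: s -> ed v \in incident u.
  by move=> /edE E; rewrite inE E !inE eqxx.
have edI : {in t :: s &, injective ed}.
  by move=> v w /edE vE /edE wE; apply: (ends_inj2 vE wE).
have ts : t \in t :: s by rewrite mem_head.
have inS v : v \in s -> v \in t :: s by rewrite inE orbC => ->.
rewrite (edge_value sol (edu t ts)); congr (_ * _).
rewrite (@prodg_seq _ _ _ _ (map ed s ++ enum Q)).
- by rewrite big_cat big_map prodg_enum.
- by apply: commuting_sub (sol_comm sol (v := u)); apply: subsetDl.
- rewrite cat_uniq enum_uniq andbT map_inj_in_uniq; last first.
    by move=> v w vs ws; apply: edI; apply: inS.
  move: us => /= /andP[_ ->] /=; apply/hasPn => f; rewrite mem_enum => fQ.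
  by apply/negP => /mapP[v vs E]; move: fQ; rewrite E (negbTE (edQ v (inS v vs))).
- move=> f; rewrite mem_cat mem_enum in_setD1; apply/orP/andP.
    case=> [/mapP[v vs ->]|fQ].
      split; last exact/edu/inS.
      apply/negP => /eqP/edI E; move: us => /= /andP[/negP[]].
      by rewrite -(E (inS v vs) ts).
    split; last exact: (subsetP sQ).
    by apply: contraTneq fQ => ->; apply: edQ.
  case=> ft fu; case: (boolP (f \in Q)) => fQ; [by right|left].
  have [v] := cov f fu fQ; rewrite inE => /orP[/eqP-> fE|vs ->].
    by rewrite fE eqxx in ft.
  exact: map_f.
Qed.

Lemma complete5_commutative : complete5 mult -> parity b = 0%R ->
  forall e f, commute (x e) (x f).
Proof.
case=> V5 m1 par e f.
case: (boolP [disjoint ends e & ends f]) => [dis|]; last first.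
  rewrite -setI_eq0 => /set0Pn[u]; rewrite inE => /andP[ue uf].
  exact: share_commute ue uf.
(* The ends are numbered so that [e] and [f] become the elements y13 and y24 of the pentagram
   identity. *)
have [v1 [v3 [n13 eE]]] := ends2 e; have [v2 [v4 [n24 fE]]] := ends2 f.
have n1 : v1 \notin ends f by rewrite (disjointFr dis) // eE !inE eqxx.
have n3 : v3 \notin ends f by rewrite (disjointFr dis) // eE !inE eqxx orbT.
move: n1 n3; rewrite fE !inE !negb_or => /andP[n12 n14] /andP[n32 n34].
have : #|~: [set v1; v2; v3; v4]| = 1%N.
  have -> : [set v1; v2; v3; v4] = [set:: [:: v1; v2; v3; v4]].
    by apply/setP => z; rewrite !inE -!orbA.
  have := cardsC [set:: [:: v1; v2; v3; v4]]; rewrite V5 cardsE.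
  have /card_uniqP -> : uniq [:: v1; v2; v3; v4].
    by rewrite /= !inE !negb_or n12 n13 n14 n24 n34 (eq_sym v2) n32.
  by move=> /= [].
move/eqP/cards1P=> [v5 v5E].
have : v5 \in ~: [set v1; v2; v3; v4] by rewrite v5E inE.
rewrite !inE !negb_or -!andbA => /and4P[n51 n52 n53 n54].
have all5 z : z \in [:: v1; v2; v3; v4; v5].
  have : (z \in ~: [set v1; v2; v3; v4]) = (z == v5) by rewrite v5E inE.
  rewrite !inE; case: (z == v5); first by rewrite !orbT.
  by move/negbFE; rewrite orbF -!orbA.
have uniq5 : uniq [:: v1; v2; v3; v4; v5].
  by rewrite /= !inE !negb_or n12 n13 n14 n24 n34 (eq_sym v2 v3) n32
    ![_ == v5]eq_sym n51 n52 n53 n54.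
(* Any two distinct vertices are joined, so the default [e] matters only for equal arguments. *)
pose ed u v : edge G := odflt e [pick g | ends g == [set u; v]].
have edE u v : u != v -> ends (ed u v) = [set u; v].
  move=> uv; have [g gE] : exists g, ends g = [set u; v].
    by apply: multiplicity_ex; rewrite m1.
  by rewrite /ed; case: pickP => [h /eqP //|/(_ g)]; rewrite gE eqxx.
have edC u v : ed u v = ed v u by rewrite /ed setUC.
have edU u v g : ends g = [set u; v] -> g = ed u v.
  by move=> gE; have uv := ends_neq gE; apply: multiplicity1_eq (m1 _ _ uv) gE (edE _ _ uv).
have val u t s : perm_eq [:: u, t & s] [:: v1; v2; v3; v4; v5] ->
    x (ed u t) = J ^+ b u * \prod_(v <- s) x (ed u v).
  move=> pe; have upe : uniq [:: u, t & s] by rewrite (perm_uniq pe).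
  rewrite (@star_value u t s (ed u) set0).
  - by rewrite big_set0 mulg1.
  - by case/andP: upe.
  - move=> v vs; apply: edE; case/andP: upe => + _.
    by apply: contraNneq => ->.
  - exact: sub0set.
  - by move=> v _; rewrite inE.
  - move=> g gu _; have [v vu gE] := ends_other gu; exists v; last exact: edU.
    have : v \in [:: u, t & s] by rewrite (perm_mem pe).
    by rewrite inE (negbTE vu).
have eed : e = ed v1 v3 by apply: edU.
have fed : f = ed v2 v4 by apply: edU.
rewrite eed fed.
pose y u v := x (ed u v).
have yC u v : y u v = y v u by rewrite /y edC.
have yc u v w : u != v -> u != w -> commute (y u v) (y u w).
  by move=> uv uw; apply: (share_commute (u := u)); rewrite edE // !inE eqxx.
have pe s : size s = 5 -> [&& v1 \in s, v2 \in s, v3 \in s, v4 \in s & v5 \in s] ->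
    perm_eq s [:: v1; v2; v3; v4; v5].
  move=> ss /and5P[i1 i2 i3 i4 i5]; rewrite perm_sym; apply: uniq_perm => //.
    apply: leq_size_uniq uniq5 _ _; last by rewrite ss.
    by move=> z; rewrite !inE => /or4P[|||/orP[]]/eqP->.
  have sub : {subset [:: v1; v2; v3; v4; v5] <= s}.
    by move=> z; rewrite !inE => /or4P[|||/orP[]]/eqP->.
  by move=> z; rewrite all5 sub.
have JX u z w : commute (J ^+ b u) (y z w) by apply/commute_sym/commuteX/xJ.
have val3 u t p q r : perm_eq [:: u; t; p; q; r] [:: v1; v2; v3; v4; v5] ->
    y u t = J ^+ b u * (y u p * y u q * y u r).
  by move=> /val; rewrite !big_cons big_nil mulg1 !mulgA.
apply: (@pentagram_commute _ (y v1 v2) (y v1 v3) (y v1 v4) (y v1 v5) (y v2 v3)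
  (y v2 v4) (y v2 v5) (y v3 v4) (y v3 v5) (y v4 v5)
  (J ^+ b v1) (J ^+ b v2) (J ^+ b v3) (J ^+ b v4) (J ^+ b v5)).
- by apply: val3; apply: pe => //; rewrite !inE !eqxx ?orbT.
- by rewrite (yC v1 v2); apply: val3; apply: pe => //; rewrite !inE !eqxx ?orbT.
- rewrite (yC v1 v3) (yC v2 v3); apply: val3; apply: pe => //.
  by rewrite !inE !eqxx ?orbT.
- rewrite (yC v1 v4) (yC v2 v4) (yC v3 v4); apply: val3; apply: pe => //.
  by rewrite !inE !eqxx ?orbT.
- rewrite (yC v4) (yC v1) (yC v2) (yC v3); apply: val3; apply: pe => //.
  by rewrite !inE !eqxx ?orbT.
- rewrite -!expg_Z2D //; congr (J ^+ _).
  move: par; rewrite /parity (sum_seq_all _ uniq5 all5) !big_cons big_nil addr0.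
  move: (b v1) (b v2) (b v3) (b v4) (b v5) => a1 a2 a3 a4 a5.
  by case: (Z2_cases a1) => ->; case: (Z2_cases a2) => ->; case: (Z2_cases a3) => ->;
     case: (Z2_cases a4) => ->; case: (Z2_cases a5) => ->.
- by do ?apply: commuteM.
- by do ?apply: commuteM.
- exact: sol_xx sol _.
- exact: sol_xx sol _.
- exact: sol_xx sol _.
- exact: yc.
- exact: yc.
- exact: yc.
- by apply: yc; rewrite // eq_sym.
- by rewrite (yC v1) (yC v2); apply: yc; rewrite // eq_sym.
Qed.

End SmallGraphs.

(** * Graphs covered by three vertices *)

Section ThreeCovered.

Variables (G : mgraph) (A : {set vertex G}).
Hypotheses (A3 : #|A| = 3).
Hypothesis mA : forall q a, q \notin A -> a \in A -> multiplicity q a = 1%N.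
Hypothesis mB : forall q q', q \notin A -> q' \notin A -> multiplicity q q' = 0%N.

Lemma covered_edge (e : edge G) :
  ends e \subset A \/ exists a q, [/\ a \in A, q \notin A & ends e = [set a; q]].
Proof.
have [u [v [uv E]]] := ends2 e.
case: (boolP (u \in A)) => uA; case: (boolP (v \in A)) => vA.
- by left; rewrite E subUset !sub1set uA.
- by right; exists u, v.
- by right; exists v, u; rewrite setUC.
- have := mB uA vA => /eqP; rewrite cards_eq0 => /eqP E0.
  by have := in_set0 e; rewrite -E0 inE E eqxx.
Qed.

Variables (b : colouring G) (gT : groupType) (x : edge G -> gT) (J : gT).
Hypothesis sol : solution b x J.

Let JJ := sol_JJ sol.
Let xJ := sol_xJ sol.

(** Two edges inside the three-element set [A] share a vertex. If f = aq leaves [A] at the vertex a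
    missed by [e], the relation at q expresses it by edges that end at the two ends of [e]. *)
Lemma covered_central e f : ends e \subset A -> commute (x e) (x f).
Proof.
move=> eA; have e2 := eqP (card_ends e).
case: (covered_edge f) => [fA|[a [q [aA qA fE]]]].
  have /set0Pn[u] : ends e :&: ends f != set0.
    apply/negP => /eqP I0; have := cardsUI (ends e) (ends f).
    rewrite I0 cards0 e2 (eqP (card_ends f)) addn0 => U4.
    have : #|ends e :|: ends f| <= 3 by rewrite -A3 subset_leq_card // subUset eA.
    by rewrite U4.
  by rewrite inE => /andP[ue uf]; apply: (share_commute sol ue uf).
case: (boolP (a \in ends e)) => ae.
  by apply: (share_commute sol ae); rewrite fE !inE eqxx.
have eE : ends e = A :\ a.
  apply/eqP; rewrite eqEcard subsetD1 eA ae e2.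
  by have := A3; rewrite (cardsD1 a) aA add1n => -[->].
have fq : f \in incident q by rewrite inE fE !inE eqxx orbT.
apply: (vertex_commute sol fq); first exact: xJ.
move=> g gq gf; have [a' a'q gE] := ends_other gq.
have [gA|[p [r [pA rA gE']]]] := covered_edge g.
  by move: qA; rewrite (subsetP gA) // gE !inE eqxx.
have rq : r = q.
  have : q \in [set p; r] by rewrite -gE' gE !inE eqxx.
  by rewrite !inE => /orP[/eqP qp|/eqP//]; rewrite qp pA in qA.
rewrite {}rq in gE' rA.
apply: (share_commute sol (u := p)); rewrite ?gE' ?inE ?eqxx //.
rewrite eE !inE pA andbT; apply: contraNneq gf => pa; apply/eqP.
by apply: (multiplicity1_eq (mA qA aA)); rewrite ?gE' ?fE ?pa setUC.
Qed.

(** For e = aq and f = a'q' with q and q' distinct, the relation at a expresses [e] by edges inside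
    [A], which are central, and by an edge to q', the only other outside vertex, which meets [f]. *)
Lemma few_covered_commutative : #|~: A| <= 2 -> forall e f, commute (x e) (x f).
Proof.
move=> B2 e f.
have [eA|[a [q [aA qA eE]]]] := covered_edge e; first exact: covered_central.
have [fA|[a' [q' [a'A q'A fE]]]] := covered_edge f.
  exact/commute_sym/covered_central.
have [qq'|nq] := eqVneq q q'.
  by apply: (share_commute sol (u := q)); rewrite ?eE ?fE ?qq' !inE eqxx orbT.
have ea : e \in incident a by rewrite inE eE !inE eqxx.
apply/commute_sym/(vertex_commute sol ea); first exact: xJ.
move=> g ga ge.
have [gA|[p [r [pA rA gE]]]] := covered_edge g; first exact/commute_sym/covered_central.
have pa : p = a.
  move: ga; rewrite inE gE !inE => /orP[/eqP->//|/eqP ar].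
  by rewrite -ar aA in rA.
have rq : r != q.
  apply: contraNneq ge => rq; apply/eqP.
  by apply: (multiplicity1_eq (mA qA aA)); rewrite ?gE ?eE ?pa ?rq setUC.
have rq' : r = q'.
  apply/eqP; apply: contraT => nrq'; move: B2; rewrite leqNgt => /negP[].
  apply: leq_trans (_ : #|[set r; q; q']| <= _).
    by rewrite -setUA cardsU1 cards2 !inE negb_or rq nrq' nq.
  by apply: subset_leq_card; rewrite !subUset !sub1set !inE rA qA q'A.
by apply: (share_commute sol (u := q')); rewrite ?fE ?gE ?rq' !inE eqxx orbT.
Qed.

Definition inner_edges p := [set f in incident p | ends f \subset A].

Definition between p p' := \prod_(f in [set f : edge G | ends f == [set p; p']]) x f.

Lemma between_sym p p' : between p p' = between p' p.
Proof. by rewrite /between setUC. Qed.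

Lemma between_commuting p p' : commuting x [set f : edge G | ends f == [set p; p']].
Proof.
apply: commuting_sub (sol_comm sol (v := p)); apply/subsetP => f.
by rewrite !inE => /eqP->; rewrite !inE eqxx.
Qed.

Lemma between_square p p' : between p p' * between p p' = 1.
Proof.
apply: prodg_involution; first exact: between_commuting.
by move=> f _; apply: (sol_xx sol).
Qed.

Lemma between_commute p p' z : p \in A -> p' \in A ->
  (forall f, ends f \subset A -> commute z (x f)) -> commute z (between p p').
Proof.
move=> pA p'A zf; apply: prodg_commute => f; rewrite inE => /eqP E; apply: zf.
by rewrite E subUset !sub1set pA.
Qed.

Lemma inner_edges_prod p1 p2 p3 : A = [set p1; p2; p3] ->
  p2 != p1 -> p3 != p1 -> p3 != p2 ->
  \prod_(f in inner_edges p1) x f = between p1 p2 * between p1 p3.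
Proof.
move=> AE n21 n31 n32.
have IE : inner_edges p1 =
    [set f | ends f == [set p1; p2]] :|: [set f | ends f == [set p1; p3]].
  apply/setP => f; rewrite !inE; apply/andP/orP => [[f1 fA]|].
    have fi : f \in incident p1 by rewrite inE.
    have [u u1 fE] := ends_other fi.
    have : u \in A by apply: (subsetP fA); rewrite fE !inE eqxx orbT.
    by rewrite AE fE !inE (negbTE u1) => /orP[]/eqP->; [left|right].
  by case=> /eqP->; rewrite !inE eqxx AE subUset !sub1set !inE !eqxx ?orbT.
rewrite IE prodgU //.
  rewrite -IE; apply: commuting_sub (sol_comm sol (v := p1)).
  by apply/subsetP => f; rewrite inE => /andP[].
rewrite disjoints_subset; apply/subsetP => f; rewrite !inE => /eqP E.
apply/negP => /eqP E'; have : p3 \in [set p1; p2] by rewrite -E E' !inE eqxx orbT.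
by rewrite !inE (negbTE n31) (negbTE n32).
Qed.

(** The cover gives the rows of the magic square and the other three vertices its columns. Edges
    inside the cover add a central factor [P] to each row. Each pair of cover vertices enters two of
    these factors, so [P a3 = P a1 * P a2], and the condition on the factors becomes even parity. *)
Lemma three_covered_commutative : #|~: A| = 3 -> parity b = 0%R ->
  forall e f, commute (x e) (x f).
Proof.
move=> B3 par e f.
have [eA|[a1 [q2 [a1A q2A eE]]]] := covered_edge e; first exact: covered_central.
have [fA|[a2 [q1 [a2A q1A fE]]]] := covered_edge f.
  exact/commute_sym/covered_central.
have [qq|nq] := eqVneq q1 q2.
  by apply: (share_commute sol (u := q1)); rewrite ?eE ?fE ?qq !inE eqxx orbT.
have [aa|na] := eqVneq a1 a2.
  by apply: (share_commute sol (u := a1)); rewrite ?eE ?fE ?aa !inE eqxx.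
have [a3 [n31 n32 AE]] := card3_third A3 a1A a2A na.
have [q3 [m31 m32 BE]] : exists q3, [/\ q3 != q1, q3 != q2 & ~: A = [set q1; q2; q3]].
  by apply: card3_third; rewrite ?inE.
have a3A : a3 \in A by rewrite AE !inE eqxx orbT.
have q3A : q3 \notin A by rewrite -in_setC BE !inE eqxx orbT.
pose ed u v : edge G := odflt e [pick g | ends g == [set u; v]].
have edE a q : a \in A -> q \notin A -> ends (ed a q) = [set a; q].
  move=> aA qA; have [g gE] : exists g, ends g = [set a; q].
    by apply: multiplicity_ex; rewrite multiplicity_sym mA.
  by rewrite /ed; case: pickP => [h /eqP //|/(_ g)]; rewrite gE eqxx.
have edC u v : ed u v = ed v u by rewrite /ed setUC.
have edU a q g : a \in A -> q \notin A -> ends g = [set a; q] -> g = ed a q.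
  move=> aA qA gE; apply: (multiplicity1_eq (mA qA aA)); first by rewrite gE setUC.
  by rewrite edE // setUC.
have inB z : z \notin A -> z \in [:: q1; q2; q3].
  by rewrite -in_setC BE !inE -orbA.
have inA z : z \in A -> z \in [:: a1; a2; a3] by rewrite AE !inE -orbA.
pose y a q := x (ed a q).
have row p : p \in A -> y p q3 =
    J ^+ b p * (y p q1 * y p q2 * \prod_(f in inner_edges p) x f).
  move=> pA.
  have qsA v : v \in [:: q3; q1; q2] -> v \notin A.
    by rewrite !inE => /or3P[]/eqP->.
  rewrite /y (@star_value _ _ _ _ _ sol p q3 [:: q1; q2] (ed p) (inner_edges p)).
  - by rewrite !big_cons big_nil mulg1.
  - by rewrite /= !inE negb_or m31 m32 nq.
  - by move=> v /qsA; apply: edE.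
  - by apply/subsetP => g; rewrite inE => /andP[].
  - move=> v /qsA vA; rewrite inE edE // subUset !sub1set (negbTE vA) !andbF //.
  - move=> g gp gQ; have [gA|[a [q [aA qA gE]]]] := covered_edge g.
      by move: gQ; rewrite inE gp gA.
    have ap : a = p.
      move: gp; rewrite inE gE !inE => /orP[/eqP->//|/eqP pq].
      by rewrite pq (negbTE qA) in pA.
    exists q; first by have := inB q qA; rewrite !inE => /or3P[]->; rewrite ?orbT.
    by apply: edU; rewrite // gE ap.
have col q : q \notin A -> y a3 q = J ^+ b q * (y a1 q * y a2 q).
  move=> qA; rewrite /y !(edC _ q).
  have asA v : v \in [:: a3; a1; a2] -> v \in A by rewrite !inE => /or3P[]/eqP->.
  rewrite (@star_value _ _ _ _ _ sol q a3 [:: a1; a2] (ed q) set0).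
  - by rewrite !big_cons big_nil big_set0 !mulg1.
  - by rewrite /= !inE negb_or n31 n32 na.
  - by move=> v /asA vA; rewrite edC edE // setUC.
  - exact: sub0set.
  - by move=> v _; rewrite inE.
  - move=> g gq _; have [gA|[a [r [aA rA gE]]]] := covered_edge g.
      by move: gq; rewrite inE => /(subsetP gA); rewrite (negbTE qA).
    have rq : r = q.
      move: gq; rewrite inE gE !inE => /orP[/eqP qa|/eqP->//].
      by rewrite qa aA in qA.
    exists a; first by have := inA a aA; rewrite !inE => /or3P[]->; rewrite ?orbT.
    by rewrite edC; apply: edU; rewrite // gE rq.
pose P p := \prod_(f in inner_edges p) x f.
have Pc p z : (forall f, ends f \subset A -> commute z (x f)) -> commute z (P p).
  by move=> zf; apply: prodg_commute => g; rewrite inE => /andP[_]; apply: zf.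
have Py p a q : commute (P p) (y a q).
  by apply/commute_sym/Pc => g gA; apply/commute_sym/covered_central.
have PJ p : commute (P p) J by apply/commute_sym/Pc => g _; apply/commute_sym/xJ.
have PJX p n : commute (P p) (J ^+ n) by exact: commuteX.
have Jy n a q : commute (J ^+ n) (y a q) by apply/commute_sym/commuteX/xJ.
have row' p : p \in A -> y p q3 = J ^+ b p * P p * (y p q1 * y p q2).
  move=> pA; rewrite row // -/(P p) -[RHS]mulgA; congr (_ * _).
  have c : commute (P p) (y p q1 * y p q2) by apply: commuteM; apply: Py.
  by rewrite c.
have P123 : P a3 = P a1 * P a2.
  have n21 : a2 != a1 by rewrite eq_sym.
  have n13 : a1 != a3 by rewrite eq_sym.
  have n23 : a2 != a3 by rewrite eq_sym.
  have AE2 : A = [set a2; a1; a3].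
    by rewrite AE; apply/setP => z; rewrite !inE; do 3!case: eqP.
  have AE3 : A = [set a3; a1; a2].
    by rewrite AE; apply/setP => z; rewrite !inE; do 3!case: eqP.
  rewrite /P (inner_edges_prod AE n21 n31 n32) (inner_edges_prod AE2 na n32 n31).
  rewrite (inner_edges_prod AE3 n13 n23 n21).
  rewrite !(between_sym a3) (between_sym a2 a1).
  have c : commute (between a1 a3) (between a1 a2).
    apply: between_commute => // g gA; apply/commute_sym/between_commute => // h hA.
    exact: covered_central.
  rewrite -[RHS]mulgA (mulgA (between a1 a3)) c -!mulgA.
  by rewrite mulgA between_square mul1g.
have eed : e = ed a1 q2 by apply: edU.
have fed : f = ed a2 q1 by apply: edU.
rewrite eed fed.
apply: (@magic_square_commute _ (y a1 q1) (y a1 q2) (y a1 q3) (y a2 q1) (y a2 q2)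
  (y a2 q3) (y a3 q1) (y a3 q2) (y a3 q3) (J ^+ b a1 * P a1) (J ^+ b a2 * P a2)
  (J ^+ b a3 * P a3) (J ^+ b q1) (J ^+ b q2) (J ^+ b q3)).
- exact: row'.
- exact: row'.
- exact: row'.
- exact: col.
- exact: col.
- exact: col.
- exact: commuteM.
- apply/commute_sym; apply: commuteM; apply/commute_sym.
    exact: commuteM.
  exact: commuteM.
rewrite P123.
have bE : (b a3 + b q1 + b q2 = b q3 + b a1 + b a2)%R.
  have us : uniq [:: a1; a2; a3; q1; q2; q3].
    have dq a q : a \in A -> q \notin A -> a != q by move=> aA; apply: contraNneq => <-.
    rewrite /= !inE !negb_or na (eq_sym a1 a3) n31 (eq_sym a2 a3) n32 nq.
    by rewrite (eq_sym q1 q3) m31 (eq_sym q2 q3) m32 !dq.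
  have all6 z : z \in [:: a1; a2; a3; q1; q2; q3].
    rewrite -[[:: a1; _; _; _; _; _]]/([:: a1; a2; a3] ++ [:: q1; q2; q3]) mem_cat.
    by case: (boolP (z \in A)) => [/inA->|/inB->]; rewrite ?orbT.
  move: par; rewrite /parity (sum_seq_all _ us all6) !big_cons big_nil addr0.
  move: (b a1) (b a2) (b a3) (b q1) (b q2) (b q3) => c1 c2 c3 c4 c5 c6.
  by case: (Z2_cases c1) => ->; case: (Z2_cases c2) => ->; case: (Z2_cases c3) => ->;
     case: (Z2_cases c4) => ->; case: (Z2_cases c5) => ->; case: (Z2_cases c6) => ->;
     move=> /(congr1 val) //= _; apply: val_inj.
have cL : J ^+ b a3 * (P a1 * P a2) * J ^+ b q1 * J ^+ b q2 =
    J ^+ (b a3 + b q1 + b q2)%R * (P a1 * P a2).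
  have cPP n : commute (P a1 * P a2) (J ^+ n).
    by apply/commute_sym; apply: commuteM; apply/commute_sym.
  have cc : commute (P a1 * P a2) (J ^+ b q1 * J ^+ b q2) by apply: commuteM; apply: cPP.
  by rewrite !expg_Z2D // -(mulgA (_ * _)) -(mulgA (J ^+ b a3)) cc !mulgA.
have cR : J ^+ b q3 * (J ^+ b a1 * P a1) * (J ^+ b a2 * P a2) =
    J ^+ (b q3 + b a1 + b a2)%R * (P a1 * P a2).
  rewrite !expg_Z2D // !mulgA; congr (_ * _).
  by rewrite -!mulgA PJX.
by rewrite cL cR bE.
Qed.

End ThreeCovered.

(** * Finding K5 and K_{3,n} as minors *)

Section PushForward.

Variables (G H : mgraph) (b : colouring G) (phi : vertex G -> vertex H).

Definition push_colouring : colouring H := fun h => (\sum_(v | phi v == h) b v)%R.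

Lemma push_parity : parity push_colouring = parity b.
Proof. by rewrite /parity [RHS](partition_big phi xpredT). Qed.

End PushForward.

Lemma complete5_minor (G : mgraph) (b : colouring G) : complete5 (@multiplicity G) ->
  exists2 c : colouring (Kn 5), parity c = parity b & cgraph_minor (CGraph c) (CGraph b).
Proof.
case=> V5 m1.
pose phi (v : vertex G) : vertex (Kn 5) := cast_ord V5 (enum_rank v).
have phiI : injective phi by move=> u v /cast_ord_inj/enum_rank_inj.
pose phi' (i : 'I_5) : vertex G := enum_val (cast_ord (esym V5) i).
have phi'K i : phi (phi' i) = i by rewrite /phi enum_valK cast_ordKV.
have ex (e : edge (Kn 5)) : exists f : edge G, [set phi v | v in ends f] = ends e.
  have [i [j [ij E]]] := ends2 e.
  have nij : phi' i != phi' j.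
    by apply: contraNneq ij => /(congr1 phi); rewrite !phi'K => ->.
  have [f fE] : exists f, ends f = [set phi' i; phi' j].
    by apply: multiplicity_ex; rewrite m1.
  by exists f; rewrite fE E imsetU1 imset_set1 !phi'K.
have [psi psiE] := fin_all_exists ex.
exists (push_colouring b phi); first exact: push_parity.
apply: (@model_minor _ _ _ _ phi psi) => //.
- by move=> e f E; apply: val_inj; rewrite -[LHS](psiE e) -[RHS](psiE f) E.
- by move=> i; exists (phi' i).
- by move=> u v /phiI->; apply: connect0.
Qed.

Section CoveredMinor.

Variables (G : mgraph) (b : colouring G) (n : nat).
Variables (alpha : 'I_3 -> vertex G) (beta : 'I_n -> vertex G).
Hypotheses (alphaI : injective alpha) (betaI : injective beta).
Hypothesis alpha_beta : forall i j, alpha i != beta j.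
Hypothesis mab : forall i j, 0 < multiplicity (alpha i) (beta j).
Hypothesis near0 : forall v, (forall i, alpha i != v) -> adjacent v (alpha ord0).

(** The vertices outside both families are adjacent to [alpha ord0] and join its branch set, so the
    branch sets cover [G] and the parity is kept. *)
Lemma covered_minor : exists2 c : colouring (Kmn 3 n),
  parity c = parity b & cgraph_minor (CGraph c) (CGraph b).
Proof.
pose phi (v : vertex G) : vertex (Kmn 3 n) :=
  if [pick j | beta j == v] is Some j then inr j else
  inl (odflt ord0 [pick i | alpha i == v]).
have phib j : phi (beta j) = inr j.
  rewrite /phi; case: pickP => [k /eqP/betaI->//|/(_ j)]; by rewrite eqxx.
have phia i : phi (alpha i) = inl i.
  rewrite /phi; case: pickP => [k|_].
    by rewrite eq_sym (negbTE (alpha_beta i k)).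
  by case: pickP => [k /eqP/alphaI->//|/(_ i)]; rewrite eqxx.
have phiP v : [\/ exists j, v = beta j, exists i, v = alpha i
    | phi v = inl ord0 /\ forall i, alpha i != v].
  rewrite /phi; case: pickP => [j /eqP<-|_]; first by constructor 1; exists j.
  case: pickP => [i /eqP<-|no]; first by constructor 2; exists i.
  by constructor 3; split=> // i; rewrite no.
have ex (e : edge (Kmn 3 n)) : exists f : edge G, [set phi v | v in ends f] = ends e.
  case: e => i j; have [f fE] := multiplicity_ex (mab i j).
  by exists f; rewrite fE imsetU1 imset_set1 phia phib.
have [psi psiE] := fin_all_exists ex.
exists (push_colouring b phi); first exact: push_parity.
have endsI (e f : edge (Kmn 3 n)) : ends e = ends f -> e = f.
  case: e f => i j [i' j'] /= E.
  have : inl i \in Kmn_ends (i', j') by rewrite -E !inE eqxx.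
  have : inr j \in Kmn_ends (i', j') by rewrite -E !inE eqxx orbT.
  by rewrite !inE orbF => /eqP[->] /eqP[->].
apply: (@model_minor _ _ _ _ phi psi) => //.
- by move=> e f E; apply: endsI; rewrite -(psiE e) -(psiE f) E.
- by case=> [i|j]; [exists (alpha i) | exists (beta j)].
set r := fun _ _ => _.
have near v : (forall i, alpha i != v) -> phi v = inl ord0 ->
    connect r v (alpha ord0) /\ connect r (alpha ord0) v.
  move=> no pv; have adj := near0 no.
  split; apply: connect1; rewrite /r pv phia eqxx //=.
  by case/existsP: adj => e E; apply/existsP; exists e; rewrite setUC.
move=> u v; case: (phiP u) => [[j ->]|[i ->]|[pu nu]];
  case: (phiP v) => [[j' ->]|[i' ->]|[pv nv]]; rewrite ?phia ?phib ?pu ?pv //.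
- by case=> ->; apply: connect0.
- by case=> ->; apply: connect0.
- by case=> ->; case: (near v nv pv).
- by case=> <-; case: (near u nu pu).
- by move=> _; apply: connect_trans (near u nu pu).1 (near v nv pv).2.
Qed.

End CoveredMinor.

Lemma three_covered_minor (G : mgraph) (b : colouring G) (v w c : vertex G) n :
  v != w -> v != c -> w != c ->
  (forall q, q \notin [set v; w; c] ->
    [/\ multiplicity q v = 1%N, multiplicity q w = 1%N & multiplicity q c = 1%N]) ->
  n <= #|~: [set v; w; c]| ->
  exists2 d : colouring (Kmn 3 n), parity d = parity b & cgraph_minor (CGraph d) (CGraph b).
Proof.
move=> vw vc wc cov len; set A := [set v; w; c] in cov len.
pose s := [:: v; w; c]; pose t := enum (~: A).
have us : uniq s by rewrite /= !inE !negb_or vw vc wc.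
have st : size t = #|~: A| by rewrite -cardE.
have sA z : (z \in s) = (z \in A) by rewrite !inE -orbA.
pose alpha (i : 'I_3) := nth v s i; pose beta (j : 'I_n) := nth v t j.
have alphaA i : alpha i \in A by rewrite -sA mem_nth.
have ltj (j : 'I_n) : j < size t by rewrite st; apply: leq_trans len.
have betaA j : beta j \notin A.
  by have := mem_nth v (ltj j); rewrite mem_enum inE.
have mqa q a : q \notin A -> a \in A -> multiplicity q a = 1%N.
  by move=> /cov[qv qw qc]; rewrite !inE => /orP[/orP[]|]/eqP->.
apply: (@covered_minor G b n alpha beta).
- move=> i i' /eqP; rewrite nth_uniq // => /eqP; exact: val_inj.
- move=> j j' /eqP; rewrite nth_uniq ?enum_uniq // => /eqP; exact: val_inj.
- by move=> i j; apply: contraNneq (betaA j) => <-.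
- by move=> i j; rewrite multiplicity_sym mqa.
- move=> u no; have uA : u \notin A.
    rewrite -sA; apply/negP => /(nthP v)[i lti iE].
    by have := no (Ordinal lti); rewrite /alpha /= iE eqxx.
  have [|e E] := @multiplicity_ex G u (alpha ord0); first by rewrite mqa.
  by apply/existsP; exists e; rewrite E.
Qed.

Lemma three_covered_case (G : mgraph) (b : colouring G) :
  three_covered (@multiplicity G) ->
  (forall c : colouring (Kmn 3 3), parity c = 1%R -> ~ cgraph_minor (CGraph c) (CGraph b)) ->
  (forall c : colouring (Kmn 3 4), parity c = 0%R -> ~ cgraph_minor (CGraph c) (CGraph b)) ->
  commutative_solutions b.
Proof.
case=> v [w [c [vw vc wc cov]]] no33 no34 gT x J sol.
set A := [set v; w; c] in cov.
have A3 : #|A| = 3 by rewrite /A -setUA cardsU1 cards2 !inE negb_or vw vc wc.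
have cov' q : q \notin A ->
    [/\ multiplicity q v = 1%N, multiplicity q w = 1%N & multiplicity q c = 1%N].
  by case/cov.
have mA q a : q \notin A -> a \in A -> multiplicity q a = 1%N.
  by move=> /cov[qv qw qc _]; rewrite !inE => /orP[/orP[]|]/eqP->.
have mB q q' : q \notin A -> q' \notin A -> multiplicity q q' = 0%N.
  by move=> /cov[_ _ _]; apply.
have mnr n := @three_covered_minor G b v w c n vw vc wc cov'.
case: (leqP #|~: A| 2) => [le2|ge3]; first exact: (few_covered_commutative A3 mA mB sol).
case: (Z2_cases (parity b)) => par; last first.
  by have [d dp /no33] := mnr 3 ge3; case; rewrite dp.
case: (leqP 4 #|~: A|) => [ge4|lt4].
  by have [d dp /no34] := mnr 4 ge4; case; rewrite dp.
apply: (three_covered_commutative A3 mA mB sol) => //.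
by apply/eqP; rewrite eqn_leq ge3 andbT -ltnS.
Qed.

(** * Contraction at a vertex of degree at most two *)

Section Restriction.

Variables (G : mgraph) (b : colouring G) (e : edge G) (v w : vertex G).
Hypotheses (vw : v != w) (ee : ends e = [set v; w]).
Hypothesis simple : forall f, ends f = ends e -> f = e.
Hypothesis deg2 : #|incident v| <= 2.
Variables (gT : groupType) (x : edge G -> gT) (J : gT).
Hypothesis sol : solution b x J.

Let ev : e \in incident v. Proof. by rewrite inE ee !inE eqxx. Qed.
Let ew : e \in incident w. Proof. by rewrite inE ee !inE eqxx orbT. Qed.

(** Only [e] and [f] meet [v], so the relation there makes [x f] equal to [x e] up to a power of
    [J], and [e] meets every edge at [w]. *)
Lemma small_vertex_commute f g : f \in incident v -> f != e -> g \in incident w ->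
  commute (x g) (x f).
Proof.
move=> fv fe gw; apply: (vertex_commute sol fv); first exact: (sol_xJ sol).
move=> h hv hf; have -> : h = e; last exact: (sol_comm sol gw ew).
apply/eqP; apply: contraT => he; move: deg2; rewrite leqNgt => /negP[].
apply: leq_trans (_ : #|[set e; f; h]| <= _).
  by rewrite -setUA cardsU1 cards2 !inE negb_or ![e == _]eq_sym fe he eq_sym hf.
by apply: subset_leq_card; rewrite !subUset !sub1set ev fv.
Qed.

(** The merged vertex requires the edges at [v] to commute with those at [w], which is where the
    small degree enters. In the product around it the factors [x e] from the two ends cancel; a
    parallel of [e] would be lost from this product, whence the assumption [simple]. *)
Lemma restrict_solution :
  solution (contract_col b e) (fun f : edge (contract e) => x (val f)) J.
Proof.
have ne (f : contr_edge e) : val f != e.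
  by apply/eqP => fe; have := valP f; rewrite /= fe eqxx.
have cv (o : vertex (contract e)) :
    commuting (fun f : edge (contract e) => x (val f)) (incident o).
  case: o => [[u ue]|] f g.
    by rewrite !(contr_incident_out ue); apply: (sol_comm sol).
  rewrite !(contr_incident_new ee) => /orP[] fi /orP[] gi.
  - exact: (sol_comm sol fi gi).
  - exact/commute_sym/small_vertex_commute.
  - exact: small_vertex_commute.
  - exact: (sol_comm sol fi gi).
split=> [|f|f|//|o].
- exact: sol_JJ sol.
- exact: sol_xx sol _.
- exact: sol_xJ sol _.
have reidx (D : {set edge G}) (D' : {set contr_edge e}) : commuting x D ->
    (forall f, f \in D -> ends f != ends e) ->
    (forall f : contr_edge e, (f \in D') = (val f \in D)) ->
    \prod_(f in D') x (val f) = \prod_(f in D) x f.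
  move=> cD De DE; apply/esym/(prodg_reindex (h := val)) => //.
    by move=> f g _ _; apply: val_inj.
  apply/setP => f; apply/imsetP/idP => [[g]|fD]; first by rewrite DE => gD ->.
  by exists (Sub f (De f fD)); rewrite ?DE SubK.
case: o => [[u ue]|].
  rewrite (reidx (incident u)).
  - exact: (sol_vertex sol).
  - exact: (sol_comm sol).
  - by move=> f; rewrite inE => uf; apply: contraNneq ue => <-.
  - by move=> f; rewrite (contr_incident_out ue).
pose E u := [set f : contr_edge e | val f \in incident u].
have EE u : u \in ends e -> \prod_(f in E u) x (val f) = J ^+ b u * x e.
  move=> ue; have eu : e \in incident u by rewrite inE.
  rewrite (reidx (incident u :\ e)).
  - rewrite {1}(edge_value sol eu) mulgA -expg_Z2D ?(sol_JJ sol) //.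
    by rewrite Z2_addrr expg0 mul1g.
  - by apply: commuting_sub (sol_comm sol (v := u)); apply: subsetDl.
  - by move=> f; rewrite !inE => /andP[+ _]; apply: contraNneq => /simple->.
  - by move=> f; rewrite !inE ne.
have IE : incident (None : vertex (contract e)) = E v :|: E w.
  by apply/setP => f; rewrite (contr_incident_new ee) !inE.
rewrite IE prodgU -?IE //; last first.
  rewrite disjoints_subset; apply/subsetP => f; rewrite [f \in E v]inE => fv.
  by rewrite inE; apply/negP; rewrite inE => /(contr_not_both vw ee fv).
rewrite !EE ?ee ?inE ?eqxx ?orbT // (contract_col_new b vw ee) expg_Z2D ?(sol_JJ sol) //.
have c : commute (x e) (J ^+ b w) by apply/commuteX/(sol_xJ sol).
by rewrite -mulgA (mulgA (x e)) c -(mulgA (J ^+ b w)) (sol_xx sol) mulg1.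
Qed.

Lemma restrict_commutative : commutative_solutions (contract_col b e) ->
  forall f g, commute (x f) (x g).
Proof.
move=> /(_ _ _ _ restrict_solution) cc.
have c f g : f != e -> g != e -> commute (x f) (x g).
  have ne h : h != e -> ends h != ends e by apply: contraNneq => /simple->.
  move=> /ne fe /ne ge; have := cc (Sub f fe) (Sub g ge); by rewrite !SubK.
have ce f : f != e -> commute (x f) (x e).
  move=> fe; apply: (vertex_commute sol ev); first exact: (sol_xJ sol).
  by move=> g _ ge; apply: c.
move=> f g; have [->|fe] := eqVneq f e; have [->|ge] := eqVneq g e.
- exact: commute_refl.
- exact/commute_sym/ce.
- exact: ce.
- exact: c.
Qed.

End Restriction.

Definition avoids (G : mgraph) (b : colouring G) :=
  [/\ forall b' : colouring (Kmn 3 3), parity b' = 1%R ->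
        ~ cgraph_minor (CGraph b') (CGraph b),
      forall b' : colouring (Kn 5), parity b' = 1%R ->
        ~ cgraph_minor (CGraph b') (CGraph b),
      forall b' : colouring (Kmn 3 4), parity b' = 0%R ->
        ~ cgraph_minor (CGraph b') (CGraph b)
    & forall b' : colouring (disj_union C2 C2),
        ~ cgraph_minor (CGraph b') (CGraph b)].

Lemma avoids_contract (G : mgraph) (b : colouring G) (e : edge G) :
  avoids b -> avoids (contract_col b e).
Proof.
have st := step_contract b e.
case=> h1 h2 h3 h4; split=> b' => [pb|pb|pb|] mb.
- exact: (h1 b' pb (minor_trans_step st mb)).
- exact: (h2 b' pb (minor_trans_step st mb)).
- exact: (h3 b' pb (minor_trans_step st mb)).
- exact: (h4 b' (minor_trans_step st mb)).
Qed.

Lemma avoids_ndc (G : mgraph) (b : colouring G) :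
  connected_graph G -> avoids b -> no_disjoint_cycles (@multiplicity G).
Proof.
move=> conn [_ _ _ h4] X Y cX cY; apply/negP => dXY.
by have [b' /h4] := disjoint_cycles_minor b conn cX cY dXY.
Qed.

(** This covers the edges that are not contracted. The parallel pair exhausts the degree of [v], so
    [v] is isolated once [w] is deleted, and the remaining vertices are acyclic because they avoid
    the digon. *)
Lemma digon_almost_forest (G : mgraph) (e f : edge G) (v w : vertex G) :
  no_disjoint_cycles (@multiplicity G) -> ends e = [set v; w] -> f != e ->
  ends f = ends e -> #|incident v| <= 2 -> almost_forest (@multiplicity G).
Proof.
move=> ndc eE fe fE deg2; have vw := ends_neq eE.
have ef : e != f by rewrite eq_sym.
have ac := ndc_acyclic ndc (parallel_cyclic ef fE); rewrite eE in ac.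
exists w; have -> : ~: [set w] = v |: ~: [set v; w].
  by apply/setP => z; rewrite !inE negb_or; case: (eqVneq z v) => [->|].
have vN : v \notin ~: [set v; w] by rewrite !inE eqxx.
case: (acyclic_or (@multiplicity G) (v |: ~: [set v; w])) => // /(extend_acyclic
  (multiplicity_sym (G := G)) (multiplicity_irr (G := G)) ac vN)[T [sT _ _ gt1]].
have m2 : 2 <= multiplicity v w.
  apply: leq_trans (_ : #|[set e; f]| <= _); first by rewrite cards2 ef.
  by apply: subset_leq_card; rewrite subUset !sub1set !inE fE eE eqxx.
have wT : w \notin T by apply/negP => /(subsetP sT); rewrite !inE eqxx orbT.
have := edges_to_sub (@multiplicity G) v (subsetT (w |: T)).
rewrite edges_toU1 // degree_card => le.
by move: le deg2 m2 gt1; clear; lia.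
Qed.

Lemma avoids_commutative (G : mgraph) (b : colouring G) :
  connected_graph G -> avoids b -> commutative_solutions b.
Proof.
have [n] := ubnP #|vertex G|; elim: n G b => // n IHn G b; rewrite ltnS => ltn conn av.
move=> gT x J sol e0.
have ndc := avoids_ndc conn av.
have [u0 [w0 [uw0 e0E]]] := ends2 e0.
case: (boolP [exists v : vertex G, #|incident v| <= 2]) => [/existsP[v deg2]|/existsPn deg3].
  (* The two ends of [e0] show that [v] is not the only vertex, so connectedness provides an edge at
     [v]. *)
  have [e ev] : exists e, e \in incident v.
    have [u uv] : exists u, u \notin [set v].
      have [<-|uv] := eqVneq u0 v; first by exists w0; rewrite inE eq_sym.
      by exists u0; rewrite inE.
    have vv : v \in [set v] by rewrite inE.
    have [p [q [pv qv /existsP[e /eqP E]]]] := connect_exit (conn v u) vv uv.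
    by exists e; move: pv; rewrite !inE E => /eqP->; rewrite !inE eqxx.
  have [w wv eE] := ends_other ev.
  case: (boolP [exists f, (f != e) && (ends f == ends e)]) => [|/existsPn nopar].
    case/existsP=> f /andP[fe /eqP fE].
    exact/(almost_forest_commutative sol)/(digon_almost_forest ndc eE fe fE deg2).
  have simple f : ends f = ends e -> f = e.
    by move=> fE; have := nopar f; rewrite fE eqxx andbT negbK => /eqP.
  have vw : v != w by rewrite eq_sym.
  apply: (restrict_commutative vw eE simple deg2 sol).
  apply: IHn.
  - exact: leq_trans (contract_vertex_card e) ltn.
  - exact: contract_connected.
  - exact: avoids_contract.
have deg3' v : 2 < edges_to (@multiplicity G) v setT.
  by rewrite degree_card ltnNge.
have V0 : 0 < #|vertex G| by apply/card_gt0P; exists u0.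
case: av => no33 no5 no34 _.
have [af|wh|k5|tc] := no_disjoint_cycles_cases (multiplicity_sym (G := G))
  (multiplicity_irr (G := G)) deg3' ndc V0.
- exact: almost_forest_commutative sol af e0.
- exact: wheel_commutative sol ndc wh e0.
- have [c cp mc] := complete5_minor b k5.
  case: (Z2_cases (parity b)) => par; first exact: complete5_commutative sol k5 par e0.
  by case: (no5 c); rewrite ?cp.
- exact: (three_covered_case tc no33 no34 sol).
Qed.

Theorem theorem1p5 (G : mgraph) (b : colouring G) (Gconn : connected_graph G) :
  (forall x y : Gamma b, (x * y = y * x)%g) <->
  [/\ forall b' : colouring (Kmn 3 3), parity b' = 1%R ->
        ~ cgraph_minor (CGraph b') (CGraph b),
      forall b' : colouring (Kn 5), parity b' = 1%R ->
        ~ cgraph_minor (CGraph b') (CGraph b),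
      forall b' : colouring (Kmn 3 4), parity b' = 0%R ->
        ~ cgraph_minor (CGraph b') (CGraph b)
    & forall b' : colouring (disj_union C2 C2),
        ~ cgraph_minor (CGraph b') (CGraph b)].
Proof.
split=> [/Gamma_commutativeP cG|av]; last first.
  exact/Gamma_commutativeP/avoids_commutative.
split=> b' => [pb|pb|pb|] /cgraph_minor_commutative/(_ cG).
- exact: K33_noncommutative.
- exact: K5_noncommutative.
- exact: K34_noncommutative.
- exact: C2C2_noncommutative.
Qed.
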